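(* (a) Fine shape is stronger than shape: there is a functor $\mathcal F^{\mathrm{Fish}}_{\mathrm{Sh}}$ from the fine shape category to the shape category of metrizable spaces which sends every object to itself, and the forgetful functor from the homotopy category of metrizable spaces to the shape category is the composition of $\mathcal F^{\mathrm{Ho}}_{\mathrm{Fish}}$ and $\mathcal F^{\mathrm{Fish}}_{\mathrm{Sh}}$. (b) Fine shape is stronger than antishape: there is a functor $\mathcal F^{\mathrm{Fish}}_{\mathrm{Ash}}$ from the fine shape category to the antishape category which sends every object to itself, and the forgetful functor from the homotopy category of metrizable spaces to the antishape category is the composition of $\mathcal F^{\mathrm{Ho}}_{\mathrm{Fish}}$ and $\mathcal F^{\mathrm{Fish}}_{\mathrm{Ash}}$.
   Context: Maps are continuous, $I=[0,1]$. Absolute retracts (ARs) and ANRs are those for metrizable spaces. A closed subset $X$ of an AR $M$ is a Z-set if there is a homotopy $h_t\colon M\to M$ with $h_0=\mathrm{id}$ and $h_t(M)\subset M\setminus X$ for $t>0$. Every metrizable space embeds as a Z-set in some AR. Fine shape category. If $X\subset M$ and $Y\subset N$ are closed subsets of metrizable spaces, a map $f\colon M\setminus X\to N\setminus Y$ is $X$-$Y$-approaching if it sends every sequence having a cluster point in $X$ to a sequence having a cluster point in $Y$. An $X$-$Y$-approaching homotopy is a homotopy $(M\setminus X)\times I\to N\setminus Y$ that is an $(X\times I)$-$Y$-approaching map. If $X$, $Y$ are Z-sets in ARs $M$, $N$ and $\varphi\colon X\to Y$ is a map, $\varphi_{MN}\colon M\setminus X\to N\setminus Y$ denotes an $X$-$Y$-approaching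 map combining with $\varphi$ into a continuous map $M\to N$ (it exists and is unique up to $X$-$Y$-approaching homotopy). The objects of the fine shape category are metrizable spaces. $X$-$Y$-approaching maps $\Phi\colon M\setminus X\to N\setminus Y$ and $\Phi'\colon M'\setminus X\to N'\setminus Y$ (with $X$ a Z-set in ARs $M,M'$ and $Y$ a Z-set in ARs $N,N'$) represent the same fine shape morphism $X\to Y$ if $(\mathrm{id}_Y)_{NN'}\Phi$ and $\Phi'(\mathrm{id}_X)_{MM'}$ are $X$-$Y$-approaching homotopic; fine shape morphisms are the equivalence classes, and composition is induced by composition of representatives $M\setminus X\to N\setminus Y\to L\setminus Z$. The functor $\mathcal F^{\mathrm{Ho}}_{\mathrm{Fish}}$ from the homotopy category of metrizable spaces to the fine shape category is the identity on objects and sends $[\varphi]$ to the class of $\varphi_{MN}$. Shape category. For inverse systems $\mathbf X=(X_\lambda,p_{\lambda\lambda'};\Lambda)$ and $\mathbf Y=(Y_\mu,q_{\mu\mu'};\mathrm M)$ over directed posets, the set of $\mathrm{pro}$-$\mathrm{Ho}$ morphisms is $\lim_\mu\mathrm{colim}_\lambda[X_\lambda,Y_\mu]$. An ANR resolution of a metrizable space $X$ is an inverse system $\mathbf X$ of ANRs with compatible maps $p=(p_\lambda\colon X\to X_\lambda)$ (so $p_{\lambda\lambda'}p_{\lambda'}=p_\lambda$ for $\lambda\le\lambda'$) such that for every ANR $P$ and every open cover $\mathcal V$ of $P$: (R1) for every map $f\colon X\to P$ there are $\lambda$ and $h\colon X_\lambda\to P$ with $hp_\lambda$ and $f$ $\mathcal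 V$-near; (R2) there is an open cover $\mathcal V'$ of $P$ such that if $h,h'\colon X_\lambda\to P$ are maps with $hp_\lambda$, $h'p_\lambda$ $\mathcal V'$-near, then $hp_{\lambda\lambda'}$, $h'p_{\lambda\lambda'}$ are $\mathcal V$-near for some $\lambda'\ge\lambda$. Every metrizable space has an ANR resolution (e.g. by all its open neighborhoods in an AR containing it as a closed subset), and given ANR resolutions $p\colon X\to\mathbf X$, $q\colon Y\to\mathbf Y$ and a map $f\colon X\to Y$, there is a unique $\mathrm{pro}$-$\mathrm{Ho}$ morphism $F\colon\mathbf X\to\mathbf Y$ with $F[p]=[q][f]$. A shape morphism $X\to Y$ is an equivalence class of $\mathrm{pro}$-$\mathrm{Ho}$ morphisms between ANR resolutions of $X$ and of $Y$, where $F\colon\mathbf X\to\mathbf Y$ and $F'\colon\mathbf X'\to\mathbf Y'$ are equivalent if they correspond under the canonical isomorphisms $\mathbf X\cong\mathbf X'$, $\mathbf Y\cong\mathbf Y'$ induced by $\mathrm{id}_X$, $\mathrm{id}_Y$. The forgetful functor from the homotopy category is the identity on objects and sends the homotopy class $[f]$ of a map $f\colon X\to Y$ to the class of the unique $\mathrm{pro}$-$\mathrm{Ho}$ morphism $F\colon\mathbf X\to\mathbf Y$ with $F[p]=[q][f]$, where $p\colon X\to\mathbf X$ and $q\colon Y\to\mathbf Y$ are ANR resolutions. Antishape category. For compacta (= compact metrizable spaces) $K$, $L$, a strong shape morphism $K\to L$ is a proper homotopy class of proper maps $P\setminus K\to Q\setminus L$, where $P$, $Q$ are compact ARs (e.g.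 Hilbert cubes) containing $K$, $L$ as Z-sets; up to canonical bijections this does not depend on $P$, $Q$. Let $[K,L]_{\mathrm{Ssh}}$ be the set of strong shape morphisms; a map $K\to L$ induces a strong shape morphism by extending it to a map $P\to Q$ sending $P\setminus K$ into $Q\setminus L$. The antishape category has metrizable spaces as objects, and the set of antishape morphisms $X\to Y$ is $[X,Y]_{\mathrm{Ash}}=\lim_K\mathrm{colim}_L[K,L]_{\mathrm{Ssh}}$, where $K$ and $L$ run over the posets of compact subsets of $X$ and of $Y$ ordered by inclusion (i.e. ind-category morphisms between the direct systems of compact subsets); composition is that of the ind-category. The forgetful functor from the homotopy category is the identity on objects and sends $[f]$ to the class of the family of strong shape morphisms induced by $f|_K\colon K\to f(K)$. *)

(* Defs.v *)
From HB Require Import structures.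
From mathcomp Require Import all_boot all_order all_algebra.
From mathcomp Require Import all_classical all_reals topology.

Set Implicit Arguments.
Unset Strict Implicit.
Unset Printing Implicit Defensive.

Import Order.TTheory GRing.Theory Num.Theory.
Import numFieldTopology.Exports.

Local Open Scope classical_set_scope.
Local Open Scope ring_scope.

(* A category with class of objects [O], presented by its data.  The set of
   morphisms x -> y is [mor x y], a subset of an ambient type [arr x y]; only
   elements of [mor x y] are meaningful.  The ambient type is there because
   below a morphism is an equivalence class of representatives, and a composite
   is written down as a set of representatives. *)
Record cat_data (O : Type) := CatData {
  arr : O -> O -> Type;
  mor : forall x y, arr x y -> Prop;
  idm : forall x, arr x x;
  cmp : forall x y z, arr y z -> arr x y -> arr x z }.
Arguments mor {O c x y}.
Arguments idm {O c} x.
Arguments cmp {O c x y z}.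

(* A functor which is the identity on objects. *)
Record is_functor (O : Type) (C D : cat_data O)
    (F : forall x y, arr C x y -> arr D x y) : Prop := IsFunctor {
  functor_mor : forall x y (a : arr C x y), mor a -> mor (F x y a);
  functor_id : forall x, F x x (idm x) = idm x;
  functor_cmp : forall x y z (b : arr C y z) (a : arr C x y),
    mor b -> mor a -> F x z (cmp b a) = cmp (F y z b) (F x y a) }.

(* Morphisms are the [eqv]-classes of representatives.  A representative may be
   composable with only some representatives of a composable class:
   [rcmp b a c] means that c is the composite of b and a.  Similarly
   [rid x r] means that r represents the identity of x. *)
Definition class_cat (O : Type) (rep : O -> O -> Type)
    (eqv : forall x y, rep x y -> rep x y -> Prop)
    (rid : forall x, rep x x -> Prop)
    (rcmp : forall x y z, rep y z -> rep x y -> rep x z -> Prop) :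
    cat_data O :=
  {| arr := fun x y => rep x y -> Prop;
     mor := fun x y A => exists r, A = eqv x y r;
     idm := fun x s => exists r, rid x r /\ eqv x x r s;
     cmp := fun x y z B A s =>
       exists b a c, [/\ B b, A a, rcmp x y z b a c & eqv x z c s] |}.

Definition ctsid (X : topologicalType) : continuousType X X :=
  [the continuousType X X of idfun].
Definition ctscomp (X Y Z : topologicalType) (g : continuousType Y Z)
    (f : continuousType X Y) : continuousType X Z :=
  [the continuousType X Z of g \o f].

Section FineShape.
Variable R : realType.

Definition metrizable (T : topologicalType) : Prop :=
  exists d : T -> T -> R,
    [/\ forall x y, d x y = 0 <-> x = y,
        forall x y, d x y = d y x,
        forall x y z, d x z <= d x y + d y z &
        forall x, nbhs x =
          filter_from [set e : R | 0 < e] (fun e => [set y | d x y < e])].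

Record metrSpace := MetrSpace {
  ms_space :> topologicalType;
  ms_metrizable : metrizable ms_space }.

Definition unit_interval : set R := `[0, 1]%classic.
Notation I := (set_type unit_interval).

Lemma unit0_proof : (0 : R) \in unit_interval.
Proof. by rewrite inE /unit_interval /= in_itv /= lexx ler01. Qed.
Lemma unit1_proof : (1 : R) \in unit_interval.
Proof. by rewrite inE /unit_interval /= in_itv /= lexx ler01. Qed.
Definition I0 : I := exist _ 0 unit0_proof.
Definition I1 : I := exist _ 1 unit1_proof.

Definition homotopic (X Y : topologicalType) (f g : continuousType X Y) :=
  exists H : continuousType (X * I)%type Y,
    (forall x, H (x, I0) = f x) /\ (forall x, H (x, I1) = g x).

Definition closed_embedding (X M : topologicalType) (i : X -> M) :=
  [/\ injective i, continuous i & forall A, closed A -> closed (i @` A)].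

Definition AR (M : topologicalType) :=
  metrizable M /\
  forall (N : topologicalType) (e : M -> N),
    metrizable N -> closed_embedding e ->
    exists r : continuousType N M, forall x, r (e x) = x.

Definition ANR (M : topologicalType) :=
  metrizable M /\
  forall (N : topologicalType) (e : M -> N),
    metrizable N -> closed_embedding e ->
    exists U : set N, [/\ open U, range e `<=` U &
      exists r : continuousType (set_type U) M,
        forall (u : U) x, val u = e x -> r u = x].

Definition Zset (M : topologicalType) (X : set M) :=
  closed X /\
  exists h : continuousType (M * I)%type M,
    (forall x, h (x, I0) = x) /\
    (forall x (t : I), 0 < val t -> ~ X (h (x, t))).

(* X as a Z-set of an AR; "X is a subset of M" is a closed embedding. *)
Record zpair (X : topologicalType) := ZPair {
  zspace :> topologicalType;
  zincl : X -> zspace;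
  z_AR : AR zspace;
  z_emb : closed_embedding zincl;
  z_Zset : Zset (range zincl) }.
Arguments zincl {X}.

(* M \ X, with the subspace topology *)
Definition zcompl (X : topologicalType) (M : zpair X) : set M :=
  ~` range (zincl M).
Arguments zcompl {X} M _.

(* [f] together with a map [phi : X -> Y] make up a continuous map M -> N *)
Definition combines (X Y : topologicalType) (M : zpair X) (N : zpair Y)
    (phi : continuousType X Y) (f : zcompl M -> zcompl N) :=
  exists F : continuousType M N,
    (forall x, F (zincl M x) = zincl N (phi x)) /\
    (forall u : zcompl M, F (val u) = val (f u)).

(* With a, b the inclusions of U = M \ A and V = N \ B, f is A-B-approaching. *)
Definition approaching (U M V N : topologicalType)
    (a : U -> M) (A : set M) (b : V -> N) (B : set N) (f : U -> V) :=
  forall u : nat -> U,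
    (exists2 x, A x & cluster ((a \o u) @ \oo) x) ->
    (exists2 y, B y & cluster ((b \o f \o u) @ \oo) y).

Definition z_approaching (X Y : topologicalType) (M : zpair X) (N : zpair Y)
    (f : zcompl M -> zcompl N) :=
  approaching (fun u : zcompl M => val u : M) (range (zincl M))
              (fun v : zcompl N => val v : N) (range (zincl N)) f.

Record appr (X Y : topologicalType) (M : zpair X) (N : zpair Y) := Appr {
  appr_map :> continuousType (zcompl M) (zcompl N);
  appr_approaching : z_approaching appr_map }.

Lemma appr_id_proof (X : topologicalType) (M : zpair X) :
  z_approaching (ctsid (zcompl M)).
Proof. by move=> u. Qed.
Definition appr_id (X : topologicalType) (M : zpair X) : appr M M :=
  Appr (@appr_id_proof X M).

Lemma appr_comp_proof (X Y Z : topologicalType) (M : zpair X) (N : zpair Y)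
  (L : zpair Z) (g : appr N L) (f : appr M N) : z_approaching (ctscomp g f).
Proof.
by move=> u /(appr_approaching f)/(@appr_approaching _ _ _ _ g (f \o u)).
Qed.
Definition appr_comp (X Y Z : topologicalType) (M : zpair X) (N : zpair Y)
    (L : zpair Z) (g : appr N L) (f : appr M N) : appr M L :=
  Appr (appr_comp_proof g f).

Definition appr_homotopic (X Y : topologicalType) (M : zpair X) (N : zpair Y)
    (f g : appr M N) :=
  exists H : continuousType (zcompl M * I)%type (zcompl N),
    [/\ approaching (fun p : (zcompl M * I)%type => (val p.1 : M, p.2))
                    (range (zincl M) `*` [set: I])
                    (fun v : zcompl N => val v : N) (range (zincl N)) H,
        forall x, H (x, I0) = f x &
        forall x, H (x, I1) = g x].

Definition Ho : cat_data metrSpace :=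
  class_cat (rep := fun X Y : metrSpace => continuousType X Y)
    (fun X Y => @homotopic X Y)
    (fun X f => f = ctsid X)
    (fun X Y Z g f h => h = ctscomp g f).

Definition hclass (X Y : metrSpace) (f : continuousType X Y) : arr Ho X Y :=
  homotopic f.

Record fish_rep (X Y : metrSpace) := FishRep {
  fish_dom : zpair X;
  fish_cod : zpair Y;
  fish_map : appr fish_dom fish_cod }.

(* Any two choices of the maps (id_X)_{MM'} and (id_Y)_{NN'} are approaching
   homotopic, so it does not matter which ones are used. *)
Definition fish_eqv (X Y : metrSpace) (r s : fish_rep X Y) :=
  exists (i : appr (fish_dom r) (fish_dom s))
         (j : appr (fish_cod r) (fish_cod s)),
    [/\ combines (ctsid X) i, combines (ctsid Y) j &
        appr_homotopic (appr_comp j (fish_map r)) (appr_comp (fish_map s) i)].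

Inductive fish_rid (X : metrSpace) : fish_rep X X -> Prop :=
  FishRid (M : zpair X) : fish_rid (FishRep (appr_id M)).

Inductive fish_rcmp (X Y Z : metrSpace) :
    fish_rep Y Z -> fish_rep X Y -> fish_rep X Z -> Prop :=
  FishRcmp (M : zpair X) (N : zpair Y) (L : zpair Z)
    (g : appr N L) (f : appr M N) :
    fish_rcmp (FishRep g) (FishRep f) (FishRep (appr_comp g f)).

Definition Fish : cat_data metrSpace :=
  class_cat fish_eqv fish_rid fish_rcmp.

Definition Ho_to_Fish (X Y : metrSpace) (c : arr Ho X Y) : arr Fish X Y :=
  fun s => exists phi r,
    [/\ c phi, combines phi (fish_map r) & fish_eqv r s].

Record dposet := DPoset {
  dcar :> Type;
  dle : dcar -> dcar -> Prop;
  dle_refl : forall i, dle i i;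
  dle_trans : forall i j k, dle i j -> dle j k -> dle i k;
  dle_antisym : forall i j, dle i j -> dle j i -> i = j;
  dle_inhabited : exists i : dcar, True;
  dle_directed : forall i j, exists k, dle i k /\ dle j k }.

Record inv_sys := InvSys {
  idx : dposet;
  term :> idx -> metrSpace;
  bond : forall i j, dle i j -> continuousType (term j) (term i);
  bond_id : forall i (h : dle i i) x, bond h x = x;
  bond_comp : forall i j k (hij : dle i j) (hjk : dle j k) (hik : dle i k) x,
    bond hij (bond hjk x) = bond hik x }.

Definition open_cover (P : topologicalType) (V : set (set P)) :=
  (forall A, V A -> open A) /\ (forall x, exists2 A, V A & A x).

Definition near_maps (X P : topologicalType) (V : set (set P)) (f g : X -> P) :=
  forall x, exists2 A, V A & A (f x) /\ A (g x).

Record anr_res (X : metrSpace) := AnrRes {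
  res_sys :> inv_sys;
  res_ANR : forall i, ANR (res_sys i);
  proj : forall i, continuousType X (res_sys i);
  proj_bond : forall i j (h : dle i j) x, bond h (proj j x) = proj i x;
  res_R1 : forall (P : topologicalType) (V : set (set P)),
    ANR P -> open_cover V ->
    forall f : continuousType X P,
      exists i (h : continuousType (res_sys i) P), near_maps V (h \o proj i) f;
  res_R2 : forall (P : topologicalType) (V : set (set P)),
    ANR P -> open_cover V ->
    exists V' : set (set P), open_cover V' /\
      forall i (h h' : continuousType (res_sys i) P),
        near_maps V' (h \o proj i) (h' \o proj i) ->
        exists j (hij : dle i j), near_maps V (h \o bond hij) (h' \o bond hij) }.

Arguments proj {X}.

(* Elements of the disjoint union of the [X_i, Y], its equivalence relation,
   and the elements of colim_i [X_i, Y] as the equivalence classes. *)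
Definition pro_elt (X : inv_sys) (Y : metrSpace) : Type :=
  {i : idx X & arr Ho (X i) Y}.

Definition pro_eqv (X : inv_sys) (Y : metrSpace) (s t : pro_elt X Y) :=
  exists k (hs : dle (tag s) k) (ht : dle (tag t) k),
    cmp (tagged s) (hclass (bond hs)) = cmp (tagged t) (hclass (bond ht)).

Definition pro_class (X : inv_sys) (Y : metrSpace) (s : pro_elt X Y) :
    pro_elt X Y -> Prop :=
  fun t => mor (tagged t) /\ pro_eqv s t.

Definition pro_post (X : inv_sys) (Y Z : metrSpace) (g : arr Ho Y Z)
    (s : pro_elt X Y) : pro_elt X Z :=
  Tagged (fun i => arr Ho (X i) Z) (cmp g (tagged s)).

Definition pro_arr (X Y : inv_sys) : Type :=
  forall m : idx Y, pro_elt X (Y m) -> Prop.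

(* membership in lim_m colim_i [X_i, Y_m] *)
Definition pro_mor (X Y : inv_sys) (F : pro_arr X Y) :=
  (forall m, exists s : pro_elt X (Y m), mor (tagged s) /\ F m = pro_class s) /\
  (forall m n (h : dle m n) (s : pro_elt X (Y n)),
    F n s -> F m = pro_class (pro_post (hclass (bond h)) s)).

Definition pro_id (X : inv_sys) : pro_arr X X := fun m =>
  pro_class (Tagged (fun i => arr Ho (X i) (X m)) (@idm _ Ho (X m))).

Definition pro_cmp (X Y Z : inv_sys) (G : pro_arr Y Z) (F : pro_arr X Y) :
    pro_arr X Z :=
  fun m t => exists (g : pro_elt Y (Z m)) (f : pro_elt X (Y (tag g))),
    [/\ G m g, F (tag g) f & pro_class (pro_post (tagged g) f) t].

(* F is a pro-Ho morphism with F[p] = [q][f] *)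
Definition pro_over (X Y : metrSpace) (p : anr_res X) (q : anr_res Y)
    (c : arr Ho X Y) (F : pro_arr p q) :=
  pro_mor F /\
  forall m (s : pro_elt p (q m)), F m s ->
    cmp (tagged s) (hclass (proj p (tag s))) = cmp (hclass (proj q m)) c.

Record sh_rep (X Y : metrSpace) := ShRep {
  sh_dom : anr_res X;
  sh_cod : anr_res Y;
  sh_arr : pro_arr sh_dom sh_cod;
  sh_mor : pro_mor sh_arr }.
Arguments sh_arr {X Y} s m _.

Definition sh_eqv (X Y : metrSpace) (r s : sh_rep X Y) :=
  exists (i : pro_arr (sh_dom r) (sh_dom s))
         (j : pro_arr (sh_cod r) (sh_cod s)),
    [/\ pro_over (hclass (ctsid X)) i, pro_over (hclass (ctsid Y)) j &
        pro_cmp j (sh_arr r) = pro_cmp (sh_arr s) i].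

Definition sh_rid (X : metrSpace) (r : sh_rep X X) :=
  exists (p : anr_res X) (h : pro_mor (@pro_id p)), r = ShRep h.

Inductive sh_rcmp (X Y Z : metrSpace) :
    sh_rep Y Z -> sh_rep X Y -> sh_rep X Z -> Prop :=
  ShRcmp (p : anr_res X) (q : anr_res Y) (r : anr_res Z)
    (G : pro_arr q r) (hG : pro_mor G) (F : pro_arr p q) (hF : pro_mor F)
    (hGF : pro_mor (pro_cmp G F)) :
    sh_rcmp (ShRep hG) (ShRep hF) (ShRep hGF).

Definition Sh : cat_data metrSpace := class_cat sh_eqv sh_rid sh_rcmp.

Definition Ho_to_Sh (X Y : metrSpace) (c : arr Ho X Y) : arr Sh X Y :=
  fun s => exists2 r, pro_over c (sh_arr r) & sh_eqv r s.

Record compactum := Compactum {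
  cpt_space :> topologicalType;
  cpt_metrizable : metrizable cpt_space;
  cpt_compact : compact [set: cpt_space] }.

Definition proper (U V : topologicalType) (f : U -> V) :=
  forall C : set V, compact C -> compact (f @^-1` C).

Record prop_map (U V : topologicalType) := PropMap {
  prop_fun :> continuousType U V;
  prop_proper : proper prop_fun }.

Definition prop_id (U : topologicalType) : prop_map U U :=
  @PropMap U U (ctsid U) (fun C cC => cC).

Definition prop_comp (U V W : topologicalType) (g : prop_map V W)
    (f : prop_map U V) : prop_map U W :=
  @PropMap U W (ctscomp g f)
    (fun C cC => prop_proper (prop_proper cC)).

Definition prop_homotopic (U V : topologicalType) (f g : prop_map U V) :=
  exists H : prop_map (U * I)%type V,
    (forall x, H (x, I0) = f x) /\ (forall x, H (x, I1) = g x).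

Record czpair (K : topologicalType) := CZPair {
  cz_pair :> zpair K;
  cz_compact : compact [set: cz_pair] }.

Record ssh_rep (K L : compactum) := SshRep {
  ssh_dom : czpair K;
  ssh_cod : czpair L;
  ssh_map : prop_map (zcompl ssh_dom) (zcompl ssh_cod) }.

(* For the same P and Q this is proper homotopy; in general it is the
   identification along the canonical bijections, induced by id_K and id_L. *)
Definition ssh_eqv (K L : compactum) (r s : ssh_rep K L) :=
  exists (i : prop_map (zcompl (ssh_dom r)) (zcompl (ssh_dom s)))
         (j : prop_map (zcompl (ssh_cod r)) (zcompl (ssh_cod s))),
    [/\ combines (ctsid K) i, combines (ctsid L) j &
        prop_homotopic (prop_comp j (ssh_map r)) (prop_comp (ssh_map s) i)].

Inductive ssh_rid (K : compactum) : ssh_rep K K -> Prop :=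
  SshRid (P : czpair K) : ssh_rid (@SshRep K K P P (prop_id _)).

Inductive ssh_rcmp (K L M : compactum) :
    ssh_rep L M -> ssh_rep K L -> ssh_rep K M -> Prop :=
  SshRcmp (P : czpair K) (Q : czpair L) (S : czpair M)
    (g : prop_map (zcompl Q) (zcompl S)) (f : prop_map (zcompl P) (zcompl Q)) :
    ssh_rcmp (SshRep g) (SshRep f) (SshRep (prop_comp g f)).

Definition Ssh : cat_data compactum := class_cat ssh_eqv ssh_rid ssh_rcmp.

Definition ssh_of (K L : compactum) (phi : continuousType K L) : arr Ssh K L :=
  fun s => exists2 r, combines phi (ssh_map r) & ssh_eqv r s.

Record csub (X : metrSpace) := CSub {
  cset :> set X;
  cset_compact : compact cset }.

Lemma metrizable_sub (T : topologicalType) (A : set T) :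
  metrizable T -> metrizable (set_type A).
Proof.
move=> [d [d0 dsym dtri dn]]; exists (fun x y => d (val x) (val y)); split.
- move=> x y; split=> [xy|->]; first exact/val_inj/(d0 _ _).1.
  exact: (d0 _ _).2.
- by move=> x y; apply: dsym.
- by move=> x y z; apply: dtri.
- move=> x; apply/seteqP; split=> B.
    move=> [B' [[W oW <-] /= Wx] WB].
    have : nbhs (val x) W by exact: open_nbhs_nbhs.
    rewrite dn => -[e e0 eW]; exists e => // y /= xy.
    by apply: WB; apply: eW.
  move=> [e e0 eB].
  have : nbhs (val x) [set y | d (val x) y < e] by rewrite dn; exists e.
  move=> /(@initial_continuous A T val x) xW.
  by apply: (@filterS _ (nbhs x) _ _ _ _ xW) => y; apply: eB.
Qed.

Lemma compact_sub (T : topologicalType) (A : set T) :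
  compact A -> compact [set: set_type A].
Proof.
move=> cA F FF _.
have [] := cA (val @ F) _.
  by apply: (@filterS _ F _ setT) filterT => x _; exact: (set_mem (valP x)).
move=> p [Ap clp]; exists (exist _ p (mem_set Ap)); split=> //.
move=> B C FB [C' [[W oW <-] /= Wp] WC].
have FvB : (val @ F) (val @` B).
  by apply: (@filterS _ F _ B) FB => x Bx; exists x.
have [_ [[x Bx <-] Wx]] := clp _ _ FvB (open_nbhs_nbhs (conj oW Wp)).
by exists x; split=> //; apply: WC.
Qed.

Definition cspace (X : metrSpace) (K : csub X) : compactum :=
  Compactum (@metrizable_sub X K (ms_metrizable X)) (@compact_sub X K (@cset_compact X K)).

Lemma sub_map_proof (T U : topologicalType) (A : set T) (B : set U)
    (f : T -> U) (h : f @` A `<=` B) (x : A) : f (val x) \in B.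
Proof. by apply/mem_set/h; exists (val x) => //; exact: (set_mem (valP x)). Qed.

Lemma sub_map_continuous (T U : topologicalType) (A : set T) (B : set U)
    (f : continuousType T U) (h : f @` A `<=` B) :
  continuous (fun x : A => exist _ (f (val x)) (sub_map_proof h x) : B).
Proof.
apply: continuous_comp_initial => x.
rewrite (_ : _ \o _ = f \o (@set_val T A)); last exact/funext.
apply: continuous_comp; first exact: initial_continuous.
exact: cts_fun.
Qed.

(* the restriction of f : X -> Y to a map K -> L, when f(K) is a subset of L *)
Definition sub_map (X Y : metrSpace) (K : csub X) (L : csub Y)
    (f : continuousType X Y) (h : f @` K `<=` L) :
    continuousType (cspace K) (cspace L) :=
  [the continuousType (set_type K) (set_type L) of
    mkcts (@sub_map_continuous X Y K L f h)].

Lemma incl_proof (T : Type) (A B : set T) : A `<=` B -> idfun @` A `<=` B.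
Proof. by move=> AB _ [x Ax <-]; exact: AB. Qed.

Definition incl (X : metrSpace) (K L : csub X) (h : K `<=` L) :
    arr Ssh (cspace K) (cspace L) :=
  ssh_of (@sub_map X X K L (ctsid X) (incl_proof h)).

Lemma cimage_proof (X Y : metrSpace) (f : continuousType X Y) (K : csub X) :
  compact (f @` K).
Proof.
apply: continuous_compact (@cset_compact X K).
by apply: continuous_subspaceT; exact: cts_fun.
Qed.
Definition cimage (X Y : metrSpace) (f : continuousType X Y) (K : csub X) :
  csub Y := CSub (@cimage_proof X Y f K).

(* Elements of the disjoint union of the [K, L]_Ssh over compact L in Y, its
   equivalence relation, and the elements of colim_L [K, L]_Ssh as the
   equivalence classes. *)
Definition ind_elt (K : compactum) (Y : metrSpace) : Type :=
  {L : csub Y & arr Ssh K (cspace L)}.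

Definition ind_eqv (K : compactum) (Y : metrSpace) (s t : ind_elt K Y) :=
  exists (L : csub Y) (hs : tag s `<=` L) (ht : tag t `<=` L),
    cmp (incl hs) (tagged s) = cmp (incl ht) (tagged t).

Definition ind_class (K : compactum) (Y : metrSpace) (s : ind_elt K Y) :
    ind_elt K Y -> Prop :=
  fun t => mor (tagged t) /\ ind_eqv s t.

Definition ind_pre (K K' : compactum) (Y : metrSpace) (a : arr Ssh K K')
    (s : ind_elt K' Y) : ind_elt K Y :=
  Tagged (fun L => arr Ssh K (cspace L)) (cmp (tagged s) a).

Definition ash_arr (X Y : metrSpace) : Type :=
  forall K : csub X, ind_elt (cspace K) Y -> Prop.

(* membership in lim_K colim_L [K, L]_Ssh *)
Definition ash_mor (X Y : metrSpace) (F : ash_arr X Y) :=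
  (forall K, exists s : ind_elt (cspace K) Y,
    mor (tagged s) /\ F K = ind_class s) /\
  (forall (K K' : csub X) (h : K `<=` K') (s : ind_elt (cspace K') Y),
    F K' s -> F K = ind_class (ind_pre (incl h) s)).

Definition ash_id (X : metrSpace) : ash_arr X X := fun K =>
  ind_class (Tagged (fun L => arr Ssh (cspace K) (cspace L))
                    (@idm _ Ssh (cspace K))).

Definition ash_cmp (X Y Z : metrSpace) (G : ash_arr Y Z) (F : ash_arr X Y) :
    ash_arr X Z :=
  fun K t => exists (f : ind_elt (cspace K) Y) (g : ind_elt (cspace (tag f)) Z),
    [/\ F K f, G (tag f) g & ind_class (ind_pre (tagged f) g) t].

Definition Ash : cat_data metrSpace := CatData ash_mor ash_id ash_cmp.

Definition Ho_to_Ash (X Y : metrSpace) (c : arr Ho X Y) : arr Ash X Y :=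
  fun K t => exists2 f, c f &
    ind_class (Tagged (fun L => arr Ssh (cspace K) (cspace L))
      (ssh_of (@sub_map X Y K (cimage f K) f (@subset_refl _ _)))) t.

End FineShape.

(* Main.v *)
(* Every metrizable P embeds as a Z-set in an AR made of 1-Lipschitz functions,
   in which Hausdorff's formula extends maps; this gives extension of homotopies
   into ANRs near closed sets and, with the Z-set homotopies, a calculus of
   approaching maps up to approaching homotopy.
   Part (a): for an ANR P, a map g : Y -> P extends to a neighbourhood of Y in N;
   pulling back along an approaching map M \ X -> N \ Y and pushing a
   neighbourhood of X off X yields a class in [X, P], natural in P.  For a
   resolution p of X, colim_i [p_i, P] = [X, P]: (R1) gives surjectivity, and (R1) for
   the path space of P with (R2) for P gives injectivity.  Hence a fine shape morphism
   X -> Y induces a pro-homotopy morphism between resolutions.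
   Part (b): for compacta, approaching maps between complements in compact ARs
   are exactly the proper maps, so strong shape is fine shape.  An approaching
   map f from the complement of a compactum K in a compact AR to N \ Y clusters
   in Y only at a compact set L, and f is then approaching towards L; thus a
   fine shape morphism restricts on each compact subset of X to a strong shape
   morphism into a compact subset of Y. *)

From HB Require Import structures.
From mathcomp Require Import all_boot all_order all_algebra.
From mathcomp Require Import all_classical all_reals topology normedtype.
From mathcomp Require Import ring lra.
Require Import Defs.

Set Implicit Arguments.
Unset Strict Implicit.
Unset Printing Implicit Defensive.

Import Order.TTheory GRing.Theory Num.Theory.
Import numFieldNormedType.Exports.

Local Open Scope classical_set_scope.
Local Open Scope ring_scope.

(** In a space of Lipschitz functions extension is an infimum in each coordinate, with a modulus of
    continuity common to all coordinates, so partitions of unity and convex hulls are avoided. The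
    Kuratowski image of [P] is not closed there when [P] is incomplete; the extra coordinate [None],
    a height at whose zero level only members of [C] are allowed, removes the unwanted limits and
    gives a direction in which [P] is pushed off itself. Representatives of fine shape morphisms
    compose only when they share the middle AR, and equal classes live over different ARs.
    Commutative squares over maps of spaces, with vertical sides unique up to approaching homotopy,
    therefore replace equations. Both functors are given by relations (all representatives that fit
    the given class) and not by choices, so well-definedness says that the related elements form
    exactly one class. Strong shape asks for compact ARs, but a map is compressed towards [L] in an
    arbitrary AR; strong shape classes are therefore also described by approaching maps between
    arbitrary ARs. *)

Section Metrics.
Variable R : realType.

(** * Metrics, distance to a set, products *)

Definition metrizes (T : topologicalType) (d : T -> T -> R) : Prop :=
  [/\ forall x y, d x y = 0 <-> x = y,
      forall x y, d x y = d y x,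
      forall x y z, d x z <= d x y + d y z &
      forall x, nbhs x =
        filter_from [set e : R | 0 < e] (fun e => [set y | d x y < e])].

Section Basics.
Variables (T : topologicalType) (d : T -> T -> R).
Hypothesis dT : metrizes d.

Lemma metr_refl x : d x x = 0.
Proof. by have [d0 _ _ _] := dT; apply/d0. Qed.

Lemma metr_eq0 x y : d x y = 0 -> x = y.
Proof. by have [d0 _ _ _] := dT; move/d0. Qed.

Lemma metr_sym x y : d x y = d y x.
Proof. by have [_ ds _ _] := dT; exact: ds. Qed.

Lemma metr_tri y x z : d x z <= d x y + d y z.
Proof. by have [_ _ dt _] := dT; exact: dt. Qed.

Lemma metr_ge0 x y : 0 <= d x y.
Proof.
have := metr_tri y x x; rewrite metr_refl (metr_sym y x); lra.
Qed.

Lemma metr_gt0 x y : x <> y -> 0 < d x y.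
Proof.
move=> xy; rewrite lt_neqAle metr_ge0 andbT eq_sym.
by apply/eqP => /metr_eq0.
Qed.

Lemma nbhs_metr x (B : set T) :
  nbhs x B <-> exists2 e, 0 < e & forall y, d x y < e -> B y.
Proof. by have [_ _ _ ->] := dT. Qed.

Lemma near_metr x e : 0 < e -> \forall y \near x, d x y < e.
Proof. by move=> e0; apply/nbhs_metr; exists e. Qed.

Lemma cvg_metr (U : Type) (F : set_system U) (FF : Filter F) (f : U -> T) l :
  f @ F --> l <-> forall e, 0 < e -> \forall u \near F, d l (f u) < e.
Proof.
split=> [fl e e0|H B /nbhs_metr [e e0 eB]].
  exact: (fl _ (near_metr l e0)).
by have := H e e0; apply: filterS => u; exact: eB.
Qed.

Lemma metr_hausdorff : hausdorff_space T.
Proof.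
move=> x y xy; apply: contrapT => /metr_gt0 d0.
have d2 : 0 < d x y / 2 by lra.
have [z [/= xz yz]] := xy _ _ (near_metr x d2) (near_metr y d2).
have := metr_tri z x y; rewrite (metr_sym z y); lra.
Qed.

(** Coordinates in the function space lie in [0, 1], so the metric of [P] has to be truncated; only
    small distances matter for the topology. *)
Lemma metr_bounded : metrizes (fun x y => Num.min 1 (d x y)).
Proof.
have m0 e x y : 0 < e -> e <= 1 -> (Num.min 1 (d x y) < e) = (d x y < e).
  by move=> e0 e1; rewrite gt_min ltNge e1.
split.
- move=> x y; split=> [|->]; last by rewrite metr_refl min_r.
  by case: (leP 1 (d x y)) => [_ /eqP|_]; [rewrite oner_eq0|exact: metr_eq0].
- by move=> x y; rewrite metr_sym.
- move=> x y z; have := metr_tri y x z; have := metr_ge0 x y.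
  have := metr_ge0 y z.
  by case: (leP 1 (d x z)); case: (leP 1 (d x y)); case: (leP 1 (d y z)); lra.
- move=> x; apply/seteqP; split=> B.
    move=> /nbhs_metr [e e0 eB]; exists (Num.min e 1) => /=.
      by rewrite lt_min e0 ltr01.
    by move=> y /=; rewrite m0 ?lt_min ?e0 ?ltr01 ?ge_min ?lexx ?orbT// => /andP[/eB].
  move=> [e /= e0 eB]; apply/nbhs_metr; exists e => // y xy; apply: eB => /=.
  by rewrite gt_min xy orbT.
Qed.

Section DistSet.
Variable S : set T.
Hypothesis S0 : S !=set0.

Definition dset x : R := inf [set d x y | y in S].

Let lb x : has_lbound [set d x y | y in S].
Proof. by exists 0 => _ [y _ <-]; exact: metr_ge0. Qed.

Let ne x : [set d x y | y in S] !=set0.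
Proof. by have [y Sy] := S0; exists (d x y); exists y. Qed.

Lemma dset_le x y : S y -> dset x <= d x y.
Proof. by move=> Sy; apply: ge_inf => //; exists y. Qed.

Lemma dset_ge0 x : 0 <= dset x.
Proof. by apply: lb_le_inf => // _ [y _ <-]; exact: metr_ge0. Qed.

Lemma dset_adherent x e : 0 < e -> exists2 y, S y & d x y < dset x + e.
Proof.
by move=> e0; have [_ [y Sy <-] ?] := @inf_adherent _ _ _ e0 (conj (ne x) (lb x)); exists y.
Qed.

Lemma dset_lip x x' : dset x <= d x x' + dset x'.
Proof.
apply/ler_addgt0Pr => e e0; have [y Sy xy] := dset_adherent x' e0.
by have := dset_le x Sy; have := metr_tri x' x y; lra.
Qed.

Lemma dset_eq0 x : S x -> dset x = 0.
Proof.
by move=> Sx; apply/le_anti; rewrite dset_ge0 andbT -(metr_refl x) dset_le.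
Qed.

Lemma dset_gt0 x : closed S -> ~ S x -> 0 < dset x.
Proof.
move=> cS Sx; have /nbhs_metr [e e0 eS] : nbhs x (~` S).
  by apply: open_nbhs_nbhs; split=> //; exact: closed_openC.
apply: lt_le_trans e0 _; apply: lb_le_inf => // _ [y Sy <-].
by rewrite leNgt; apply/negP => /eS.
Qed.

Lemma dset_continuous : continuous dset.
Proof.
move=> x; apply/cvgrPdist_lt => e e0.
apply: filterS (near_metr x e0) => y xy; rewrite ltr_distl.
have := dset_lip x y; have := dset_lip y x; rewrite (metr_sym y x).
by move=> ? ?; apply/andP; split; lra.
Qed.

End DistSet.
End Basics.

Lemma metrizable_hausdorff (T : topologicalType) :
  metrizable R T -> hausdorff_space T.
Proof. by move=> [d /metr_hausdorff]. Qed.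

Definition prod_dist (T U : Type) (d : T -> T -> R) (d' : U -> U -> R)
  (p q : T * U) : R := d p.1 q.1 + d' p.2 q.2.

Lemma metrizes_prod (T U : topologicalType) (d : T -> T -> R)
    (d' : U -> U -> R) :
  metrizes d -> metrizes d' ->
  metrizes (prod_dist d d' : (T * U)%type -> (T * U)%type -> R).
Proof.
move=> dT dU; split.
- move=> [x y] [x' y']; rewrite /prod_dist /=; split=> [xy|[<- <-]]; last first.
    by rewrite (metr_refl dT) (metr_refl dU) addr0.
  have := metr_ge0 dT x x'; have := metr_ge0 dU y y' => h1 h2.
  by congr (_, _); [apply: (metr_eq0 dT)|apply: (metr_eq0 dU)]; lra.
- by move=> p q; rewrite /prod_dist (metr_sym dT) (metr_sym dU).
- move=> p q r; have := metr_tri dT q.1 p.1 r.1.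
  have := metr_tri dU q.2 p.2 r.2; rewrite /prod_dist; lra.
- move=> [x y]; apply/seteqP; split=> B.
    move=> [[/= A A'] [/= /(nbhs_metr dT) [e e0 eA] /(nbhs_metr dU) [e' e'0 eA']] AB].
    exists (Num.min e e') => /=; first by rewrite lt_min e0.
    move=> [x' y']; rewrite /prod_dist /= lt_min => /andP[h1 h2]; apply: AB.
    have := metr_ge0 dT x x'; have := metr_ge0 dU y y' => h3 h4.
    by split=> /=; [apply: eA|apply: eA']; lra.
  move=> [e /= e0 eB]; have e2 : 0 < e / 2 by lra.
  exists ([set x' | d x x' < e / 2], [set y' | d' y y' < e / 2]).
    by split; [exact: (near_metr dT)|exact: (near_metr dU)].
  by move=> [x' y'] [/= h1 h2]; apply: eB; rewrite /= /prod_dist /=; lra.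
Qed.

Lemma metrizable_prod (T U : topologicalType) :
  metrizable R T -> metrizable R U -> metrizable R (T * U)%type.
Proof.
move=> [d dT] [d' dU]; exists (prod_dist d d'); exact: metrizes_prod.
Qed.

Lemma metrizes_real : metrizes (fun x y : R => `|x - y|).
Proof.
split.
- move=> x y; split=> [/normr0P|->]; last by rewrite subrr normr0.
  by rewrite subr_eq0 => /eqP.
- exact: distrC.
- by move=> x y z; exact: ler_distD.
- by move=> x; rewrite -filter_from_ballE; apply/seteqP; split.
Qed.

Lemma metrizable_I : metrizable R (set_type (@unit_interval R)).
Proof. by apply: metrizable_sub; exists (fun x y => `|x - y|); exact: metrizes_real. Qed.

End Metrics.

(** * The space of 1-Lipschitz functions with the sup metric *)

Section FunctionSpace.
Variable R : realType.

(* With [C] the set of all functions this is a compact AR if [P] is compact;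
   with [C] the image of the Kuratowski embedding it is an AR containing [P]
   as the zero set of the coordinate [None]. *)
Record lipfun (P : Type) (d : P -> P -> R) (C : set (option P -> R)) := LipFun {
  lipf :> option P -> R;
  lipf_ge0 : forall j, 0 <= lipf j;
  lipf_le1 : forall j, lipf j <= 1;
  lipf_lip : forall p q, lipf (Some p) <= lipf (Some q) + d p q;
  lipf_base : lipf None = 0 -> C lipf }.

Section LipfunMetric.
Variables (P : Type) (d : P -> P -> R) (C : set (option P -> R)).
Local Notation E := (lipfun d C).
Implicit Types a b c : E.

Lemma lipf_inj a b : (forall j, a j = b j) -> a = b.
Proof.
case: a b => [a a0 a1 aL aC] [b b0 b1 bL bC] /= /funext ab; subst b.
by congr LipFun; exact: Prop_irrelevance.
Qed.

Definition lipdist a b : R := sup [set `|a j - b j| | j in setT].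

Lemma lipdist_ge a b j : `|a j - b j| <= lipdist a b.
Proof.
apply: ub_le_sup; last by exists j.
exists 1 => _ [i _ <-]; rewrite ler_norml.
have := lipf_ge0 a i; have := lipf_le1 a i.
by have := lipf_ge0 b i; have := lipf_le1 b i => *; apply/andP; split; lra.
Qed.

Lemma lipdist_le a b e : (forall j, `|a j - b j| <= e) -> lipdist a b <= e.
Proof.
move=> H; apply: ge_sup; first by exists `|a None - b None|; exists None.
by move=> _ [j _ <-].
Qed.

Lemma lipdist_refl a : lipdist a a = 0.
Proof.
apply/le_anti/andP; split; first by apply: lipdist_le => j; rewrite subrr normr0.
exact: le_trans (normr_ge0 _) (lipdist_ge a a None).
Qed.

Lemma lipdist_eq0 a b : lipdist a b = 0 -> a = b.
Proof.
move=> ab; apply: lipf_inj => j; apply/eqP; rewrite -subr_eq0 -normr_le0 -ab.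
exact: lipdist_ge.
Qed.

Lemma lipdist_sym a b : lipdist a b = lipdist b a.
Proof.
by apply/le_anti/andP; split; apply: lipdist_le => j; rewrite distrC lipdist_ge.
Qed.

Lemma lipdist_tri b a c : lipdist a c <= lipdist a b + lipdist b c.
Proof.
apply: lipdist_le => j; apply: le_trans (ler_distD (b j) _ _) _.
by apply: lerD; exact: lipdist_ge.
Qed.

HB.instance Definition _ := gen_eqMixin E.
HB.instance Definition _ := gen_choiceMixin E.
HB.instance Definition _ := @isMetric.Build R E lipdist
  lipdist_refl lipdist_eq0 lipdist_sym lipdist_tri.

Lemma metrizes_lipdist : metrizes (lipdist : E -> E -> R).
Proof.
split.
- by move=> a b; split=> [/lipdist_eq0//|->]; rewrite lipdist_refl.
- exact: lipdist_sym.
- by move=> a b c; exact: lipdist_tri.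
- by move=> a; rewrite -filter_from_ballE; apply/seteqP; split=> B [e e0 eB];
    exists e => //= b; move: (eB b); rewrite ballEmdist.
Qed.

End LipfunMetric.
End FunctionSpace.

(** * Hausdorff's extension formula *)

Section Extension.
Variables (R : realType) (P : Type) (d : P -> P -> R).
Variable C : set (option P -> R).
Local Notation E := (lipfun d C).
Hypothesis d0 : forall p q, 0 <= d p q.

(** A base point. Its [None] coordinate is 1, so it exists for every [C]. *)
Definition lipfun1 : E.
Proof.
exists (fun=> 1) => [_|_|p q|/eqP]; rewrite ?ler01 ?lerDl ?oner_eq0//.
Defined.

Variables (N : topologicalType) (dN : N -> N -> R) (S : set N) (g : N -> E).
Hypothesis dNm : metrizes dN.
Hypothesis S0 : S !=set0.
Hypothesis cS : closed S.
Hypothesis cg : forall x e, S x -> 0 < e ->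
  exists2 r, 0 < r & forall y, S y -> dN x y < r -> lipdist (g x) (g y) <= e.

Local Notation del := (dset dN S).

(** The penalty in the formula, capped at 2: close to 1 for almost nearest points of [S], and equal
    to 2 once [dN x y] reaches [2 * del x]. After 1 is subtracted, such far points contribute at
    least 1 and cannot influence a function bounded by 1. *)
Let ratio x y : R := Num.min (dN x y) (2 * del x) / del x.

Let del_gt0 x : ~ S x -> 0 < del x.
Proof. exact: dset_gt0. Qed.

Let ratio_ge1 x y : ~ S x -> S y -> 1 <= ratio x y.
Proof.
move=> /del_gt0 Sx Sy; rewrite /ratio ler_pdivlMr// mul1r le_min.
by rewrite dset_le//=; lra.
Qed.

Let ratio_le2 x y : ~ S x -> ratio x y <= 2.
Proof.
by move=> /del_gt0 Sx; rewrite /ratio ler_pdivrMr// ge_min lexx orbT.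
Qed.

Let ratio_eq2 x y : ~ S x -> 2 * del x <= dN x y -> ratio x y = 2.
Proof.
by move=> /del_gt0 Sx xy; rewrite /ratio min_r// mulfK// gt_eqF.
Qed.

Let ratio_lt x y e : ~ S x -> dN x y < del x + del x * e -> ratio x y < 1 + e.
Proof.
move=> /del_gt0 Sx xy; rewrite /ratio ltr_pdivrMr// gt_min.
by apply/orP; left; lra.
Qed.

(** The bound does not involve [y], nor any coordinate; this uniformity is what continuity in the
    sup metric needs. *)
Let ratio_lip x x' y : ~ S x -> ~ S x' -> S y ->
  `|ratio x y - ratio x' y| <= 4 * dN x x' / del x.
Proof.
move=> Sx Sx' Sy; have x0 := del_gt0 Sx; have x'0 := del_gt0 Sx'.
have l1 := dset_lip dNm S0 x x'; have l2 := dset_lip dNm S0 x' x.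
have t1 := metr_tri dNm x x' y; have t2 := metr_tri dNm x' x y.
have r0 := metr_ge0 dNm x x'.
rewrite (metr_sym dNm x' x) in l2 t1.
set m := Num.min (dN x y) (2 * del x); set m' := Num.min (dN x' y) (2 * del x').
have mm : `|m - m'| <= 2 * dN x x'.
  rewrite ler_norml /m /m'.
  by case: (leP (dN x y)); case: (leP (dN x' y)) => ? ?; apply/andP; split; lra.
have m'0 : 0 <= m' by rewrite le_min metr_ge0//=; lra.
have m'2 : m' <= 2 * del x' by rewrite ge_min lexx orbT.
have dd : `|del x' - del x| <= dN x x'.
  by rewrite ler_norml; apply/andP; split; lra.
have -> : ratio x y - ratio x' y =
    ((m - m') + ratio x' y * (del x' - del x)) / del x.
  rewrite /ratio -/m -/m'; field.
  by rewrite !gt_eqF.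
have i0 : 0 <= (del x)^-1 by rewrite invr_ge0 ltW.
rewrite normrM (ger0_norm i0); apply: ler_wpM2r => //.
apply: le_trans (ler_normD _ _) _; rewrite normrM.
have q2 : `|ratio x' y| <= 2.
  by rewrite ger0_norm ?ratio_le2//; apply: le_trans ler01 (ratio_ge1 _ _).
have : `|ratio x' y| * `|del x' - del x| <= 2 * dN x x' by apply: ler_pM.
by lra.
Qed.

Let val x j : R := inf [set g y j + ratio x y | y in S] - 1.

Let val_lb x j : ~ S x -> has_lbound [set g y j + ratio x y | y in S].
Proof.
move=> Sx; exists 0 => _ [y Sy <-]; have := ratio_ge1 Sx Sy.
by have := lipf_ge0 (g y) j; lra.
Qed.

Let val_ne x j : [set g y j + ratio x y | y in S] !=set0.
Proof. by have [y Sy] := S0; exists (g y j + ratio x y); exists y. Qed.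

Let val_le x j y : ~ S x -> S y -> val x j <= g y j + ratio x y - 1.
Proof.
by move=> Sx Sy; rewrite lerD2r; apply: ge_inf; [exact: val_lb|exists y].
Qed.

Let val_ge x j e : (forall y, S y -> e <= g y j + ratio x y - 1) -> e <= val x j.
Proof.
move=> H; rewrite lerBrDr; apply: lb_le_inf => [|_ [y Sy <-]]; first exact: val_ne.
by have := H y Sy; lra.
Qed.

Let val_ge0 x j : ~ S x -> 0 <= val x j.
Proof.
move=> Sx; apply: val_ge => y Sy; have := ratio_ge1 Sx Sy.
by have := lipf_ge0 (g y) j; lra.
Qed.

(** An almost nearest point of [S] almost attains its own value of [g] in the infimum. *)
Let val_le_near x j c e : 0 < e -> ~ S x ->
  (forall y, S y -> dN x y < 2 * del x -> g y j <= c) -> val x j <= c + e.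
Proof.
move=> e0 Sx H; have x0 := del_gt0 Sx.
(* The excess serves twice: the bound 1 keeps [y] within [2 * del x], and the bound [e] keeps its
   ratio below [1 + e]. *)
have e1 : 0 < del x * Num.min 1 e by rewrite mulr_gt0// lt_min e0 ltr01.
have [y Sy xy] := dset_adherent dNm S0 x e1.
have := val_le j Sx Sy; have := ratio_lt Sx xy.
have m1 : Num.min 1 e <= 1 by rewrite ge_min lexx.
have me : Num.min 1 e <= e by rewrite ge_min lexx orbT.
have : g y j <= c by apply: H => //; have := ler_wpM2l (ltW x0) m1; lra.
by lra.
Qed.

Let val_le1 x j : ~ S x -> val x j <= 1.
Proof.
move=> Sx; apply/ler_addgt0Pr => e e0; apply: val_le_near => // y _ _.
exact: lipf_le1.
Qed.

Let ext0 x j : R := if pselect (S x) then g x j else val x j.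

Let ext0_in x j : S x -> ext0 x j = g x j.
Proof. by rewrite /ext0; case: pselect. Qed.

Let ext0_out x j : ~ S x -> ext0 x j = val x j.
Proof. by rewrite /ext0; case: pselect. Qed.

Let ext0_ge0 x j : 0 <= ext0 x j.
Proof. by rewrite /ext0; case: pselect => ?; [exact: lipf_ge0|exact: val_ge0]. Qed.

Let ext0_le1 x j : ext0 x j <= 1.
Proof. by rewrite /ext0; case: pselect => ?; [exact: lipf_le1|exact: val_le1]. Qed.

(** The penalty is the same in all coordinates, so the value off [S] is an infimum of 1-Lipschitz
    functions. *)
Let ext0_lip x p q : ext0 x (Some p) <= ext0 x (Some q) + d p q.
Proof.
rewrite /ext0; case: pselect => Sx; first exact: lipf_lip.
rewrite -lerBlDr; apply: val_ge => y Sy.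
by have := val_le (Some p) Sx Sy; have := lipf_lip (g y) p q; lra.
Qed.

(* Hausdorff's extension formula in each coordinate; the summand [del x] makes
   [C] irrelevant off [S] *)
Let ext x j : R :=
  Num.min 1 (ext0 x j + (if j is None then del x else 0)).

Let ext_in x j : S x -> ext x j = g x j.
Proof.
move=> Sx; rewrite /ext ext0_in//; have := lipf_le1 (g x) j.
by case: j => [p|] h; rewrite ?dset_eq0// addr0 min_r.
Qed.

Let ext_ge0 x j : 0 <= ext x j.
Proof.
rewrite le_min ler01 /= addr_ge0//; case: j => [p|]//.
exact: dset_ge0.
Qed.

Let ext_le1 x j : ext x j <= 1.
Proof. by rewrite ge_min lexx. Qed.

Let ext_lip x p q : ext x (Some p) <= ext x (Some q) + d p q.
Proof.
by rewrite /ext !addr0 !min_r ?ext0_le1.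
Qed.

Let ext_base x : ext x None = 0 -> C (ext x).
Proof.
have [Sx|Sx] := pselect (S x) => H.
  have -> : ext x = g x by apply/funext => j; exact: ext_in.
  by apply: lipf_base; rewrite -H ext_in.
suff : 0 < ext x None by rewrite H ltxx.
by rewrite lt_min ltr01 /= ltr_wpDl// del_gt0.
Qed.

Let extE x : E := LipFun (ext_ge0 x) (ext_le1 x) (ext_lip x) (@ext_base x).

Let ext_dist x x' j :
  `|ext x j - ext x' j| <= `|ext0 x j - ext0 x' j| + dN x x'.
Proof.
have l1 := dset_lip dNm S0 x x'; have l2 := dset_lip dNm S0 x' x.
have r0 := metr_ge0 dNm x x'; rewrite (metr_sym dNm x' x) in l2.
have : `|(if j is None then del x else 0) - (if j is None then del x' else 0)|
    <= dN x x'.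
  by case: j => [p|]; rewrite ?subrr ?normr0// ler_norml; apply/andP; split; lra.
have := ler_norm (ext0 x j - ext0 x' j).
have := ler_norm (ext0 x' j - ext0 x j); rewrite (distrC (ext0 x' j)).
rewrite /ext !ler_norml; set u := ext0 x j; set v := ext0 x' j.
set s := (if j is None then _ else _); set s' := (if j is None then _ else _).
move=> h1 h2 /andP[h3 h4]; have := normr_ge0 (u - v) => h5.
by case: (leP 1 (u + s)); case: (leP 1 (v + s')) => ? ?; apply/andP; split; lra.
Qed.

Let extE_continuous : continuous extE.
Proof.
move=> x; apply/(cvg_metr (metrizes_lipdist _ _)) => e e0.
have [Sx|Sx] := pselect (S x); last first.
  have x0 := del_gt0 Sx.
  (* The three bounds keep [y] off [S], the change of the [None] summand below [e / 4], and
     [4 * dN x y / del x] below [e / 4]. *)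
  pose r := Num.min (del x) (Num.min (e / 4) (e * del x / 20)).
  have r0 : 0 < r by rewrite !lt_min x0 /= !divr_gt0// mulr_gt0.
  apply: filterS (near_metr dNm x r0) => y.
  rewrite !lt_min => /and3P[xy1 xy2 xy3].
  have Sy : ~ S y by move=> Sy; have := dset_le dNm x Sy; lra.
  apply: (@le_lt_trans _ _ (e / 2)); last by lra.
  apply: lipdist_le => j; apply: le_trans (ext_dist _ _ _) _.
  rewrite !ext0_out//.
  have h : 4 * dN x y / del x <= e / 4.
    by rewrite ler_pdivrMr//; have := mulr_gt0 e0 x0; lra.
  suff : `|val x j - val y j| <= 4 * dN x y / del x by lra.
  have {}h z : S z -> ratio x z <= ratio y z + 4 * dN x y / del x /\
      ratio y z <= ratio x z + 4 * dN x y / del x.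
    by move=> Sz; have := ratio_lip Sx Sy Sz; rewrite ler_norml => /andP[]; split; lra.
  rewrite ler_norml; apply/andP; split.
    rewrite lerBrDr addrC; apply: val_ge => z Sz.
    by have := val_le j Sy Sz; have [? ?] := h z Sz; lra.
  rewrite lerBlDl -lerBlDr; apply: val_ge => z Sz.
  by have := val_le j Sx Sz; have [? ?] := h z Sz; lra.
have e4 : 0 < e / 4 by lra.
have [r r0 rg] := cg Sx e4.
(* If [dN x y < r / 4], then points of [S] within [2 * del y] of [y] are within [r] of [x], and
   points at distance at least [r] from [x] have ratio 2 as seen from [y]. *)
pose s := Num.min (r / 4) (e / 4).
have s0 : 0 < s by rewrite lt_min e4 divr_gt0.
apply: filterS (near_metr dNm x s0) => y; rewrite lt_min => /andP[xy1 xy2].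
apply: (@le_lt_trans _ _ (3 * e / 4)); last by lra.
apply: lipdist_le => j; apply: le_trans (ext_dist _ _ _) _.
suff : `|ext0 x j - ext0 y j| <= 2 * e / 4 by lra.
have gx z : S z -> dN x z < r -> `|g x j - g z j| <= e / 4.
  by move=> Sz xz; apply: le_trans (lipdist_ge _ _ _) (rg z Sz xz).
rewrite ext0_in//; have [Sy|Sy] := pselect (S y).
  rewrite ext0_in//; have := gx y Sy; lra.
rewrite ext0_out// ler_norml.
have yx := dset_le dNm y Sx; rewrite (metr_sym dNm y) in yx.
apply/andP; split.
  suff : val y j <= (g x j + e / 4) + e / 4 by lra.
  apply: val_le_near => // z Sz yz; have t := metr_tri dNm y x z.
  have xz : dN x z < r by lra.
  by have := gx z Sz xz; rewrite ler_norml => /andP[]; lra.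
rewrite lerBlDl -lerBlDr; apply: val_ge => z Sz.
have [xz|xz] := ltP (dN x z) r.
  have := gx z Sz xz; rewrite ler_norml => /andP[]; have := ratio_ge1 Sy Sz; lra.
have t := metr_tri dNm y x z.
rewrite ratio_eq2//; last by lra.
by have := lipf_ge0 (g z) j; have := lipf_le1 (g x) j; lra.
Qed.

Lemma lipfun_extension_aux :
  exists2 G : N -> E, continuous G & forall x, S x -> G x = g x.
Proof.
exists extE => [|x Sx]; first exact: extE_continuous.
by apply: lipf_inj => j; exact: ext_in.
Qed.

End Extension.

(** * Absolute extensors and absolute retracts *)

Section Extensors.
Variable R : realType.
Local Notation I := (set_type (@unit_interval R)).

Lemma compact_I : compact [set: I].
Proof. by apply: compact_sub; exact: segment_compact. Qed.

Lemma I_ge0 (t : I) : 0 <= val t.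
Proof.
have : @unit_interval R (val t) by exact: set_mem (valP t).
by rewrite /unit_interval /= in_itv /= => /andP[].
Qed.

Lemma I_le1 (t : I) : val t <= 1.
Proof.
have : @unit_interval R (val t) by exact: set_mem (valP t).
by rewrite /unit_interval /= in_itv /= => /andP[].
Qed.

(** Partial maps are kept as total functions with arbitrary values off [W], so [W] can be shrunk
    without restriction maps. For open [W] this is continuity on the subspace. *)
Definition cont_on (T U : topologicalType) (W : set T) (f : T -> U) : Prop :=
  forall x, W x -> {for x, continuous f}.

Lemma cont_onW (T U : topologicalType) (W W' : set T) (f : T -> U) :
  W' `<=` W -> cont_on W f -> cont_on W' f.
Proof. by move=> WW cf x /WW/cf. Qed.

Lemma open_preimage_on (T U : topologicalType) (W : set T) (O : set U)
    (f : T -> U) :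
  open W -> open O -> cont_on W f -> open (W `&` f @^-1` O).
Proof.
move=> oW oO cf; rewrite openE => x [Wx Ox]; apply: filterI.
  exact: open_nbhs_nbhs.
exact: (cf x Wx _ (open_nbhs_nbhs (conj oO Ox))).
Qed.

Lemma cvg_set_val (T : Type) (F : set_system T) (FF : Filter F)
    (X : topologicalType) (A : set X) (f : T -> A) (y : A) :
  (fun x => val (f x) : X) @ F --> (val y : X) -> f @ F --> y.
Proof.
move=> fy B [_ [[W oW <-] /= Wy] WB].
have FW : F [set x | W (val (f x))] := fy W (open_nbhs_nbhs (conj oW Wy)).
suff : F (f @^-1` B) by [].
apply: filterS FW => x Wx; exact: WB.
Qed.

Lemma fmap_ultra (T U : Type) (f : T -> U) (F : set_system T) :
  UltraFilter F -> UltraFilter (f @ F).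
Proof.
move=> FU; have PF : ProperFilter (f @ F) by exact: fmap_proper_filter.
apply: (@Build_UltraFilter _ _ PF) => G PG FG; apply/seteqP; split=> // A GA.
have [//|FA] := in_ultra_setVsetC (f @^-1` A) FU.
have /FG GA' : (f @ F) (~` A) by [].
by case: (@filter_not_empty _ G PG); rewrite -(setICr A); exact: filterI.
Qed.

Lemma val_continuous (X : topologicalType) (A : set X) :
  continuous (fun x : A => val x : X).
Proof. exact: initial_continuous. Qed.

Lemma near_tube (T K : topologicalType) (V : set (T * K)%type) (x : T) :
  compact [set: K] -> (forall k, nbhs ((x, k) : (T * K)%type) V) ->
  \forall x' \near x, forall k, V (x', k).
Proof.
move=> /compact_near_coveringP cK H.
have h := cK T (nbhs x) (fun x' k => V (x', k)) (nbhs_filter x).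
have : \forall x' \near x, [set: K] `<=` (fun k => V (x', k)).
  apply: h => k _; have [[A B] /= [nA nB] AB] := H k.
  by exists (B, A) => // -[k' x'] [/= Bk Ax]; apply: AB.
by apply: filterS => x' Hx k; apply: Hx.
Qed.

Lemma open_tube (T K : topologicalType) (V : set (T * K)%type) :
  compact [set: K] -> open V -> open [set x | forall k, V (x, k)].
Proof.
move=> cK oV; rewrite openE => x Vx; apply: near_tube => // k.
exact: open_nbhs_nbhs.
Qed.

Definition AE (P : topologicalType) : Prop :=
  forall (N : topologicalType) (S : set N) (g : N -> P),
    metrizable R N -> closed S -> {within S, continuous g} ->
    exists2 G : N -> P, continuous G & forall x, S x -> G x = g x.

Definition ANE (P : topologicalType) : Prop :=
  forall (N : topologicalType) (S : set N) (g : N -> P),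
    metrizable R N -> closed S -> {within S, continuous g} ->
    exists (V : set N) (G : N -> P),
      [/\ open V, S `<=` V, cont_on V G & forall x, S x -> G x = g x].

Lemma lipfun_AE (P : Type) (d : P -> P -> R) (C : set (option P -> R)) :
  (forall p q, 0 <= d p q) -> AE (lipfun d C).
Proof.
move=> d0 N S g [dN dNm] cS cg.
have [S0|/set0P/negP/negPn/eqP S0] := pselect (S !=set0); last first.
  by exists (fun=> lipfun1 C d0) => [x|x]; [exact: cvg_cst|rewrite S0].
apply: (lipfun_extension_aux dNm S0 cS) => x e Sx e0.
move/subspace_continuousP: cg => /(_ x Sx).
move=> /(_ _ (near_metr (metrizes_lipdist _ _) (g x) e0)).
move=> /= /(nbhs_metr dNm) [r r0 H]; exists r => // y Sy xy.
exact/ltW/(H y xy Sy).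
Qed.

(** Off the image the inverse takes the value [x0]. Continuity within the image holds because closed
    sets have closed images. *)
Lemma closed_embedding_inv (X M : topologicalType) (e : X -> M) (x0 : X) :
  closed_embedding e ->
  exists2 s : M -> X, cancel e s & {within range e, continuous s}.
Proof.
move=> [ei ec ecl].
pose s m := if pselect (exists x, e x = m) is left H then projT1 (cid H) else x0.
have sK : cancel e s.
  move=> x; rewrite /s; case: pselect => [H|[]]; last by exists x.
  by apply: ei; exact: projT2 (cid H).
clearbody s; exists s => //.
apply/subspace_continuousP => _ [x _ <-]. rewrite /from_subspace sK => B.
rewrite nbhsE => -[B' [oB' B'x] B'B].
have : nbhs (e x) (~` (e @` (~` B'))).
  apply: open_nbhs_nbhs; split.
    by apply: closed_openC; apply: ecl; exact: open_closedC.
  by move=> [x' Bx' /ei xx]; apply: Bx'; rewrite xx.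
apply: filterS => m Hm [x' _ mx]; apply: B'B; rewrite /= -mx sK.
by apply: contrapT => Bx'; apply: Hm; exists x'.
Qed.

Lemma AE_AR (M : topologicalType) (m0 : M) : metrizable R M -> AE M -> AR R M.
Proof.
move=> mM aM; split=> // N e mN eN.
have [s sK sc] := closed_embedding_inv m0 eN.
have [_ _ ecl] := eN.
have [|G cG Gs] := aM N (range e) s mN _ sc; first by apply: ecl; exact: closedT.
exists [the continuousType N M of mkcts cG] => x.
by rewrite /= /mkcts Gs ?sK//; exists x.
Qed.

(** Total functions into [M] need a default value, so the extensor property is asked only of an
    inhabited [M]; an empty [M] is a retract of its empty neighbourhood. *)
Lemma ANE_ANR (M : topologicalType) :
  metrizable R M -> (M -> ANE M) -> ANR R M.
Proof.
move=> mM aM; split=> // N e mN eN.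
have [[m0]|M0] := pselect (inhabited M); last first.
  have F (u : set_type (@set0 N)) : False by have := set_mem (valP u).
  exists set0; split; [exact: open0|by move=> ? [m]; case: M0|].
  have c : continuous (fun u : set_type (@set0 N) => False_rect M (F u)).
    by move=> u; case: (F u).
  by exists [the continuousType (set_type (@set0 N)) M of mkcts c] => u; case: (F u).
have [s sK sc] := closed_embedding_inv m0 eN.
have [_ _ ecl] := eN.
have [|V [G [oV SV cG Gs]]] := aM m0 N (range e) s mN _ sc.
  by apply: ecl; exact: closedT.
exists V; split=> //.
have c : continuous (fun u : V => G (val u)).
  move=> u; apply: (@continuous_comp _ _ _ (fun u : V => val u : N) G).
    exact: val_continuous.
  exact/cG/set_mem/valP.
exists [the continuousType (set_type V) M of mkcts c] => u x ux.
by rewrite /= /mkcts ux Gs ?sK//; exists x.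
Qed.

Lemma isometry_closed_embedding (X M : topologicalType) (d : X -> X -> R)
    (d' : M -> M -> R) (e : X -> M) :
  metrizes d -> metrizes d' -> (forall x y, d' (e x) (e y) = d x y) ->
  closed (range e) -> closed_embedding e.
Proof.
move=> dX dM ed cl; split.
- by move=> x y xy; apply: (metr_eq0 dX); rewrite -ed xy metr_refl.
- move=> x; apply/(cvg_metr dM) => r r0.
  by apply: filterS (near_metr dX x r0) => y; rewrite ed.
- move=> A cA m clm.
  have [x _ xm] : range e m.
    by apply: cl => B /clm [_ [[x Ax <-] Bx]]; exists (e x); split=> //; exists x.
  subst m; exists x => //; apply: cA => B /(nbhs_metr dX) [r r0 rB].
  have [_ [[y Ay <-] /= xy]] := clm _ (near_metr dM (e x) r0).
  by exists y; split=> //; apply: rB; rewrite -ed.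
Qed.

(** * The Kuratowski embedding as a Z-set in an AR *)

Section Kuratowski.
Variables (P : topologicalType) (d : P -> P -> R) (C : set (option P -> R)).
Hypothesis dP : metrizes d.
Hypothesis d1 : forall p q, d p q <= 1.
Local Notation E := (lipfun d C).

Definition kurf (p : P) (j : option P) : R := if j is Some q then d p q else 0.

Hypothesis kurC : forall p, C (kurf p).

Definition kur (p : P) : E.
Proof.
exists (kurf p) => [[q|]|[q|]|q r|_] //=; rewrite ?metr_ge0 ?ler01//.
by rewrite (metr_sym dP q); exact: metr_tri.
Defined.

Lemma kur_isometry p q : lipdist (kur p) (kur q) = d p q.
Proof.
apply/le_anti/andP; split; last first.
  have := lipdist_ge (kur p) (kur q) (Some q).
  by rewrite /= (metr_refl dP q) subr0 ger0_norm// metr_ge0.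
apply: lipdist_le => -[r|] /=; last by rewrite subrr normr0 metr_ge0.
have := metr_tri dP q p r; have := metr_tri dP p q r.
rewrite (metr_sym dP q p) ler_norml => ? ?; apply/andP; split; lra.
Qed.

Lemma kur_continuous : continuous kur.
Proof.
move=> p; apply/(cvg_metr (metrizes_lipdist _ _)) => r r0.
by apply: filterS (near_metr dP p r0) => y; rewrite kur_isometry.
Qed.

Lemma kur_embedding : closed (range kur) -> closed_embedding kur.
Proof.
apply: (isometry_closed_embedding dP (metrizes_lipdist _ _)).
exact: kur_isometry.
Qed.

Lemma lipfun_AR : AR R E.
Proof.
have d0 := metr_ge0 dP.
apply: (AE_AR (lipfun1 C d0)); last exact: lipfun_AE.
by exists (@lipdist _ _ d C); exact: metrizes_lipdist.
Qed.

(** The homotopy behind the Z-set property: at time t the height is at least t, whereas it is 0 on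
    the image of [P]. If the new height is 0, nothing was raised, so the condition on [C] is
    inherited. *)
Definition lipraise (x : E * I) : E.
Proof.
pose f j := if j is None then Num.max (x.1 None) (val x.2) else x.1 j.
exists f => [[p|]|[p|]|p q|] /=.
- exact: lipf_ge0.
- by rewrite le_max lipf_ge0.
- exact: lipf_le1.
- by rewrite ge_max lipf_le1 I_le1.
- exact: lipf_lip.
- rewrite /f => H; have x0 : x.1 None = 0.
    by apply/le_anti; rewrite lipf_ge0 andbT -[leRHS]H le_max lexx.
  have -> : (fun j => if j is None then Num.max (x.1 None) (val x.2) else x.1 j)
      = x.1 by apply/funext => -[p|]//; rewrite H x0.
  exact: lipf_base.
Defined.

Lemma lipraise_continuous : continuous lipraise.
Proof.
move=> [a t]; apply/(cvg_metr (metrizes_lipdist _ _)) => r r0.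
have r2 : 0 < r / 2 by lra.
have nt : \forall s \near t, `|val t - val s| < r / 2.
  by have /cvgrPdist_lt := @val_continuous _ _ t; apply.
exists ([set b | lipdist a b < r / 2], [set s | `|val t - val s| < r / 2]).
  by split=> //=; apply: (near_metr (metrizes_lipdist _ _)).
move=> [b s] [/= ab ts]; apply: (@le_lt_trans _ _ (r / 2)); last by lra.
apply: lipdist_le => -[p|] /=.
  by have := lipdist_ge a b (Some p); lra.
have := lipdist_ge a b None; move: ts; rewrite ler_norml ltr_norml.
move=> /andP[? ?]; rewrite ler_norml => /andP[? ?].
by case: (leP (a None)); case: (leP (b None)) => ? ?; apply/andP; split; lra.
Qed.

Lemma kur_Zset : closed (range kur) -> Zset R (range kur).
Proof.
move=> cl; split=> //.
exists [the continuousType (E * I)%type E of mkcts lipraise_continuous].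
split=> [a|a t t0] /=.
  apply: lipf_inj => -[p|] //=; rewrite max_l//; exact: lipf_ge0.
rewrite /mkcts => -[p _ /(congr1 (fun f : E => f None)) /=].
move=> t00; suff : 0 < Num.max (a None) (val t) by rewrite -t00 ltxx.
by rewrite lt_max t0 orbT.
Qed.

Definition kur_zpair (cl : closed (range kur)) : zpair R P :=
  ZPair lipfun_AR (kur_embedding cl) (kur_Zset cl).

Lemma kur_range : C = range kurf -> range kur = [set a : E | a None = 0].
Proof.
move=> CE; apply/seteqP; split=> [_ [p _ <-]//|a /= a0].
have := lipf_base a0; rewrite {1}CE => -[p _ pa]; exists p => //.
by apply: lipf_inj => j /=; rewrite pa.
Qed.

(** For this [C] the image is the zero set of the height, which is closed even if [P] is
    incomplete. *)
Lemma kur_closed : C = range kurf -> closed (range kur).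
Proof.
move=> CE a; rewrite kur_range// => cl; apply/eqP; rewrite -normr_le0.
apply/ler_addgt0Pr => e e0; rewrite add0r.
have [b [/= b0 ab]] := cl _ (near_metr (metrizes_lipdist _ _) a e0).
by have := lipdist_ge a b None; rewrite b0 subr0; lra.
Qed.

Lemma kur_closed_compact : compact [set: P] -> closed (range kur).
Proof.
move=> cP; apply: compact_closed.
  exact: (metr_hausdorff (metrizes_lipdist _ _)).
by apply: continuous_compact => //; apply: continuous_subspaceT; exact: kur_continuous.
Qed.

(** The argument of Arzela and Ascoli: along an ultrafilter every coordinate converges, and the
    common Lipschitz constant with compactness of [P] makes the convergence uniform. The limit is a
    point of the space because [C] imposes nothing. *)
Lemma lipfun_compact : C = setT -> compact [set: P] -> compact [set: E].
Proof.
move=> CE cP; rewrite compact_ultra => F FU _.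
have lim j : exists l : R, (fun a : E => a j) @ F --> l.
  have := @segment_compact R 0 1; rewrite compact_ultra.
  move=> /(_ _ (fmap_ultra (fun a : E => a j) FU)) [].
    suff : F [set a : E | `[0, 1]%classic (a j)] by [].
    apply: filterS filterT => a _ /=; rewrite in_itv /=.
    by rewrite lipf_ge0 lipf_le1.
  by move=> l [_ Fl]; exists l.
have [l lF] := choice lim.
have near1 j (e : R) : 0 < e -> F [set a : E | `|l j - a j| < e].
  by move=> e0; have /cvgrPdist_lt := lF j; apply.
have l0 j : 0 <= l j.
  apply/ler_addgt0Pr => e e0; have /filter_ex [a] := near1 j e e0.
  by rewrite /= ltr_norml => /andP[]; have := lipf_ge0 a j; lra.
have l1 j : l j <= 1.
  apply/ler_addgt0Pr => e e0; have /filter_ex [a] := near1 j e e0.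
  by rewrite /= ltr_norml => /andP[]; have := lipf_le1 a j; lra.
have lL p q : l (Some p) <= l (Some q) + d p q.
  apply/ler_addgt0Pr => e e0; have e2 : 0 < e / 2 by lra.
  have /filter_ex [a] : F ([set a : E | `|l (Some p) - a (Some p)| < e / 2] `&`
      [set a : E | `|l (Some q) - a (Some q)| < e / 2]).
    by apply: filterI; exact: near1.
  rewrite /= !ltr_norml => -[/andP[? ?] /andP[? ?]].
  by have := lipf_lip a p q; lra.
have lC : l None = 0 -> C l by rewrite CE.
pose L : E := LipFun l0 l1 lL lC.
exists L; split=> // B /(nbhs_metr (metrizes_lipdist _ _)) [e e0 eB].
suff : F [set a | lipdist L a < e] by apply: filterS => a; exact: eB.
have e2 : 0 < e / 2 by lra.
have e8 : 0 < e / 8 by lra.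
have : F [set a : E | forall p, `|l (Some p) - a (Some p)| <= e / 2].
  move/compact_near_coveringP: cP.
  move=> /(_ E F (fun a p => `|l (Some p) - a (Some p)| <= e / 2) _) H.
  have : F (fun a : E => [set: P] `<=`
      (fun p => `|l (Some p) - a (Some p)| <= e / 2)).
    apply: H => p _.
    (* Three errors of [e / 8]: at [p], and from [p] to [q] for each of [l] and [a]. *)
    exists ([set q | d p q < e / 8], [set a : E | `|l (Some p) - a (Some p)| < e / 8]).
      by split; [exact: (near_metr dP)|exact: near1].
    move=> [q a] /= [pq]; rewrite ltr_norml ler_norml => /andP[? ?].
    have := lipf_lip a p q; have := lipf_lip a q p.
    have := lL p q; have := lL q p; rewrite (metr_sym dP q p) => *.
    by apply/andP; split; lra.
  by apply: filterS => a Ha p; exact: Ha.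
move=> n1; have n2 := near1 None _ e2; apply: filterS (filterI n1 n2).
move=> a [H1 H2]; apply: (@le_lt_trans _ _ (e / 2)); last by lra.
by apply: lipdist_le => -[p|]; [exact: H1|exact/ltW/H2].
Qed.

End Kuratowski.
End Extensors.

(** * Homotopies over a subset *)

Section Homotopies.
Variable R : realType.
Local Notation I := (set_type (@unit_interval R)).
Local Notation I0 := (@I0 R).
Local Notation I1 := (@I1 R).
Implicit Types T U P : topologicalType.

Lemma continuous_pair T U P (f : T -> U) (g : T -> P) (x : T) :
  {for x, continuous f} -> {for x, continuous g} ->
  {for x, continuous (fun x => (f x, g x))}.
Proof. by move=> cf cg; exact: cvg_pair. Qed.

Lemma continuous_fst T U (z : T * U) : {for z, continuous fst}.
Proof. exact: cvg_fst. Qed.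

Lemma continuous_snd T U (z : T * U) : {for z, continuous snd}.
Proof. exact: cvg_snd. Qed.

Lemma continuous_pairl T U (u : U) (x : T) :
  {for x, continuous (fun y : T => (y, u))}.
Proof. by apply: cvg_pair; [exact: cvg_id|exact: cvg_cst]. Qed.

Lemma continuous_pairr T U (t : T) (x : U) :
  {for x, continuous (fun y : U => (t, y))}.
Proof. by apply: cvg_pair; [exact: cvg_cst|exact: cvg_id]. Qed.

Lemma continuous_at_near T U (f g : T -> U) (x : T) :
  (\forall y \near x, f y = g y) -> {for x, continuous f} ->
  {for x, continuous g}.
Proof.
move=> fg cf B /=; rewrite -(nbhs_singleton fg) => /cf fB.
suff : nbhs x (g @^-1` B) by [].
by apply: filterS (filterI fg fB) => y [/= <-].
Qed.

Lemma continuous_if T U (c : T -> R) (f g : T -> U) (x : T) :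
  {for x, continuous c} -> {for x, continuous f} -> {for x, continuous g} ->
  (c x = 0 -> f x = g x) ->
  {for x, continuous (fun y => if c y <= 0 then f y else g y)}.
Proof.
move=> cc cf cg fg.
have [x0|x0|x0] := ltgtP (c x) 0.
- apply: (continuous_at_near _ cf).
  have : \forall y \near x, c y < 0 by apply: (cc [set r | r < 0]); exact: lt_nbhsl.
  by apply: filterS => y y0; rewrite (ltW y0).
- apply: (continuous_at_near _ cg).
  have : \forall y \near x, 0 < c y by apply: (cc [set r | 0 < r]); exact: lt_nbhsr.
  by apply: filterS => y y0; rewrite leNgt y0.
- move=> B /=; rewrite x0 lexx => nB.
  have nB' : nbhs (g x) B by rewrite -fg.
  suff : nbhs x ((fun y => if c y <= 0 then f y else g y) @^-1` B) by [].
  have fB : nbhs x (f @^-1` B) := cf _ nB.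
  have gB : nbhs x (g @^-1` B) := cg _ nB'.
  apply: filterS (filterI fB gB) => y [/= fy gy].
  by case: ifP.
Qed.

Lemma clamp_proof (r : R) : Num.max 0 (Num.min 1 r) \in @unit_interval R.
Proof.
rewrite inE /unit_interval /= in_itv /= le_max lexx /= ge_max ler01 /=.
by rewrite ge_min lexx.
Qed.
(** The retraction of the line onto the interval, so that times can be given by real formulas
    without proofs of their range. *)
Definition clamp (r : R) : I := exist _ (Num.max 0 (Num.min 1 r)) (clamp_proof r).

Lemma clamp_le0 (r : R) : r <= 0 -> clamp r = I0.
Proof.
move=> r0; apply: val_inj => /=; rewrite min_r ?max_l//.
exact: le_trans ler01.
Qed.

Lemma clamp_ge1 (r : R) : 1 <= r -> clamp r = I1.
Proof. by move=> r1; apply: val_inj => /=; rewrite min_l// max_r. Qed.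

Lemma val_clamp (r : R) : val (clamp r) = Num.max 0 (Num.min 1 r).
Proof. by []. Qed.

Lemma clamp_continuous : continuous clamp.
Proof.
move=> r; apply: cvg_set_val; apply/cvgrPdist_lt => e e0.
have : \forall s \near r, `|r - s| < e by have /cvgrPdist_lt := @cvg_id _ (nbhs r); apply.
apply: filterS => s; rewrite !val_clamp => rs; apply: le_lt_trans rs.
have := ler_norm (r - s); have := ler_norm (s - r); rewrite (distrC s r) => h1 h2.
rewrite ler_norml; case: (leP 1 r) => ?; case: (leP 1 s) => ?.
- by rewrite max_r//; apply/andP; split; lra.
- by rewrite max_r//; case: (leP 0 s) => ?; apply/andP; split; lra.
- by rewrite (max_r ler01); case: (leP 0 r) => ?; apply/andP; split; lra.
- by case: (leP 0 r) => ?; case: (leP 0 s) => ?; apply/andP; split; lra.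
Qed.

Definition irev (t : I) : I := clamp (1 - val t).

Lemma irev0 : irev I0 = I1.
Proof. by rewrite /irev /= subr0 clamp_ge1. Qed.

Lemma irev1 : irev I1 = I0.
Proof. by rewrite /irev /= subrr clamp_le0. Qed.

Lemma irev_continuous : continuous irev.
Proof.
move=> t; apply: (@continuous_comp _ _ _ (fun t : I => 1 - val t) clamp); last first.
  exact: clamp_continuous.
apply: (@continuous_comp _ _ _ (fun t : I => val t) (fun r : R => 1 - r)).
  exact: val_continuous.
by apply: cvgB; [exact: cvg_cst|exact: cvg_id].
Qed.

(** As for [cont_on], the homotopy is a total function and only what happens over [W] counts. *)
Definition hom_on T P (W : set T) (f g : T -> P) : Prop :=
  exists H : T * I -> P,
    [/\ forall x t, W x -> {for (x, t), continuous H},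
        forall x, W x -> H (x, I0) = f x & forall x, W x -> H (x, I1) = g x].

Lemma hom_onW T P (W W' : set T) (f g : T -> P) :
  W' `<=` W -> hom_on W f g -> hom_on W' f g.
Proof.
by move=> WW [H [cH H0 H1]]; exists H; split=> [x t /WW/cH|x /WW/H0|x /WW/H1].
Qed.

Lemma hom_on_eq T P (W : set T) (f g : T -> P) :
  cont_on W f -> (forall x, W x -> f x = g x) -> hom_on W f g.
Proof.
move=> cf fg; exists (fun z => f z.1); split=> // x t Wx.
by apply: (@continuous_comp _ _ _ fst f); [exact: continuous_fst|exact: cf].
Qed.

Lemma hom_on_ext T P (W : set T) (f g f' g' : T -> P) :
  (forall x, W x -> f x = f' x) -> (forall x, W x -> g x = g' x) ->
  hom_on W f g -> hom_on W f' g'.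
Proof.
move=> ff gg [H [cH H0 H1]]; exists H.
by split=> // x Wx; rewrite ?H0 ?H1 ?ff ?gg.
Qed.

Lemma hom_on_sym T P (W : set T) (f g : T -> P) :
  hom_on W f g -> hom_on W g f.
Proof.
move=> [H [cH H0 H1]]; exists (fun z => H (z.1, irev z.2)).
split=> [x t Wx|x Wx|x Wx]; rewrite /= ?irev0 ?irev1 ?H0 ?H1//.
apply: (@continuous_comp _ _ _ (fun z : T * I => (z.1, irev z.2)) H) => /=.
  apply: continuous_pair; first exact: continuous_fst.
  apply: (@continuous_comp _ _ _ snd irev); first exact: continuous_snd.
  exact: irev_continuous.
exact: cH.
Qed.

Definition concat T P (H H' : T * I -> P) (z : T * I) : P :=
  if val z.2 - 1 / 2 <= 0 then H (z.1, clamp (2 * val z.2))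
  else H' (z.1, clamp (2 * val z.2 - 1)).

Lemma concat0 T P (H H' : T * I -> P) x : concat H H' (x, I0) = H (x, I0).
Proof. by rewrite /concat /= ifT ?mulr0 ?clamp_le0//; lra. Qed.

Lemma concat1 T P (H H' : T * I -> P) x : concat H H' (x, I1) = H' (x, I1).
Proof. by rewrite /concat /= ifF ?clamp_ge1//; lra. Qed.

Lemma rescale_continuous T (a b : R) (z : T * I) :
  {for z, continuous (fun z : T * I => (z.1, clamp (a * val z.2 - b)))}.
Proof.
apply: continuous_pair; first exact: continuous_fst.
apply: (@continuous_comp _ _ _ (fun z : T * I => a * val z.2 - b) clamp).
  apply: cvgB; last exact: cvg_cst.
  apply: cvgM; first exact: cvg_cst.
  apply: (@continuous_comp _ _ _ snd (fun t : I => val t)).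
    exact: continuous_snd.
  exact: val_continuous.
exact: clamp_continuous.
Qed.

Lemma concat_continuous T P (H H' : T * I -> P) x t :
  (forall t, {for (x, t), continuous H}) ->
  (forall t, {for (x, t), continuous H'}) -> H (x, I1) = H' (x, I0) ->
  {for (x, t), continuous (concat H H')}.
Proof.
move=> cH cH' HH.
apply: (@continuous_if _ _ (fun z : T * I => val z.2 - 1 / 2)
  (fun z => H (z.1, clamp (2 * val z.2)))
  (fun z => H' (z.1, clamp (2 * val z.2 - 1)))).
- apply: cvgB; last exact: cvg_cst.
  apply: (@continuous_comp _ _ _ snd (fun t : I => val t)).
    exact: continuous_snd.
  exact: val_continuous.
- have -> : (fun z : T * I => H (z.1, clamp (2 * val z.2))) =
      (fun z : T * I => H (z.1, clamp (2 * val z.2 - 0))).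
    by apply/funext => z; rewrite subr0.
  apply: (@continuous_comp _ _ _ (fun z : T * I => (z.1, clamp (2 * val z.2 - 0))) H).
    exact: rescale_continuous.
  exact: cH.
- apply: (@continuous_comp _ _ _ (fun z : T * I => (z.1, clamp (2 * val z.2 - 1))) H').
    exact: rescale_continuous.
  exact: cH'.
- move=> /= t2; rewrite clamp_ge1; last by lra.
  by rewrite clamp_le0//; lra.
Qed.

Lemma hom_on_trans T P (W : set T) (g f h : T -> P) :
  hom_on W f g -> hom_on W g h -> hom_on W f h.
Proof.
move=> [H [cH H0 H1]] [H' [cH' H'0 H'1]]; exists (concat H H').
split=> [x t Wx|x Wx|x Wx]; last 2 first.
- by rewrite concat0 H0.
- by rewrite concat1 H'1.
by apply: concat_continuous => [u|u|]; rewrite ?H1 ?H'0//; [exact: cH|exact: cH'].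
Qed.

Lemma hom_on_comp T U P (W : set T) (W' : set U) (k : T -> U) (f g : U -> P) :
  cont_on W k -> (forall x, W x -> W' (k x)) -> hom_on W' f g ->
  hom_on W (f \o k) (g \o k).
Proof.
move=> ck WW [H [cH H0 H1]]; exists (fun z => H (k z.1, z.2)).
split=> [x t Wx|x /WW/H0|x /WW/H1]//.
apply: (@continuous_comp _ _ _ (fun z : T * I => (k z.1, z.2)) H).
  apply: continuous_pair; last exact: continuous_snd.
  by apply: (@continuous_comp _ _ _ fst k); [exact: continuous_fst|exact: ck].
exact/cH/WW.
Qed.

Lemma comp_hom_on T U P (W : set T) (f g : T -> U) (k : U -> P) :
  continuous k -> hom_on W f g -> hom_on W (k \o f) (k \o g).
Proof.
move=> ck [H [cH H0 H1]]; exists (k \o H).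
split=> [x t Wx|x Wx|x Wx] /=; rewrite ?H0 ?H1//.
by apply: continuous_comp; [exact: cH|exact: ck].
Qed.

Lemma homotopicP T P (f g : continuousType T P) :
  homotopic R f g <-> hom_on setT f g.
Proof.
split=> [[H [H0 H1]]|[H [cH H0 H1]]].
  by exists H; split=> // x t _; exact: cts_fun.
have c : continuous H by move=> [x t]; exact: cH.
exists [the continuousType (T * I)%type P of mkcts c].
by split=> x; [exact: H0|exact: H1].
Qed.

Lemma homotopic_refl T P (f : continuousType T P) : homotopic R f f.
Proof. by apply/homotopicP; apply: hom_on_eq => // x _; exact: cts_fun. Qed.

Lemma homotopic_sym T P (f g : continuousType T P) :
  homotopic R f g -> homotopic R g f.
Proof. by move/homotopicP/hom_on_sym/homotopicP. Qed.

Lemma homotopic_trans T P (g f h : continuousType T P) :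
  homotopic R f g -> homotopic R g h -> homotopic R f h.
Proof.
by move=> /homotopicP fg /homotopicP gh; apply/homotopicP/(hom_on_trans fg gh).
Qed.

Lemma homotopic_comp T U P (f f' : continuousType T U)
    (g g' : continuousType U P) :
  homotopic R f f' -> homotopic R g g' ->
  homotopic R (ctscomp g f) (ctscomp g' f').
Proof.
move=> /homotopicP ff /homotopicP gg; apply: (@homotopic_trans _ _ (ctscomp g f')).
  by apply/homotopicP; apply: comp_hom_on ff; exact: cts_fun.
apply/homotopicP; apply: hom_on_comp gg => // x _; exact: cts_fun.
Qed.

End Homotopies.

(** * Equiconnectedness of the function space, ANRs as extensors *)

Section AbsoluteNeighborhoodRetracts.
Variable R : realType.
Local Notation I := (set_type (@unit_interval R)).
Local Notation I0 := (@I0 R).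
Local Notation I1 := (@I1 R).
Implicit Types T U V P N X M : topologicalType.

Lemma metrizes_sub T (d : T -> T -> R) (A : set T) :
  metrizes d -> metrizes (fun x y : A => d (val x) (val y)).
Proof.
move=> dT; split.
- move=> x y; split=> [/(metr_eq0 dT)/val_inj//|->]; exact: metr_refl.
- by move=> x y; exact: metr_sym.
- by move=> x y z; exact: metr_tri.
- move=> x; apply/seteqP; split=> B.
    move=> [_ [[W oW <-] /= Wx] WB].
    have /(nbhs_metr dT) [e e0 eW] : nbhs (val x) W by exact: open_nbhs_nbhs.
    by exists e => // y xy; apply: WB; exact: eW.
  move=> [e /= e0 eB]; have : \forall y \near x, d (val x) (val y) < e.
    by apply: (val_continuous (near_metr dT (val x) e0)).
  by apply: filterS => y; exact: eB.
Qed.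

Lemma metrizes_I : metrizes (fun s t : I => `|val s - val t|).
Proof. exact: (metrizes_sub _ (metrizes_real R)). Qed.

Lemma near_tube_dist N P (d : P -> P -> R) (F : N * I -> P) (n : N) (e : R) :
  metrizes d -> (forall t, {for (n, t), continuous F}) -> 0 < e ->
  \forall n' \near n, forall t, d (F (n, t)) (F (n', t)) < e.
Proof.
move=> dP cF e0.
apply: (@near_tube _ _ [set z : (N * I)%type | d (F (n, z.2)) (F z) < e]).
  exact: compact_I.
move=> t; have e2 : 0 < e / 2 by lra.
have c1 : \forall z \near ((n, t) : (N * I)%type), d (F (n, t)) (F (n, z.2)) < e / 2.
  have : {for (n, t), continuous (fun z : N * I => F (n, z.2))}.
    apply: (@continuous_comp _ _ _ (fun z : N * I => (n, z.2)) F).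
      by apply: continuous_pair; [exact: cvg_cst|exact: continuous_snd].
    exact: cF.
  by move=> /(_ _ (near_metr dP _ e2)).
have c2 : \forall z \near ((n, t) : (N * I)%type), d (F (n, t)) (F z) < e / 2.
  by have := cF t _ (near_metr dP _ e2).
apply: filterS (filterI c1 c2) => z [/= h1 h2].
have := metr_tri dP (F (n, t)) (F (n, z.2)) (F z).
by rewrite (metr_sym dP (F (n, z.2)) (F (n, t))); lra.
Qed.

Lemma normM_le (u v w : R) : `|u| <= 1 -> `|v| <= w -> `|u * v| <= w.
Proof. by move=> u1 vw; rewrite normrM -[w]mul1r ler_pM. Qed.

Section Mixing.
Variables (P : Type) (d : P -> P -> R) (C : set (option P -> R)).
Local Notation E := (lipfun d C).
Hypothesis d0 : forall p q, 0 <= d p q.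

(* the coordinate [None] is positive unless t = 0, t = 1 or the two functions are
   equal, so the mixture satisfies the condition on C *)
Let mix (z : (E * E) * I) (j : option P) : R :=
  (1 - val z.2) * z.1.1 j + val z.2 * z.1.2 j +
  (if j is None then val z.2 * (1 - val z.2) * lipdist z.1.1 z.1.2 else 0).

Let lipdist_ge0 (a b : E) : 0 <= lipdist a b.
Proof. exact: le_trans (normr_ge0 _) (lipdist_ge a b None). Qed.

Let lipdist_le1 (a b : E) : lipdist a b <= 1.
Proof.
apply: lipdist_le => j; rewrite ler_norml.
have := lipf_ge0 a j; have := lipf_le1 a j.
by have := lipf_ge0 b j; have := lipf_le1 b j => *; apply/andP; split; lra.
Qed.

Let mix_ge0 z j : 0 <= mix z j.
Proof.
have t0 := I_ge0 z.2; have t1 := I_le1 z.2.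
have s0 : 0 <= 1 - val z.2 by lra.
rewrite /mix !addr_ge0 ?mulr_ge0 ?lipf_ge0//.
by case: j => [p|]//; rewrite !mulr_ge0.
Qed.

Let mix_Some z p : mix z (Some p) <= 1.
Proof.
have t0 := I_ge0 z.2; have t1 := I_le1 z.2.
have s0 : 0 <= 1 - val z.2 by lra.
rewrite /mix addr0; have := ler_wpM2l s0 (lipf_le1 z.1.1 (Some p)).
by have := ler_wpM2l t0 (lipf_le1 z.1.2 (Some p)); lra.
Qed.

Let mix_lip z p q : mix z (Some p) <= mix z (Some q) + d p q.
Proof.
have t0 := I_ge0 z.2; have t1 := I_le1 z.2.
have s0 : 0 <= 1 - val z.2 by lra.
rewrite /mix !addr0; have := ler_wpM2l s0 (lipf_lip z.1.1 p q).
by have := ler_wpM2l t0 (lipf_lip z.1.2 p q); lra.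
Qed.

Let cmix z j := Num.min 1 (mix z j).

Lemma mix0 a b j : mix (a, b, I0) j = a j.
Proof.
by rewrite /mix /= subr0 mul1r !mul0r addr0; case: j => [p|]; rewrite addr0.
Qed.

Lemma mix1 a b j : mix (a, b, I1) j = b j.
Proof.
by rewrite /mix /= subrr mul1r !mul0r add0r mulr0; case: j => [p|];
  rewrite ?mul0r addr0.
Qed.

Lemma mixxx a t j : mix (a, a, t) j = a j.
Proof.
rewrite /mix /= lipdist_refl mulr0.
have -> : (if j is None then 0 else 0) = 0 :> R by case: j.
by rewrite addr0 -mulrDl subrK mul1r.
Qed.

Let cmix_base z : cmix z None = 0 -> C (cmix z).
Proof.
move: z => [[a b] t] H.
have m0 : mix (a, b, t) None = 0.
  by move: H; rewrite /cmix; case: leP => // _ /eqP; rewrite oner_eq0.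
have cE (f : E) : (forall j, mix (a, b, t) j = f j) -> C (cmix (a, b, t)).
  move=> mf; have -> : cmix (a, b, t) = f.
    by apply/funext => j; rewrite /cmix mf min_r// lipf_le1.
  by apply: lipf_base; rewrite -mf.
have t0 := I_ge0 t; have t1 := I_le1 t.
have s0 : 0 <= 1 - val t by lra.
have : val t * (1 - val t) * lipdist a b = 0.
  apply/le_anti; rewrite !mulr_ge0// andbT -m0 /mix /=.
  by rewrite ler_wpDl// addr_ge0// mulr_ge0// lipf_ge0.
move/eqP; rewrite !mulf_eq0 subr_eq0 -orbA => /or3P[/eqP tE|/eqP tE|/eqP/lipdist_eq0 ab].
- have -> : t = I0 by exact: val_inj.
  by rewrite (_ : t = I0) in m0 cE *; [apply: cE => j; exact: mix0|exact: val_inj].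
- rewrite (_ : t = I1) in m0 cE *; [apply: cE => j; exact: mix1|exact: val_inj].
- by subst b; apply: (cE a) => j; exact: mixxx.
Qed.

Definition lipmix (z : (E * E) * I) : E.
Proof.
exists (cmix z) => [j|j|p q|].
- by rewrite le_min ler01 mix_ge0.
- by rewrite ge_min lexx.
- by rewrite /cmix !min_r ?mix_Some//; exact: mix_lip.
- exact: cmix_base.
Defined.

Lemma lipmix0 a b : lipmix (a, b, I0) = a.
Proof. by apply: lipf_inj => j /=; rewrite /cmix mix0 min_r// lipf_le1. Qed.

Lemma lipmix1 a b : lipmix (a, b, I1) = b.
Proof. by apply: lipf_inj => j /=; rewrite /cmix mix1 min_r// lipf_le1. Qed.

Lemma lipmixxx a t : lipmix (a, a, t) = a.
Proof. by apply: lipf_inj => j /=; rewrite /cmix mixxx min_r// lipf_le1. Qed.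

(** One variable is changed at a time; every cofactor has absolute value at most 1, and the
    resulting bound is uniform in [j]. *)
Let mix_dist a b t a' b' s j : `|mix (a, b, t) j - mix (a', b', s) j| <=
  2 * lipdist a a' + 2 * lipdist b b' + 2 * `|val t - val s|.
Proof.
have t0 := I_ge0 t; have t1 := I_le1 t; have s0 := I_ge0 s; have s1 := I_le1 s.
have p1 : `|(1 - val t) * (a j - a' j)| <= lipdist a a'.
  by apply: normM_le (lipdist_ge _ _ _); rewrite ger0_norm; lra.
have p2 : `|val t * (b j - b' j)| <= lipdist b b'.
  by apply: normM_le (lipdist_ge _ _ _); rewrite ger0_norm; lra.
have p3 : `|(b' j - a' j) * (val t - val s)| <= `|val t - val s|.
  apply: normM_le (lexx _); exact: le_trans (lipdist_ge _ _ _) (lipdist_le1 _ _).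
pose D := lipdist a b; pose D' := lipdist a' b'.
have DD : `|D - D'| <= lipdist a a' + lipdist b b'.
  have := lipdist_tri a' a b; have := lipdist_tri b' a' b.
  have := lipdist_tri a a' b'; have := lipdist_tri b a b'.
  rewrite -/D -/D' (lipdist_sym a' a) (lipdist_sym b' b) => *.
  by rewrite ler_norml; apply/andP; split; lra.
have p4 : `|val t * (1 - val t) * (D - D')| <= lipdist a a' + lipdist b b'.
  apply: normM_le DD; apply: normM_le; first by rewrite ger0_norm.
  by rewrite ger0_norm; lra.
(* This comes from t(1 - t) - s(1 - s) = (1 - t - s)(t - s). *)
have p5 : `|(1 - val t - val s) * D' * (val t - val s)| <= `|val t - val s|.
  apply: normM_le (lexx _); apply: normM_le; first by rewrite ler_norml; apply/andP; split; lra.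
  by rewrite /D' ger0_norm ?lipdist_le1 ?lipdist_ge0.
have n1 := lipdist_ge0 a a'; have n2 := lipdist_ge0 b b'.
have n3 := normr_ge0 (val t - val s).
case: j p1 p2 p3 => [p|] p1 p2 p3.
  have -> : mix (a, b, t) (Some p) - mix (a', b', s) (Some p) =
    (1 - val t) * (a (Some p) - a' (Some p)) +
    val t * (b (Some p) - b' (Some p)) +
    (b' (Some p) - a' (Some p)) * (val t - val s) by rewrite /mix /=; ring.
  apply: le_trans (ler_normD _ _) _; apply: le_trans (lerD (ler_normD _ _) p3) _.
  by lra.
have -> : mix (a, b, t) None - mix (a', b', s) None =
    (1 - val t) * (a None - a' None) + val t * (b None - b' None) +
    (b' None - a' None) * (val t - val s) + val t * (1 - val t) * (D - D') +
    (1 - val t - val s) * D' * (val t - val s).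
  by rewrite /mix /= -/D -/D'; ring.
apply: le_trans (ler_normD _ _) _; apply: le_trans (lerD (ler_normD _ _) p5) _.
have := ler_normD ((1 - val t) * (a None - a' None) + val t * (b None - b' None))
  ((b' None - a' None) * (val t - val s)).
have := ler_normD ((1 - val t) * (a None - a' None)) (val t * (b None - b' None)).
by lra.
Qed.

Lemma lipmix_continuous : continuous lipmix.
Proof.
have mE := @metrizes_lipdist R P d C.
have mz := metrizes_prod (metrizes_prod mE mE) metrizes_I.
move=> [[a b] t]; apply/(cvg_metr mE) => e e0; have e4 : 0 < e / 4 by lra.
apply: filterS (near_metr mz _ e4) => -[[a' b'] s]; rewrite /prod_dist /= => H.
apply: (@le_lt_trans _ _ (2 * e / 4)); last by lra.
apply: lipdist_le => j /=; have := mix_dist a b t a' b' s j.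
rewrite /cmix; set u := mix _ _; set v := mix _ _; rewrite !ler_norml => /andP[h1 h2].
by case: (leP 1 u); case: (leP 1 v) => ? ?; apply/andP; split; lra.
Qed.

Lemma lipmix_pair_continuous T (e : T -> E) : continuous e ->
  continuous (fun z : (T * T) * I => lipmix (e z.1.1, e z.1.2, z.2)).
Proof.
move=> ce z.
apply: (@continuous_comp _ _ _ (fun z : (T * T) * I => (e z.1.1, e z.1.2, z.2))).
  apply: continuous_pair; last exact: continuous_snd.
  apply: continuous_pair; (apply: continuous_comp; last exact: ce);
    (apply: continuous_comp; first exact: continuous_fst).
    exact: continuous_fst.
  exact: continuous_snd.
exact: lipmix_continuous.
Qed.

End Mixing.

Definition nbhd_retract P (d : P -> P -> R) (C : set (option P -> R))
    (e : P -> lipfun d C) (O : set (lipfun d C)) (r : lipfun d C -> P) : Prop :=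
  [/\ continuous e, open O, forall p, O (e p), cont_on O r &
      forall p, r (e p) = p].

Lemma total_extension T P (O : set T) (p0 : P) (r : O -> P) :
  open O -> continuous r ->
  exists2 r' : T -> P, cont_on O r' & forall u : O, r' (val u) = r u.
Proof.
move=> oO cr; pose r' x := if pselect (O x) is left H then r (exist _ x (mem_set H)) else p0.
have r'E u : r' (val u) = r u.
  rewrite /r'; case: pselect => [H|[]]; last exact: (set_mem (valP u)).
  by congr r; exact: val_inj.
exists r' => // x Ox B; have -> : r' x = r (exist _ x (mem_set Ox)) by rewrite -r'E.
move=> /cr [_ [[W oW <-] /= Wx] WB].
have nWO : nbhs x (W `&` O) by apply: open_nbhs_nbhs; split; [exact: openI|].
suff : nbhs x (r' @^-1` B) by [].
apply: filterS nWO => y [Wy Oy]; rewrite /= -[y]/(val (exist _ y (mem_set Oy) : O)) r'E.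
exact: WB.
Qed.

Lemma metrizable_bounded P : metrizable R P ->
  exists2 d : P -> P -> R, metrizes d & forall p q, d p q <= 1.
Proof.
move=> [d dP]; exists (fun x y => Num.min 1 (d x y)); first exact: metr_bounded.
by move=> p q; rewrite ge_min lexx.
Qed.

(** One concrete ambient space, with its explicit formulas, replaces the arbitrary ambient spaces in
    the definition of an ANR. *)
Lemma ANR_nbhd_retract P (p0 : P) : ANR R P ->
  exists (d : P -> P -> R) (C : set (option P -> R)) (e : P -> lipfun d C)
         (O : set (lipfun d C)) (r : lipfun d C -> P),
    (forall p q, 0 <= d p q) /\ nbhd_retract e O r.
Proof.
move=> [/metrizable_bounded [d dP d1] aP].
pose C := range (kurf d).
have CP p : C (kurf d p) by exists p.
have emb := kur_embedding (@kur_closed _ _ _ _ dP d1 CP erefl).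
have mE : metrizable R (lipfun d C).
  by exists (@lipdist _ _ d C); exact: metrizes_lipdist.
have [O [oO eO [r rE]]] := aP _ _ mE emb.
have [r' cr' r'E] := total_extension p0 oO (@cts_fun _ _ r).
exists d, C, (kur dP d1 CP), O, r'; split; first exact: metr_ge0.
have Op p : O (kur dP d1 CP p) by apply: eO; exists p.
split=> //; first by case: emb.
move=> p; pose u : O := exist _ (kur dP d1 CP p) (mem_set (Op p)).
by rewrite -[kur _ _ _ _]/(val u) r'E; exact: rE.
Qed.

Lemma AR_nbhd_retract P : AR R P ->
  exists (d : P -> P -> R) (C : set (option P -> R)) (e : P -> lipfun d C)
         (r : lipfun d C -> P),
    (forall p q, 0 <= d p q) /\ nbhd_retract e setT r.
Proof.
move=> [/metrizable_bounded [d dP d1] aP].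
pose C := range (kurf d).
have CP p : C (kurf d p) by exists p.
have emb := kur_embedding (@kur_closed _ _ _ _ dP d1 CP erefl).
have mE : metrizable R (lipfun d C).
  by exists (@lipdist _ _ d C); exact: metrizes_lipdist.
have [r rE] := aP _ _ mE emb.
exists d, C, (kur dP d1 CP), r; split; first exact: metr_ge0.
split=> //; first by case: emb.
- exact: openT.
- by move=> x _; exact: cts_fun.
Qed.

Lemma within_comp N U V (S : set N) (g : N -> U) (f : U -> V) :
  continuous f -> {within S, continuous g} -> {within S, continuous (f \o g)}.
Proof.
move=> cf cg x; apply: (@continuous_comp (subspace S) U V g f); first exact: cg.
exact: cf.
Qed.

Lemma ANR_ANE P (p0 : P) : ANR R P -> ANE R P.
Proof.
move=> /(ANR_nbhd_retract p0) [d [C [e [O [r [d0 [ce oO Oe cr re]]]]]]].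
move=> N S g mN cS cg.
have [G cG Gg] := lipfun_AE d0 mN cS (within_comp ce cg).
exists (G @^-1` O), (r \o G); split.
- by apply: open_comp => // x _; exact: cG.
- by move=> x Sx /=; rewrite Gg//=; exact: Oe.
- by move=> x Ox; apply: continuous_comp; [exact: cG|exact: cr].
- by move=> x Sx /=; rewrite Gg//= re.
Qed.

Lemma AR_AE P : AR R P -> AE R P.
Proof.
move=> /AR_nbhd_retract [d [C [e [r [d0 [ce oO Oe cr re]]]]]].
move=> N S g mN cS cg.
have [G cG Gg] := lipfun_AE d0 mN cS (within_comp ce cg).
exists (r \o G) => x.
  by apply: continuous_comp; [exact: cG|exact: cr].
by move=> Sx /=; rewrite Gg//= re.
Qed.

(** Points are joined by mixing their images and retracting. [D] consists of the pairs whose whole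
    path stays in the domain of the retraction; it is open because the interval is compact. *)
Lemma ANR_equiconnected P (p0 : P) : ANR R P ->
  exists (D : set (P * P)%type) (mu : (P * P) * I -> P),
    [/\ open D, forall p, D (p, p),
        forall z t, D z -> {for (z, t), continuous mu},
        forall p q, D (p, q) -> mu (p, q, I0) = p /\ mu (p, q, I1) = q &
        forall p t, mu (p, p, t) = p].
Proof.
move=> /(ANR_nbhd_retract p0) [d [C [e [O [r [d0 [ce oO Oe cr re]]]]]]].
pose k (z : (P * P) * I) := lipmix (e z.1.1, e z.1.2, z.2).
have ck : continuous k by exact: lipmix_pair_continuous.
exists [set z | forall t, O (k (z, t))], (r \o k); split.
- apply: (@open_tube _ _ (k @^-1` O)); first exact: compact_I.
  by apply: open_comp => // x _; exact: ck.
- by move=> p t; rewrite /k /= lipmixxx.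
- by move=> z t Dz; apply: continuous_comp; [exact: ck|exact/cr/Dz].
- by move=> p q _; rewrite /k /= lipmix0 lipmix1 !re.
- by move=> p t; rewrite /k /= lipmixxx re.
Qed.

(** Constancy on the diagonal will keep homotopies fixed where two maps agree. *)
Lemma AR_equiconnected P : AR R P ->
  exists mu : (P * P) * I -> P,
    [/\ continuous mu, forall p q, mu (p, q, I0) = p, forall p q, mu (p, q, I1) = q &
        forall p t, mu (p, p, t) = p].
Proof.
move=> /AR_nbhd_retract [d [C [e [r [d0 [ce oO Oe cr re]]]]]].
pose k (z : (P * P) * I) := lipmix (e z.1.1, e z.1.2, z.2).
have ck : continuous k by exact: lipmix_pair_continuous.
exists (r \o k); split.
- by move=> z; apply: continuous_comp; [exact: ck|exact: cr].
- by move=> p q; rewrite /k /= lipmix0 re.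
- by move=> p q; rewrite /k /= lipmix1 re.
- by move=> p t; rewrite /k /= lipmixxx re.
Qed.

End AbsoluteNeighborhoodRetracts.

(** * Extension of maps and homotopies near a closed set *)

Section NearExtension.
Variable R : realType.
Local Notation I := (set_type (@unit_interval R)).
Local Notation I0 := (@I0 R).
Local Notation I1 := (@I1 R).
Implicit Types T U V P N X M : topologicalType.

Lemma ext_near X M (e : X -> M) P (p0 : P) (f : X -> P) :
  metrizable R M -> closed_embedding e -> ANR R P -> continuous f ->
  exists (W : set M) (F : M -> P),
    [/\ open W, range e `<=` W, cont_on W F & forall x, F (e x) = f x].
Proof.
move=> mM eM aP cf.
have [[x0]|X0] := pselect (inhabited X); last first.
  by exists set0, (fun=> p0); split=> [|m [x]|m|x] //; [exact: open0|case: X0|case: X0].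
have [s sK cs] := closed_embedding_inv x0 eM.
have [_ _ ecl] := eM.
have [|W [F [oW SW cF Ff]]] := ANR_ANE p0 aP mM _ (within_comp cf cs).
  by apply: ecl; exact: closedT.
by exists W, F; split=> // x; rewrite Ff/= ?sK//; exists x.
Qed.

(** An empty space is closed in the interval, but the interval has no map to it. *)
Lemma AR_inhabited P : AR R P -> inhabited P.
Proof.
move=> [_ aP]; have [//|P0] := pselect (inhabited P).
have emb : @closed_embedding P I (fun=> I0).
  split=> [p|p|A _]; [by case: P0|by case: P0|].
  rewrite (_ : _ @` _ = set0); first exact: closed0.
  by apply/seteqP; split=> // ? [p]; case: P0.
by have [r _] := aP _ _ (metrizable_I R) emb; exists; exact: r I0.
Qed.

Lemma ext_AR X M (e : X -> M) P (f : X -> P) :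
  metrizable R M -> closed_embedding e -> AR R P -> continuous f ->
  exists2 F : M -> P, continuous F & forall x, F (e x) = f x.
Proof.
move=> mM eM aP cf.
have [[x0]|X0] := pselect (inhabited X); last first.
  have [p0] := AR_inhabited aP.
  by exists (fun=> p0) => [m|x]; [exact: cvg_cst|case: X0].
have [s sK cs] := closed_embedding_inv x0 eM.
have [_ _ ecl] := eM.
have [|F cF Ff] := AR_AE aP mM _ (within_comp cf cs).
  by apply: ecl; exact: closedT.
by exists F => // x; rewrite Ff/= ?sK//; exists x.
Qed.

Lemma AR_metrizable P : AR R P -> metrizable R P.
Proof. by case. Qed.

Lemma ANR_metrizable P : ANR R P -> metrizable R P.
Proof. by case. Qed.

Lemma closed_embedding_prodI X M (e : X -> M) : closed_embedding e ->
  closed_embedding (fun z : (X * I)%type => (e z.1, z.2)).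
Proof.
move=> [ei ec ecl]; split.
- by move=> [x t] [x' t'] /= [/ei -> ->].
- move=> z; apply: continuous_pair; last exact: continuous_snd.
  by apply: (@continuous_comp _ _ _ fst e); [exact: continuous_fst|exact: ec].
move=> A cA [m t] cl.
have [x _ xm] : range e m.
  apply: (ecl setT closedT) => B nB.
  have nB' : nbhs ((m, t) : (M * I)%type) (fst @^-1` B).
    exact: (@continuous_fst _ _ (m, t) _ nB).
  by have [_ [[z Az <-] Bz]] := cl _ nB'; exists (e z.1); split=> //; exists z.1.
exists (x, t); last by rewrite /= xm.
apply: cA => B [[B1 B2] /= [n1 n2] B12].
have nO : nbhs m (~` (e @` (~` B1^°))).
  apply: open_nbhs_nbhs; split.
    by apply: closed_openC; apply: ecl; apply: open_closedC; exact: open_interior.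
  by rewrite -xm => -[x' + /ei xx]; rewrite xx; apply; exact: n1.
have nOB : nbhs ((m, t) : (M * I)%type) ((~` (e @` (~` B1^°))) `*` B2).
  by exists (~` (e @` (~` B1^°)), B2).
have [_ [[[x' t'] Ax' <-] [/= Ox' Bt']]] := cl _ nOB.
exists (x', t'); split=> //; apply: B12; split=> //=.
by apply: interior_subset; apply: contrapT => Bx'; apply: Ox'; exists x'.
Qed.

(** The homotopy on [X] extends to some [G] near [X] times the interval. The ends of [G] agree with
    [F] and [F'] only on [X], but nearby they are joined to them by the paths of the equiconnecting
    map. *)
Lemma hom_near X M (e : X -> M) P (p0 : P) (W : set M) (F F' : M -> P) :
  metrizable R M -> closed_embedding e -> ANR R P ->
  open W -> range e `<=` W -> cont_on W F -> cont_on W F' ->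
  hom_on R setT (F \o e) (F' \o e) ->
  exists W' : set M, [/\ open W', range e `<=` W', W' `<=` W & hom_on R W' F F'].
Proof.
move=> mM eM aP oW eW cF cF' [h [ch h0 h1]].
have [D [mu [oD DD cmu mu01 muxx]]] := ANR_equiconnected p0 aP.
have chc : continuous h by move=> [x t]; exact: ch.
have [V [G [oV SV cG Gh]]] := ext_near p0 (metrizable_prod mM (metrizable_I R))
  (closed_embedding_prodI eM) aP chc.
pose W1 := W `&` [set m | forall t, V (m, t)].
have oW1 : open W1 by apply: openI => //; apply: open_tube => //; exact: compact_I.
have Ge x t : G (e x, t) = h (x, t) by rewrite -Gh.
have cGt t : cont_on W1 (fun m => G (m, t)).
  move=> m [_ Vm]; apply: (@continuous_comp _ _ _ (fun m => (m, t)) G).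
    by apply: continuous_pair; [exact: cvg_id|exact: cvg_cst].
  exact: cG.
have step (A B : M -> P) : cont_on W1 A -> cont_on W1 B ->
    (forall x, A (e x) = B (e x)) ->
    exists W2 : set M, [/\ open W2, range e `<=` W2, W2 `<=` W1 & hom_on R W2 A B].
  move=> cA cB AB; pose k m := (A m, B m).
  have ck : cont_on W1 k by move=> m Wm; apply: continuous_pair; [exact: cA|exact: cB].
  exists (W1 `&` k @^-1` D); split=> //.
  - exact: open_preimage_on.
  - move=> _ [x _ <-]; split; last by rewrite /k /= AB; exact: DD.
    by split; [apply: eW; exists x|move=> t; apply: SV; exists (x, t)].
  - exists (fun z => mu (k z.1, z.2)); split=> [m t [Wm Dm]|m [Wm /mu01[]]|m [Wm /mu01[]]]//.
    apply: (@continuous_comp _ _ _ (fun z : M * I => (k z.1, z.2)) mu); last exact: cmu.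
    apply: continuous_pair; last exact: continuous_snd.
    by apply: (@continuous_comp _ _ _ fst k); [exact: continuous_fst|exact: ck].
have WW1 : W1 `<=` W by move=> m [].
have [||x|W2 [oW2 eW2 W21 h2]] := step F (fun m => G (m, I0)).
- exact: cont_onW cF.
- exact: cGt.
- by rewrite Ge h0.
have [||x|W3 [oW3 eW3 W31 h3]] := step F' (fun m => G (m, I1)).
- exact: cont_onW cF'.
- exact: cGt.
- by rewrite Ge h1.
exists (W2 `&` W3); split.
- exact: openI.
- by move=> m em; split; [exact: eW2|exact: eW3].
- by move=> m [/W21[]].
apply: hom_on_trans (hom_onW _ h2) (hom_on_trans _ (hom_on_sym (hom_onW _ h3))).
- by move=> m [].
- exists G; split=> // m t [/W21[_ Vm] _]; exact: cG.
- by move=> m [].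
Qed.

(** The given homotopy may leave [W]; it is slowed down by a positive function of the starting point
    so that it does not. *)
Lemma Zset_push M (X : set M) (W : set M) :
  metrizable R M -> Zset R X -> open W ->
  exists k : M * I -> M,
    [/\ continuous k, forall m, k (m, I0) = m,
        forall m t, W m -> W (k (m, t)) &
        forall m (t : I), W m -> 0 < val t -> ~ X (k (m, t))].
Proof.
move=> [d dM] [_ [h [h0 hX]]] oW.
have dMI := metrizes_prod dM (metrizes_I R).
set D := prod_dist _ _ in dMI.
pose S : set (M * I)%type := ~` (h @^-1` W).
have cS : closed S.
  by apply: open_closedC; apply: open_comp => // z _; exact: cts_fun.
have [S0|/set0P/negP/negPn/eqP S0] := pselect (S !=set0); last first.
  exists h; split=> //; first exact: cts_fun.
    move=> m t _; apply: contrapT => Wm.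
    by have : S (m, t) by []; rewrite S0.
  by move=> m t _; exact: hX.
(* In the sum metric, moving from time 0 to time s costs exactly s, so half the distance to the set
   [S] of bad pairs is a safe amount of time. *)
pose tau m : R := dset D S (m, I0) / 2.
have ctau : continuous tau.
  move=> m; apply: cvgM; last exact: cvg_cst.
  apply: (@continuous_comp _ _ _ (fun m => (m, I0)) (dset D S)).
    by apply: continuous_pair; [exact: cvg_id|exact: cvg_cst].
  exact: dset_continuous.
have tau0 m : W m -> 0 < tau m.
  move=> Wm; apply: divr_gt0 => //; apply: (dset_gt0 dMI) => //.
  by rewrite /S /= h0 => /(_ Wm).
exists (fun z => h (z.1, clamp (val z.2 * tau z.1))); split.
- move=> z; apply: (@continuous_comp _ _ _
    (fun z : M * I => (z.1, clamp (val z.2 * tau z.1))) h); last exact: cts_fun.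
  apply: continuous_pair; first exact: continuous_fst.
  apply: (@continuous_comp _ _ _
    (fun z : M * I => val z.2 * tau z.1) (@clamp R)); last exact: clamp_continuous.
  apply: cvgM.
    apply: (@continuous_comp _ _ _ snd (fun t : I => val t)).
      exact: continuous_snd.
    exact: val_continuous.
  apply: (@continuous_comp _ _ _ fst tau); first exact: continuous_fst.
  exact: ctau.
- by move=> m /=; rewrite mul0r clamp_le0.
- move=> m t Wm; apply: contrapT => Wk.
  have E : dset D S (m, I0) = 2 * tau m by rewrite /tau; lra.
  have := @dset_le _ _ _ dMI S (m, I0) (m, clamp (val t * tau m)) Wk.
  have := tau0 m Wm; rewrite E /D /prod_dist /= (metr_refl dM) sub0r normrN add0r => t0.
  have a0 : 0 <= val t * tau m by rewrite mulr_ge0 ?I_ge0// ltW.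
  have a1 : val t * tau m <= tau m by rewrite ler_piMl ?I_le1// ltW.
  have : `|Num.max 0 (Num.min 1 (val t * tau m))| <= tau m.
    by rewrite ger0_norm ?le_max ?lexx// ge_max ltW//= ge_min a1 orbT.
  by rewrite /=; lra.
- move=> m t Wm t0; apply: hX => /=.
  by rewrite lt_max lt_min ltr01 mulr_gt0 ?orbT// tau0.
Qed.

(** The cover consists of the open sets any two of whose points form a pair in [D]. *)
Lemma near_homotopic P : ANR R P ->
  exists2 V : set (set P), open_cover V &
    forall X (f g : continuousType X P), near_maps V f g -> homotopic R f g.
Proof.
move=> aP; have [[p0]|P0] := pselect (inhabited P); last first.
  exists open; first by split=> // x; case: P0.
  move=> X f g _; apply/homotopicP; apply: hom_on_eq => x _; last by case: P0; exists; exact: f x.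
  exact: cts_fun.
have [D [mu [oD DD cmu mu01 muxx]]] := ANR_equiconnected p0 aP.
exists [set B | open B /\ forall x y, B x -> B y -> D (x, y)].
  split=> [B []//|x].
  have [[A B] /= [nA nB] AB] := open_nbhs_nbhs (conj oD (DD x)).
  have : nbhs x (A `&` B) by exact: filterI.
  rewrite nbhsE => -[O [oO Ox] OAB].
  exists O => //; split=> // y z /OAB[Ay _] /OAB[_ Bz]; exact: AB.
move=> X f g fg; apply/homotopicP.
have Dfg x : D (f x, g x).
  by have [B [_ BD] [Bf Bg]] := fg x; exact: BD.
exists (fun z => mu (f z.1, g z.1, z.2)); split=> [x t _|x _|x _].
- apply: (@continuous_comp _ _ _ (fun z : X * I => (f z.1, g z.1, z.2)) mu); last exact: cmu.
  apply: continuous_pair; last exact: continuous_snd.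
  apply: continuous_pair.
    by apply: (@continuous_comp _ _ _ fst f); [exact: continuous_fst|exact: cts_fun].
  by apply: (@continuous_comp _ _ _ fst g); [exact: continuous_fst|exact: cts_fun].
- by have [] := mu01 _ _ (Dfg x).
- by have [] := mu01 _ _ (Dfg x).
Qed.

End NearExtension.

(** * The path space of an ANR *)

Section PathSpace.
Variable R : realType.
Local Notation I := (set_type (@unit_interval R)).
Local Notation I0 := (@I0 R).
Local Notation I1 := (@I1 R).

(** The metric and its properties are parameters of the type, so that the metric structure on paths
    can be read off from it. *)
Record pathspace (P : topologicalType) (d : P -> P -> R) (dP : metrizes d)
    (d1 : forall p q, d p q <= 1) := PathSpace {
  pathfun :> I -> P;
  pathfun_continuous : continuous pathfun }.

Variables (P : topologicalType) (d : P -> P -> R).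
Hypothesis dP : metrizes d.
Hypothesis d1 : forall p q, d p q <= 1.
Local Notation E := (pathspace dP d1).
Implicit Types f g h : E.

Lemma pathfun_inj f g : (forall t, f t = g t) -> f = g.
Proof.
case: f g => [f cf] [g cg] /= /funext fg; subst g.
by congr PathSpace; exact: Prop_irrelevance.
Qed.

Definition pathdist f g : R := sup [set d (f t) (g t) | t in setT].

Lemma pathdist_ge f g t : d (f t) (g t) <= pathdist f g.
Proof. by apply: ub_le_sup; [exists 1 => _ [s _ <-]|exists t]. Qed.

Lemma pathdist_le f g e : (forall t, d (f t) (g t) <= e) -> pathdist f g <= e.
Proof.
move=> H; apply: ge_sup; first by exists (d (f I0) (g I0)); exists I0.
by move=> _ [t _ <-].
Qed.

Lemma pathdist_refl f : pathdist f f = 0.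
Proof.
apply/le_anti/andP; split; first by apply: pathdist_le => t; rewrite metr_refl.
exact: le_trans (metr_ge0 dP _ _) (pathdist_ge f f I0).
Qed.

Lemma pathdist_eq0 f g : pathdist f g = 0 -> f = g.
Proof.
move=> fg; apply: pathfun_inj => t; apply: (metr_eq0 dP); apply/le_anti.
by rewrite metr_ge0// andbT -fg pathdist_ge.
Qed.

Lemma pathdist_sym f g : pathdist f g = pathdist g f.
Proof.
by apply/le_anti/andP; split; apply: pathdist_le => t; rewrite metr_sym// pathdist_ge.
Qed.

Lemma pathdist_tri g f h : pathdist f h <= pathdist f g + pathdist g h.
Proof.
apply: pathdist_le => t; apply: le_trans (metr_tri dP (g t) _ _) _.
by apply: lerD; exact: pathdist_ge.
Qed.

HB.instance Definition _ := gen_eqMixin E.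
HB.instance Definition _ := gen_choiceMixin E.
HB.instance Definition _ := @isMetric.Build R E pathdist
  pathdist_refl pathdist_eq0 pathdist_sym pathdist_tri.

Lemma metrizes_pathdist : metrizes (pathdist : E -> E -> R).
Proof.
split.
- by move=> f g; split=> [/pathdist_eq0//|->]; rewrite pathdist_refl.
- exact: pathdist_sym.
- by move=> f g h; exact: pathdist_tri.
- by move=> f; rewrite -filter_from_ballE; apply/seteqP; split=> B [e e0 eB];
    exists e => //= g; move: (eB g); rewrite ballEmdist.
Qed.

Lemma curry_continuous (N : topologicalType) (F : N * I -> P) (K : N -> E) n :
  (forall t, {for (n, t), continuous F}) ->
  (\forall n' \near n, forall t, K n' t = F (n', t)) ->
  {for n, continuous K}.
Proof.
move=> cF KF; apply/(cvg_metr metrizes_pathdist) => e e0.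
have e2 : 0 < e / 2 by lra.
apply: filterS (filterI KF (near_tube_dist dP cF e2)) => n' [Kn nn].
apply: (@le_lt_trans _ _ (e / 2)); last by lra.
by apply: pathdist_le => t; rewrite Kn (nbhs_singleton KF) ltW.
Qed.

Lemma path_eval_continuous : continuous (fun z : E * I => z.1 z.2).
Proof.
move=> [f t]; apply/(cvg_metr dP) => e e0; have e2 : 0 < e / 2 by lra.
exists ([set g | pathdist f g < e / 2], [set s | d (f t) (f s) < e / 2]).
  split; first exact: (near_metr metrizes_pathdist).
  exact: (@pathfun_continuous _ _ _ _ f t _ (near_metr dP (f t) e2)).
move=> [g s] [/= h1 h2]; have := pathdist_ge f g s.
by have := metr_tri dP (f s) (f t) (g s); lra.
Qed.

Lemma path_at_continuous (t : I) : continuous (fun f : E => f t).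
Proof.
move=> f; apply: (@continuous_comp _ _ _ (fun f : E => (f, t)) (fun z => z.1 z.2)).
  exact: continuous_pairl.
exact: path_eval_continuous.
Qed.

(** By currying, extending a map into paths from [S] is extending a map into [P] from [S] times the
    interval; the points whose whole fibre lies in the domain of the extension form an open set. *)
Lemma pathspace_ANR : ANR R P -> ANR R E.
Proof.
move=> aP; apply: ANE_ANR; first by exists (@pathdist); exact: metrizes_pathdist.
move=> f0 N S g mN cS cg; pose p0 := f0 I0.
have cS' : closed (fst @^-1` S : set (N * I)%type).
  by apply: preimage_closed => // z _; exact: continuous_fst.
have cg' : {within fst @^-1` S, continuous (fun z : N * I => g z.1 z.2)}.
  apply/subspace_continuousP => -[n t] Sn; rewrite /from_subspace.
  move/subspace_continuousP: cg => /(_ n Sn); rewrite /from_subspace => cgn.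
  move=> B /= /(path_eval_continuous (x := (g n, t))) [[A1 A2] /= [n1 n2] AB].
  have n1' : nbhs n [set m | S m -> A1 (g m)] by exact: cgn n1.
  exists ([set m | S m -> A1 (g m)], A2) => //.
  by move=> [m s] /= [h1 h2] Sm; apply: (AB (g m, s)); split=> //; exact: h1.
have [V [F [oV SV cF Fg]]] :=
  ANR_ANE p0 aP (metrizable_prod mN (metrizable_I R)) cS' cg'.
pose U := [set n | forall t, V (n, t)].
have oU : open U by apply: open_tube => //; exact: compact_I.
have cFn n : U n -> continuous (fun t => F (n, t)).
  move=> Un t; apply: (@continuous_comp _ _ _ (fun t => (n, t)) F).
    exact: continuous_pairr.
  exact/cF/Un.
pose K n : E := if pselect (U n) is left H then PathSpace dP d1 (cFn n H) else f0.
have KE n t : U n -> K n t = F (n, t).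
  by move=> Un; rewrite /K; case: pselect.
exists U, K; split=> //.
- by move=> n Sn t; exact: SV.
- move=> n Un; apply: (@curry_continuous _ F); first by move=> t; exact: cF.
  by apply: filterS (open_nbhs_nbhs (conj oU Un)) => m Um t; exact: KE.
- by move=> n Sn; apply: pathfun_inj => t; rewrite KE ?Fg//= => s; exact: SV.
Qed.

End PathSpace.

Arguments proj {R X} a i.

(** * Homotopy classes and resolutions *)

Section Resolutions.
Variable R : realType.
Local Notation I := (set_type (@unit_interval R)).
Local Notation I0 := (@I0 R).
Local Notation I1 := (@I1 R).

Lemma ctscompA (T U V W : topologicalType) (h : continuousType V W)
    (g : continuousType U V) (f : continuousType T U) :
  ctscomp (ctscomp h g) f = ctscomp h (ctscomp g f).
Proof. exact/continuousEP. Qed.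

Lemma ctscomp_idl (T U : topologicalType) (f : continuousType T U) :
  ctscomp (ctsid U) f = f.
Proof. exact/continuousEP. Qed.

Lemma ctscomp_idr (T U : topologicalType) (f : continuousType T U) :
  ctscomp f (ctsid T) = f.
Proof. exact/continuousEP. Qed.

Lemma bondM (X : inv_sys R) (i j k : idx X) (hij : dle i j) (hjk : dle j k)
  (hik : dle i k) : ctscomp (bond hij) (bond hjk) = bond hik.
Proof. by apply/continuousEP => x; exact: bond_comp. Qed.

Lemma proj_bondM (X : metrSpace R) (p : anr_res X) i j (hij : dle i j) :
  ctscomp (bond hij) (proj p j) = proj p i.
Proof. by apply/continuousEP => x; exact: proj_bond. Qed.

Lemma res_approx (X : metrSpace R) (p : anr_res X) (P : topologicalType)
    (f : continuousType X P) : ANR R P ->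
  exists i (h : continuousType (p i) P), homotopic R (ctscomp h (proj p i)) f.
Proof.
move=> aP; have [V oV hV] := near_homotopic aP.
have [i [h hf]] := res_R1 p aP oV f.
by exists i, h; exact: hV.
Qed.

(** A homotopy is a map from [X] to the path space, hence approximately factors through some term of
    the resolution. The approximation is itself a homotopy, and its ends are close to the given maps
    after projection. *)
Lemma res_homotopic_near (X : metrSpace R) (p : anr_res X)
    (P : topologicalType) i j (h : continuousType (p i) P)
    (h' : continuousType (p j) P) : ANR R P ->
  homotopic R (ctscomp h (proj p i)) (ctscomp h' (proj p j)) ->
  exists k (hi : dle i k) (hj : dle j k),
    homotopic R (ctscomp h (bond hi)) (ctscomp h' (bond hj)).
Proof.
move=> aP [H [H0 H1]].
have [d dP d1] := metrizable_bounded (ANR_metrizable aP).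
have [V oV hV] := near_homotopic aP.
have [V' [oV' RV]] := res_R2 p aP oV.
pose E := pathspace dP d1.
have cH x : continuous (fun t => H (x, t)).
  move=> t; apply: (@continuous_comp _ _ _ (fun t => (x, t)) H); last exact: cts_fun.
  exact: continuous_pairr.
pose K x : E := PathSpace dP d1 (cH x).
have cK : continuous K.
  move=> x; apply: (@curry_continuous _ _ _ _ _ _ H) => [t|]; first exact: cts_fun.
  exact: filterE.
(* This cover controls only the two ends of a path, where (R2) for [P] will be applied. *)
pose U : set (set E) := [set C | exists A B, [/\ V' A, V' B &
  C = [set f : E | A (f I0) /\ B (f I1)]]].
have oU : open_cover U.
  have [oV'1 oV'2] := oV'; split.
    move=> _ [A [B [/oV'1 oA /oV'1 oB ->]]].
    apply: (@openI _ [set f : E | A (f I0)] [set f : E | B (f I1)]).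
      by apply: (open_comp (f := fun f : E => f I0)) => // f _; exact: path_at_continuous.
    by apply: (open_comp (f := fun f : E => f I1)) => // f _; exact: path_at_continuous.
  move=> f; have [A VA Af] := oV'2 (f I0); have [B VB Bf] := oV'2 (f I1).
  by exists [set f : E | A (f I0) /\ B (f I1)] => //; exists A, B.
have [l [k hk]] := res_R1 p (pathspace_ANR dP d1 aP) oU
  [the continuousType X E of mkcts cK].
have ck t : continuous (fun x : p l => k x t).
  move=> x; apply: (@continuous_comp _ _ _ k (fun f : E => f t)).
    exact: cts_fun.
  exact: path_at_continuous.
pose kt t : continuousType (p l) P := [the continuousType _ _ of mkcts (ck t)].
have [m0 [im0 jm0]] := dle_directed i j.
have [m [m0m lm]] := dle_directed m0 l.
have im := dle_trans im0 m0m; have jm := dle_trans jm0 m0m.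
have near0 : near_maps V' (ctscomp (kt I0) (bond lm) \o proj p m)
    (ctscomp h (bond im) \o proj p m).
  move=> x /=; rewrite !proj_bond; have [_ [A [B [VA VB ->]]] []] := hk x.
  by move=> [/= a b] [/= a' b']; exists A => //; rewrite H0 in a'.
have near1 : near_maps V' (ctscomp (kt I1) (bond lm) \o proj p m)
    (ctscomp h' (bond jm) \o proj p m).
  move=> x /=; rewrite !proj_bond; have [_ [A [B [VA VB ->]]] []] := hk x.
  by move=> [/= a b] [/= a' b']; exists B => //; rewrite H1 in b'.
have [n0 [mn0 hn0]] := RV _ _ _ near0.
have [n1 [mn1 hn1]] := RV _ _ _ near1.
have [o [n0o n1o]] := dle_directed n0 n1.
have lo := dle_trans (dle_trans lm mn0) n0o.
have io := dle_trans (dle_trans im mn0) n0o.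
have jo := dle_trans (dle_trans jm mn1) n1o.
exists o, io, jo.
have e0 : homotopic R (ctscomp (kt I0) (bond lo)) (ctscomp h (bond io)).
  have := homotopic_comp (homotopic_refl R (bond n0o))
    (hV _ (ctscomp (ctscomp (kt I0) (bond lm)) (bond mn0))
          (ctscomp (ctscomp h (bond im)) (bond mn0)) hn0).
  rewrite !ctscompA !(bondM mn0 n0o (dle_trans mn0 n0o)).
  by rewrite (bondM lm _ lo) (bondM im _ io).
have e1 : homotopic R (ctscomp (kt I1) (bond lo)) (ctscomp h' (bond jo)).
  have := homotopic_comp (homotopic_refl R (bond n1o))
    (hV _ (ctscomp (ctscomp (kt I1) (bond lm)) (bond mn1))
          (ctscomp (ctscomp h' (bond jm)) (bond mn1)) hn1).
  rewrite !ctscompA !(bondM mn1 n1o (dle_trans mn1 n1o)).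
  by rewrite (bondM lm _ lo) (bondM jm _ jo).
apply: homotopic_trans (homotopic_sym e0) (homotopic_trans _ e1).
(* The map [k] into paths is the homotopy between its own ends. *)
apply/homotopicP; exists (fun z => k (bond lo z.1) z.2); split=> // x t _.
apply: (@continuous_comp _ _ _ (fun z => (k (bond lo z.1), z.2)) (fun z : E * I => z.1 z.2)).
  apply: continuous_pair; last exact: continuous_snd.
  apply: (@continuous_comp _ _ _ fst (ctscomp k (bond lo))); last exact: cts_fun.
  exact: continuous_fst.
exact: path_eval_continuous.
Qed.

End Resolutions.

(** * Existence of Z-set embeddings and of resolutions *)

Section Existence.
Variable R : realType.
Implicit Types X P M N : topologicalType.

Lemma zspace_metrizable X (M : zpair R X) : metrizable R M.
Proof. exact/AR_metrizable/z_AR. Qed.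

Lemma zpair_exists X : metrizable R X -> inhabited (zpair R X).
Proof.
move=> /metrizable_bounded [d dX d1].
have CX p : range (kurf d) (kurf d p) by exists p.
exists; exact: kur_zpair (@kur_closed _ _ _ _ dX d1 CX erefl).
Qed.

(** With no condition at height 0 the function space is compact, and the image of [K] is closed by
    compactness. *)
Lemma czpair_exists (K : compactum R) : inhabited (czpair R K).
Proof.
have [d dK d1] := metrizable_bounded (cpt_metrizable K).
have CK p : [set: option K -> R] (kurf d p) by [].
exists; apply: (@CZPair _ _ (kur_zpair (@kur_closed_compact _ _ _ _ dK d1 CK (@cpt_compact _ K)))).
exact: (lipfun_compact dK erefl (@cpt_compact _ K)).
Qed.

Lemma open_ANR P (O : set P) : ANR R P -> open O -> ANR R (set_type O).
Proof.
move=> aP oO; apply: ANE_ANR; first exact/metrizable_sub/ANR_metrizable.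
move=> o0 N S g mN cS cg.
have [V [F [oV SV cF Fg]]] := ANR_ANE (val o0) aP mN cS
  (within_comp (@val_continuous P O) cg).
pose V' := V `&` F @^-1` O.
pose G n : O := if pselect (O (F n)) is left H then exist _ (F n) (mem_set H) else o0.
have GF n : O (F n) -> val (G n) = F n.
  by move=> On; rewrite /G; case: pselect.
have SO n : S n -> O (F n).
  by move=> Sn; rewrite Fg//; exact: (set_mem (valP (g n))).
have oV' : open V' by exact: open_preimage_on.
exists V', G; split=> //.
- by move=> n Sn; split; [exact: SV|exact: SO].
- move=> n [Vn On]; apply: cvg_set_val.
  apply: (@continuous_at_near _ _ F); last exact: cF.
  by apply: filterS (open_nbhs_nbhs (conj oV' (conj Vn On))) => m [_ /GF ->].
- by move=> n Sn; apply: val_inj; rewrite (GF _ (SO n Sn)) Fg.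
Qed.

(** * The resolution by open neighbourhoods *)

Section NeighbourhoodResolution.
Variables (X : metrSpace R) (M : zpair R X).

Record znbhd := ZNbhd {
  znbhd_set :> set M;
  znbhd_open : open znbhd_set;
  znbhd_sub : range (zincl M) `<=` znbhd_set }.

(** Reverse inclusion, since bonding maps go from larger to smaller indices. *)
Definition znbhd_le (U V : znbhd) : Prop := (V : set M) `<=` U.

Lemma znbhd_antisym (U V : znbhd) : znbhd_le U V -> znbhd_le V U -> U = V.
Proof.
case: U V => [U oU sU] [V oV sV] /= VU UV; have UE : U = V by apply/seteqP; split.
by subst V; congr ZNbhd; exact: Prop_irrelevance.
Qed.

Lemma znbhd_inhabited : exists U : znbhd, True.
Proof. by exists (ZNbhd openT (@subsetT _ _)). Qed.

Lemma znbhd_directed (U V : znbhd) : exists W, znbhd_le U W /\ znbhd_le V W.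
Proof.
have sW : range (zincl M) `<=` U `&` V.
  by move=> m Xm; split; apply: znbhd_sub.
by exists (ZNbhd (openI (@znbhd_open U) (@znbhd_open V)) sW); split=> m [].
Qed.

Definition znbhd_dposet : dposet :=
  DPoset (dle := znbhd_le) (fun U => @subset_refl _ U)
    (fun U V W VU WV => subset_trans WV VU)
    znbhd_antisym znbhd_inhabited znbhd_directed.

Definition znbhd_space (U : znbhd) : metrSpace R :=
  MetrSpace (@metrizable_sub R M (U : set M) (zspace_metrizable M)).

Lemma znbhd_bond_proof (U V : znbhd) (UV : znbhd_le U V) (v : set_type V) :
  val v \in (U : set M).
Proof. exact/mem_set/UV/set_mem/valP. Qed.

Lemma znbhd_bond_continuous (U V : znbhd) (UV : znbhd_le U V) :
  continuous (fun v : set_type V =>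
    exist _ (val v) (znbhd_bond_proof UV v) : set_type U).
Proof. by move=> v; apply: (@cvg_set_val _ (nbhs v) _ M U); exact: (@val_continuous M V v). Qed.

Definition znbhd_bond (U V : znbhd) (UV : znbhd_le U V) :
    continuousType (znbhd_space V) (znbhd_space U) :=
  [the continuousType (set_type V) (set_type U) of
    mkcts (@znbhd_bond_continuous U V UV)].

Lemma znbhd_bond_id (U : znbhd) (h : znbhd_le U U) x : znbhd_bond h x = x.
Proof. exact: val_inj. Qed.

Lemma znbhd_bond_comp (U V W : znbhd) (UV : znbhd_le U V) (VW : znbhd_le V W)
  (UW : znbhd_le U W) x : znbhd_bond UV (znbhd_bond VW x) = znbhd_bond UW x.
Proof. exact: val_inj. Qed.

Definition znbhd_sys : inv_sys R :=
  @InvSys R znbhd_dposet znbhd_space znbhd_bond znbhd_bond_id znbhd_bond_comp.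

Lemma znbhd_ANR (U : znbhd) : ANR R (znbhd_space U).
Proof.
apply: open_ANR (@znbhd_open U); apply: ANE_ANR; first exact: zspace_metrizable.
move=> m0 N S g mN cS cg; have [G cG Gg] := AR_AE (z_AR M) mN cS cg.
by exists setT, G; split=> // [|n _]; [exact: openT|exact: cG].
Qed.

Lemma znbhd_proj_proof (U : znbhd) (x : X) : zincl M x \in (U : set M).
Proof. by apply/mem_set/znbhd_sub; exists x. Qed.

Lemma znbhd_proj_continuous (U : znbhd) :
  continuous (fun x : X => exist _ (zincl M x) (znbhd_proj_proof U x) : set_type U).
Proof. by move=> x; apply: cvg_set_val; have [_ ce _] := z_emb M; exact: ce. Qed.

Definition znbhd_proj (U : znbhd) : continuousType X (znbhd_space U) :=
  [the continuousType X (set_type U) of mkcts (@znbhd_proj_continuous U)].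

Lemma znbhd_proj_bond (U V : znbhd) (UV : znbhd_le U V) x :
  znbhd_bond UV (znbhd_proj V x) = znbhd_proj U x.
Proof. exact: val_inj. Qed.

Lemma znbhd_R1 (P : topologicalType) (V : set (set P)) :
  ANR R P -> open_cover V -> forall f : continuousType X P,
  exists (U : znbhd) (h : continuousType (znbhd_space U) P),
    near_maps V (h \o znbhd_proj U) f.
Proof.
move=> aP [_ cV] f.
(* An empty [P] forces [X] to be empty, and then the empty set is a neighbourhood of [X]. *)
have [[p0]|P0] := pselect (inhabited P); last first.
  have X0 : forall x : X, False by move=> x; apply: P0; exists; exact: f x.
  have sX : range (zincl M) `<=` set0 by move=> ? [x]; case: (X0 x).
  pose U := ZNbhd open0 sX.
  have F (u : set_type U) : False by have := set_mem (valP u).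
  have c : continuous (fun u : set_type U => False_rect P (F u)).
    by move=> u; case: (F u).
  exists U, [the continuousType (set_type U) P of mkcts c] => x.
  by case: (X0 x).
have [W [F [oW sW cF Ff]]] := ext_near p0 (zspace_metrizable M) (z_emb M) aP (@cts_fun _ _ f).
pose U := ZNbhd oW sW.
have c : continuous (fun u : set_type U => F (val u)).
  move=> u; apply: (@continuous_comp _ _ _ (fun u : set_type U => val u : M) F).
    exact: val_continuous.
  exact/cF/set_mem/valP.
exists U, [the continuousType (set_type U) P of mkcts c] => x.
by rewrite /= /mkcts /= Ff; have [A VA Af] := cV (f x); exists A.
Qed.

(** The cover itself works as [V']: the points sent by both maps into a common member of [V] form an
    open set, which contains [X] by assumption. *)
Lemma znbhd_R2 (P : topologicalType) (V : set (set P)) :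
  ANR R P -> open_cover V ->
  exists V' : set (set P), open_cover V' /\
    forall (U : znbhd) (h h' : continuousType (znbhd_space U) P),
      near_maps V' (h \o znbhd_proj U) (h' \o znbhd_proj U) ->
      exists (U' : znbhd) (UU' : znbhd_le U U'),
        near_maps V (h \o znbhd_bond UU') (h' \o znbhd_bond UU').
Proof.
move=> aP oV; exists V; split=> // U h h' hh.
pose O : set (set_type U) := [set u | exists2 A, V A & A (h u) /\ A (h' u)].
have oO : open O.
  rewrite openE => u [A VA [hu hu']].
  have oA : open A by apply: oV.1.
  have n1 : nbhs u (h @^-1` A).
    exact: (@cts_fun _ _ h u _ (open_nbhs_nbhs (conj oA hu))).
  have n2 : nbhs u (h' @^-1` A).
    exact: (@cts_fun _ _ h' u _ (open_nbhs_nbhs (conj oA hu'))).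
  by apply: filterS (filterI n1 n2) => v [/= ? ?]; exists A.
have [W oW WO] := oO.
have sW : range (zincl M) `<=` U `&` W.
  move=> _ [x _ <-]; split; first by apply: znbhd_sub; exists x.
  have : O (znbhd_proj U x) by exact: hh.
  by rewrite -WO.
have UU' : znbhd_le U (ZNbhd (openI (@znbhd_open U) oW) sW) by move=> m [].
exists (ZNbhd (openI (@znbhd_open U) oW) sW), UU' => v.
suff : O (znbhd_bond UU' v) by [].
by rewrite -WO /=; have [_] := set_mem (valP v).
Qed.

Definition znbhd_res : anr_res X :=
  @AnrRes R X znbhd_sys znbhd_ANR znbhd_proj znbhd_proj_bond znbhd_R1 znbhd_R2.

End NeighbourhoodResolution.

Lemma anr_res_exists (X : metrSpace R) : inhabited (anr_res X).
Proof. by have [M] := zpair_exists (ms_metrizable X); exists; exact: znbhd_res M. Qed.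

End Existence.
Arguments zcompl {R X} M _.

(** * Pulling back maps into ANRs along approaching maps *)

Section Approaching.
Variable R : realType.
Local Notation I := (set_type (@unit_interval R)).
Local Notation I0 := (@I0 R).
Local Notation I1 := (@I1 R).
Implicit Types X Y P U V M N : topologicalType.

Lemma cluster_seqP M (d : M -> M -> R) (v : nat -> M) (x : M) : metrizes d ->
  cluster (v @ \oo) x <->
  forall e n, 0 < e -> exists2 m, (n <= m)%N & d x (v m) < e.
Proof.
move=> dM; split=> [cl e n e0|H A B [n _ nA] /(nbhs_metr dM) [e e0 eB]].
  have vn : (v @ \oo) (v @` [set m | (n <= m)%N]).
    by exists n => // m nm; exists m.
  have [_ [[m nm <-] xm]] := cl _ _ vn (near_metr dM x e0).
  by exists m.
have [m nm xm] := H e n e0.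
by exists (v m); split; [exact: nA|exact: eB].
Qed.

(** From sequences to neighbourhoods: failure on every ball about [x] would give a sequence
    converging to [x] whose images avoid [O] and so cannot cluster in [B]. *)
Lemma approaching_near U M V N (a : U -> M) (A : set M) (b : V -> N)
    (B : set N) (f : U -> V) (O : set N) x :
  metrizable R M -> approaching a A b B f -> open O -> B `<=` O -> A x ->
  \forall m \near x, forall u, a u = m -> O (b (f u)).
Proof.
move=> [d dM] af oO BO Ax; apply: contrapT => H.
have step n : exists u, d x (a u) < n.+1%:R^-1 /\ ~ O (b (f u)).
  apply: contrapT => Hn; apply: H; apply/(nbhs_metr dM).
  exists n.+1%:R^-1; first by rewrite invr_gt0.
  move=> m xm u um; apply: contrapT => Ou; apply: Hn; exists u.
  by rewrite um.
have [u uP] := choice step.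
have [|y By cl] := af u.
  exists x => //; apply/(cluster_seqP _ _ dM) => e n e0.
  have [k ke] : exists k : nat, k.+1%:R^-1 < e.
    exists (Num.truncn e^-1); rewrite invf_plt ?posrE//; exact: truncnS_gt.
  exists (maxn n k); first exact: leq_maxl.
  have [uk _] := uP (maxn n k); apply: lt_trans uk _; apply: le_lt_trans ke.
  by rewrite lef_pV2 ?posrE// ler_nat ltnS leq_maxr.
have [_ [[n _ <-] On]] : [set b (f (u n)) | n in setT] `&` O !=set0.
  apply: cl; first by exists 0%N => // n _; exists n.
  exact: (open_nbhs_nbhs (conj oO (BO y By))).
by have [_] := uP n; apply.
Qed.

Definition zend X (M : zpair R X) (W : set M) : Prop :=
  open W /\ range (zincl M) `<=` W.

Lemma zendI X (M : zpair R X) (W W' : set M) :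
  zend W -> zend W' -> zend (W `&` W').
Proof.
move=> [oW sW] [oW' sW']; split; first exact: openI.
by move=> m Xm; split; [exact: sW|exact: sW'].
Qed.

Lemma zcompl_not X (M : zpair R X) (u : zcompl M) : ~ range (zincl M) (val u).
Proof. exact: (set_mem (valP u)). Qed.

Lemma appr_near X Y (M : zpair R X) (N : zpair R Y) (f : appr M N)
    (O : set N) : zend O ->
  exists2 W : set M, zend W & forall u, W (val u) -> O (val (f u)).
Proof.
move=> [oO sO]; pose S m := forall u : zcompl M, val u = m -> O (val (f u)).
exists (S^°); last by move=> u /interior_subset; apply.
split; first exact: open_interior.
move=> m Xm; apply: (approaching_near _ (@appr_approaching _ _ _ _ _ f)) => //.
exact: zspace_metrizable.
Qed.

(** The neighbourhood can be taken independent of time by compactness of the interval. *)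
Lemma appr_homotopy_near X Y (M : zpair R X) (N : zpair R Y)
    (H : zcompl M * I -> zcompl N) (O : set N) :
  approaching (fun p : (zcompl M * I)%type => (val p.1 : M, p.2))
    (range (zincl M) `*` [set: I])
    (fun v : zcompl N => val v : N) (range (zincl N)) H ->
  zend O ->
  exists2 W : set M, zend W & forall u t, W (val u) -> O (val (H (u, t))).
Proof.
move=> aH [oO sO].
pose S m := forall t (u : zcompl M), val u = m -> O (val (H (u, t))).
exists (S^°); last by move=> u t /interior_subset/(_ t u); apply.
split; first exact: open_interior.
move=> m Xm; rewrite /interior /=.
pose Q := [set z : (M * I)%type |
  forall u : zcompl M, val u = z.1 -> O (val (H (u, z.2)))].
apply: (@near_tube _ _ Q); first exact: compact_I.
move=> t; have mMI := metrizable_prod (zspace_metrizable M) (metrizable_I R).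
have := approaching_near (x := (m, t)) mMI aH oO sO (conj Xm Logic.I).
by apply: filterS => -[m' t'] h u um; apply: (h (u, t')); rewrite /= um.
Qed.

Lemma zcompl_inhabited X (M : zpair R X) : inhabited (zcompl M).
Proof.
have [m0] := AR_inhabited (z_AR M).
have [_ [h [_ hX]]] := z_Zset M.
have hm : zcompl M (h (m0, I1)) by apply: hX; exact: ltr01.
by exists; exact: (exist _ (h (m0, I1)) (mem_set hm)).
Qed.

Lemma open_zcompl X (M : zpair R X) : open (zcompl M).
Proof. by apply: closed_openC; have [] := z_Zset M. Qed.

(** A total left inverse of the inclusion, with junk values on [X], lets maps on the complement be
    evaluated at points of [M]. *)
Lemma zcompl_total X (M : zpair R X) :
  exists2 c : M -> zcompl M, cont_on (zcompl M) c & forall u : zcompl M, c (val u) = u.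
Proof.
have [u0] := zcompl_inhabited M.
by apply: (total_extension (r := idfun) u0) => [|u]; [exact: open_zcompl|].
Qed.

(* [h] is the pull-back of the homotopy class of [g] along the fine shape
   morphism of [f] *)
Definition traces X Y (M : zpair R X) (N : zpair R Y)
    (f : zcompl M -> zcompl N) P (g : Y -> P) (h : X -> P) : Prop :=
  inhabited P -> exists (W : set M) (V : set N) (F : M -> P) (G : N -> P),
    [/\ zend W /\ zend V, cont_on W F /\ cont_on V G,
        (forall x, F (zincl M x) = h x) /\ (forall y, G (zincl N y) = g y),
        forall u, W (val u) -> V (val (f u)) &
        hom_on R (fun u : zcompl M => W (val u))
          (fun u => F (val u)) (fun u => G (val (f u)))].

Lemma zincl_continuous X (M : zpair R X) : continuous (zincl M).
Proof. by have [] := z_emb M. Qed.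

Lemma zext_near X (M : zpair R X) P (p0 : P) (f : X -> P) :
  ANR R P -> continuous f ->
  exists (W : set M) (F : M -> P),
    [/\ zend W, cont_on W F & forall x, F (zincl M x) = f x].
Proof.
move=> aP cf.
have [W [F [oW sW cF Ff]]] := ext_near p0 (zspace_metrizable M) (z_emb M) aP cf.
by exists W, F.
Qed.

Lemma zhom_near X (M : zpair R X) P (p0 : P) (W : set M) (F F' : M -> P) :
  ANR R P -> zend W -> cont_on W F -> cont_on W F' ->
  hom_on R setT (F \o zincl M) (F' \o zincl M) ->
  exists W' : set M, [/\ zend W', W' `<=` W & hom_on R W' F F'].
Proof.
move=> aP [oW sW] cF cF' FF.
have [W' [oW' sW' WW' h]] :=
  hom_near p0 (zspace_metrizable M) (z_emb M) aP oW sW cF cF' FF.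
by exists W'.
Qed.

Lemma zpush X (M : zpair R X) (W : set M) : zend W ->
  exists k : M * I -> M, [/\ continuous k, forall m, k (m, I0) = m,
    forall m t, W m -> W (k (m, t)) &
    forall m (t : I), W m -> 0 < val t -> zcompl M (k (m, t))].
Proof.
by move=> [oW _]; exact: (Zset_push (zspace_metrizable M) (z_Zset M) oW).
Qed.

Lemma val_cont_on X (M : zpair R X) P (W : set M) (F : M -> P) :
  cont_on W F -> cont_on (fun u : zcompl M => W (val u)) (fun u => F (val u)).
Proof.
move=> cF u Wu; apply: (@continuous_comp _ _ _ (fun u : zcompl M => val u : M) F).
  exact: val_continuous.
exact: cF.
Qed.

(** The pulled-back map is [G] after [f], evaluated where [X] lands when it is pushed into [W] minus
    [X]; the push run backwards is the required homotopy. *)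
Lemma traces_exists X Y (M : zpair R X) (N : zpair R Y) (f : appr M N) P
    (g : continuousType Y P) : ANR R P ->
  exists h : continuousType X P, traces f g h.
Proof.
(* If [P] is empty, so is [Y], and the empty set is a neighbourhood of [Y]. Some neighbourhood of
   [X] then has no point off [X]; as [X] can be pushed into such points, [X] is empty. *)
move=> aP; have [[p0]|P0] := pselect (inhabited P); last first.
  have Y0 (y : Y) : False by apply: P0; exists; exact: g y.
  have zN : zend (@set0 N).
    by split; [exact: open0|move=> ? [y]; case: (Y0 y)].
  have [W zW WP] := appr_near f zN.
  have [k [ck k0 kW kX]] := zpush zW.
  have X0 (x : X) : False.
    have Wx : W (zincl M x) by apply: zW.2; exists x.
    have kx : zcompl M (k (zincl M x, I1)) by apply: kX => //; exact: ltr01.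
    pose u : zcompl M := exist _ (k (zincl M x, I1)) (mem_set kx).
    by have := WP u; apply; exact: kW.
  have c : continuous (fun x : X => False_rect P (X0 x)) by move=> x; case: (X0 x).
  by exists [the continuousType X P of mkcts c].
have [V [G [zV cG Gg]]] := zext_near N p0 aP (@cts_fun _ _ g).
have [W zW WP] := appr_near f zV.
have [k [ck k0 kW kX]] := zpush zW.
have [c cc ci] := zcompl_total M.
pose L m := G (val (f (c m))).
have cL : cont_on (zcompl M `&` W) L.
  move=> m [Xm Wm]; pose u : zcompl M := exist _ m (mem_set Xm).
  apply: (@continuous_comp _ _ _ c (fun u => G (val (f u)))); first exact: cc.
  apply: (@continuous_comp _ _ _ f (fun v : zcompl N => G (val v))).
    exact: cts_fun.
  apply: (val_cont_on cG); apply: WP.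
  by rewrite -[m]/(val u) ci.
pose F m := L (k (m, I1)).
have ck1 : continuous (fun m => k (m, I1)).
  move=> m; apply: (@continuous_comp _ _ _ (fun m => (m, I1)) k); last exact: ck.
  exact: continuous_pairl.
have cF : cont_on W F.
  move=> m Wm; apply: (@continuous_comp _ _ _ (fun m => k (m, I1)) L).
    exact: ck1.
  by apply: cL; split; [apply: kX => //; exact: ltr01|exact: kW].
have ch : continuous (F \o zincl M).
  move=> x; apply: continuous_comp; first exact: zincl_continuous.
  by apply: cF; apply: zW.2; exists x.
exists [the continuousType X P of mkcts ch] => _; exists W, V, F, G.
split=> //; exists (fun z => L (k (val z.1, irev z.2))); split=> [u t Wu|u Wu|u Wu] /=.
- apply: (@continuous_comp _ _ _ (fun z : zcompl M * I => k (val z.1, irev z.2)) L).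
    apply: (@continuous_comp _ _ _
    (fun z : zcompl M * I => (val z.1 : M, irev z.2)) k); last exact: ck.
    apply: continuous_pair.
      apply: (@continuous_comp _ _ _ fst (fun u : zcompl M => val u : M)).
        exact: continuous_fst.
      exact: val_continuous.
    apply: (@continuous_comp _ _ _ snd (@irev R)); first exact: continuous_snd.
    exact: irev_continuous.
  apply: cL; split; last exact: kW.
  have [t0|t0] := ltP 0 (val (irev t)); first exact: kX.
  have -> : irev t = I0 by apply/val_inj/le_anti; rewrite t0 I_ge0.
  by rewrite k0; exact: zcompl_not.
- by rewrite irev0.
- by rewrite irev1 k0 /L ci.
Qed.

(** Pushing [X] off itself inside [W] changes neither map up to homotopy, and after the push the two
    are compared off [X]. *)
Lemma hom_on_zincl X (M : zpair R X) P (W : set M) (F F' : M -> P) :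
  zend W -> cont_on W F -> cont_on W F' ->
  hom_on R (fun u : zcompl M => W (val u)) (fun u => F (val u)) (fun u => F' (val u)) ->
  hom_on R setT (F \o zincl M) (F' \o zincl M).
Proof.
move=> zW cF cF' FF; have [k [ck k0 kW kX]] := zpush zW.
have We x : W (zincl M x) by apply: zW.2; exists x.
have push (G : M -> P) : cont_on W G ->
    hom_on R setT (G \o zincl M) (fun x => G (k (zincl M x, I1))).
  move=> cG; exists (fun z => G (k (zincl M z.1, z.2))); split=> [x t _|x _|x _] //=.
    apply: (@continuous_comp _ _ _ (fun z : X * I => k (zincl M z.1, z.2)) G).
      apply: (@continuous_comp _ _ _ (fun z : X * I => (zincl M z.1, z.2)) k); last exact: ck.
      apply: continuous_pair; last exact: continuous_snd.
      apply: (@continuous_comp _ _ _ fst (zincl M)); first exact: continuous_fst.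
      exact: zincl_continuous.
    exact/cG/kW.
  by rewrite k0.
have [c cc ci] := zcompl_total M.
have kX1 x : zcompl M (k (zincl M x, I1)) by apply: kX => //; exact: ltr01.
have valc m : zcompl M m -> val (c m) = m.
  by move=> Xm; rewrite -[m]/(val (exist _ m (mem_set Xm) : zcompl M)) ci.
apply: hom_on_trans (push _ cF) (hom_on_trans _ (hom_on_sym (push _ cF'))).
have cu : cont_on setT (fun x => c (k (zincl M x, I1))).
  move=> x _; apply: (@continuous_comp _ _ _ (fun x => k (zincl M x, I1)) c); last exact: cc.
  apply: (@continuous_comp _ _ _ (fun x => (zincl M x, I1)) k); last exact: ck.
  apply: (@continuous_comp _ _ _ (zincl M) (fun m => (m, I1))).
    exact: zincl_continuous.
  exact: continuous_pairl.
have := hom_on_comp (W := setT) cu _ FF.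
have -> : (fun u : zcompl M => F (val u)) \o (fun x => c (k (zincl M x, I1))) =
  (fun x => F (k (zincl M x, I1))) by apply/funext => x /=; rewrite valc.
have -> : (fun u : zcompl M => F' (val u)) \o (fun x => c (k (zincl M x, I1))) =
  (fun x => F' (k (zincl M x, I1))) by apply/funext => x /=; rewrite valc.
by apply=> x _; rewrite valc//; exact: kW.
Qed.

(** Off [X] the extensions are joined through [G] after [f], [G] after [f'] and [G'] after [f']; the
    middle links use the approaching homotopy and [zhom_near] at [Y]. *)
Lemma traces_unique X Y (M : zpair R X) (N : zpair R Y) (f f' : appr M N) P
    (g g' : continuousType Y P) (h h' : continuousType X P) : ANR R P ->
  appr_homotopic f f' -> homotopic R g g' -> traces f g h -> traces f' g' h' ->
  homotopic R h h'.
Proof.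
move=> aP [H [aH H0 H1]] /homotopicP gg tr tr'; apply/homotopicP.
have [[p0]|P0] := pselect (inhabited P); last first.
  by apply: hom_on_eq => x _; [exact: cts_fun|case: P0; exists; exact: h x].
have [W [V [F [G [[zW zV] [cF cG] [Fh Gg] WV FG]]]]] := tr (inhabits p0).
have [W' [V' [F' [G' [[zW' zV'] [cF' cG'] [Fh' Gg'] WV' FG']]]]] := tr' (inhabits p0).
have IV : V `&` V' `<=` V by move=> ? [].
have IV' : V `&` V' `<=` V' by move=> ? [].
have [|V2 [zV2 VV2 GG]] := zhom_near p0 aP (zendI zV zV') (cont_onW IV cG) (cont_onW IV' cG').
  by apply: hom_on_ext gg => y _ /=; rewrite ?Gg ?Gg'.
have [W2 zW2 WH] := appr_homotopy_near aH zV2.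
have zW3 := zendI (zendI zW zW') zW2.
set W3 := _ `&` W2 in zW3.
have W3W : W3 `<=` W by move=> ? [[]].
have W3W' : W3 `<=` W' by move=> ? [[]].
have -> : (h : X -> P) = F \o zincl M by apply/funext => x; rewrite /= Fh.
have -> : (h' : X -> P) = F' \o zincl M by apply/funext => x; rewrite /= Fh'.
apply: (hom_on_zincl zW3); [exact: cont_onW cF|exact: cont_onW cF'|].
apply: hom_on_trans (hom_onW _ FG) _; first by move=> u /W3W.
apply: (@hom_on_trans _ _ _ _ (fun u => G (val (f' u)))).
  exists (fun z => G (val (H z))); split=> [u t [_ W2u]|u _|u _]; rewrite ?H0 ?H1//.
  apply: (@continuous_comp _ _ _ H (fun v : zcompl N => G (val v))); first exact: cts_fun.
  by apply: (val_cont_on cG); exact/IV/VV2/WH.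
apply: hom_on_trans _ (hom_on_sym (hom_onW _ FG')); last by move=> u /W3W'.
apply: (@hom_on_comp R _ _ _ (fun u : zcompl M => W3 (val u)) V2 (fun u => val (f' u)) G G') => //.
  move=> u _; apply: (@continuous_comp _ _ _ f' (fun v : zcompl N => val v : N)).
    exact: cts_fun.
  exact: val_continuous.
by move=> u [_ W2u]; rewrite -H1; exact: WH.
Qed.

(** The witnesses extend [h] and [g] exactly, so new extensions are taken and compared with the old
    ones near [X] and [Y]. *)
Lemma traces_homotopic X Y (M : zpair R X) (N : zpair R Y) (f : appr M N) P
    (g g' : continuousType Y P) (h h' : continuousType X P) : ANR R P ->
  homotopic R g g' -> homotopic R h h' -> traces f g h -> traces f g' h'.
Proof.
move=> aP /homotopicP gg /homotopicP hh tr [p0].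
have [W [V [F [G [[zW zV] [cF cG] [Fh Gg] WV FG]]]]] := tr (inhabits p0).
have [V' [G' [zV' cG' Gg']]] := zext_near N p0 aP (@cts_fun _ _ g').
have [W' [F' [zW' cF' Fh']]] := zext_near M p0 aP (@cts_fun _ _ h').
have IV : V `&` V' `<=` V by move=> ? [].
have IV' : V `&` V' `<=` V' by move=> ? [].
have [|V2 [zV2 VV2 GG]] := zhom_near p0 aP (zendI zV zV') (cont_onW IV cG) (cont_onW IV' cG').
  by apply: hom_on_ext gg => y _ /=; rewrite ?Gg ?Gg'.
have IW : W `&` W' `<=` W by move=> ? [].
have IW' : W `&` W' `<=` W' by move=> ? [].
have [|W2 [zW2 WW2 FF]] := zhom_near p0 aP (zendI zW zW') (cont_onW IW cF) (cont_onW IW' cF').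
  by apply: hom_on_ext hh => x _ /=; rewrite ?Fh ?Fh'.
have [W3 zW3 WV3] := appr_near f zV2.
have W23 : W2 `&` W3 `<=` W by move=> ? [/WW2[]].
exists (W2 `&` W3), V', F', G'; split=> //.
- by split=> //; exact: zendI.
- by split=> //; apply: cont_onW cF' => ? [/WW2[]].
- by move=> u [_ /WV3/VV2[]].
apply: (@hom_on_trans R _ _ _ (fun u : zcompl M => F (val u))).
  apply: hom_on_sym; apply: (@hom_on_comp _ _ _ _ _ W2 (fun u : zcompl M => val u : M) F F') => //.
    by move=> u _; exact: val_continuous.
  by move=> u [].
apply: hom_on_trans (hom_onW _ FG) _; first by move=> u /W23.
apply: (@hom_on_comp R _ _ _ _ V2 (fun u => val (f u)) G G') => //.
  move=> u _; apply: (@continuous_comp _ _ _ f (fun v : zcompl N => val v : N)).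
    exact: cts_fun.
  exact: val_continuous.
by move=> u [_ /WV3].
Qed.

Lemma traces_comp X Y Z (M : zpair R X) (N : zpair R Y) (L : zpair R Z)
    (f : appr M N) (f' : appr N L) P (k : continuousType Z P)
    (g : continuousType Y P) (h : continuousType X P) : ANR R P ->
  traces f g h -> traces f' k g -> traces (appr_comp f' f) k h.
Proof.
move=> aP tr tr' [p0].
have [W [V [F [G [[zW zV] [cF cG] [Fh Gg] WV FG]]]]] := tr (inhabits p0).
have [V' [O [G' [K [[zV' zO] [cG' cK] [Gg' Kk] VO GK]]]]] := tr' (inhabits p0).
have IV : V `&` V' `<=` V by move=> ? [].
have IV' : V `&` V' `<=` V' by move=> ? [].
have [|V2 [zV2 VV2 GG]] := zhom_near p0 aP (zendI zV zV') (cont_onW IV cG) (cont_onW IV' cG').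
  apply: (@hom_on_ext _ _ _ _ g g) => [y _|y _|]; rewrite /= ?Gg ?Gg'//.
  by apply: hom_on_eq => // y _; exact: cts_fun.
have [W3 zW3 WV3] := appr_near f zV2.
exists (W `&` W3), O, F, K; split=> //.
- by split=> //; exact: zendI.
- by split=> //; apply: cont_onW cF => ? [].
- by move=> u [_ /WV3/VV2[_ /VO]].
apply: hom_on_trans (hom_onW _ FG) _; first by move=> u [].
apply: (@hom_on_trans _ _ _ _ (fun u => G' (val (f u)))).
  apply: (@hom_on_comp R _ _ _ _ V2 (fun u => val (f u)) G G') => //.
    move=> u _; apply: (@continuous_comp _ _ _ f (fun v : zcompl N => val v : N)).
      exact: cts_fun.
    exact: val_continuous.
  by move=> u [_ /WV3].
apply: (@hom_on_comp R _ _ _ _ _ f _ _ _ _ GK); first by move=> u _; exact: cts_fun.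
by move=> u [_ /WV3/VV2[]].
Qed.

Lemma traces_combines X Y (M : zpair R X) (N : zpair R Y)
    (phi : continuousType X Y) (f : appr M N) P (g : continuousType Y P) :
  ANR R P -> combines phi f -> traces f g (ctscomp g phi).
Proof.
move=> aP [F0 [F0i F0c]] [p0].
have [V [G [[oV sV] cG Gg]]] := zext_near N p0 aP (@cts_fun _ _ g).
have cF : cont_on (F0 @^-1` V) (G \o F0).
  by move=> m Vm; apply: continuous_comp; [exact: cts_fun|exact: cG].
have zW : zend (F0 @^-1` V).
  split; first by apply: open_comp => // x _; exact: cts_fun.
  by move=> _ [x _ <-]; rewrite /= F0i; apply: sV; exists (phi x).
exists (F0 @^-1` V), V, (G \o F0), G; split=> //.
- by split=> // x; rewrite /= F0i Gg.
- by move=> u; rewrite /= F0c.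
- by apply: hom_on_eq => [|u _ /=]; [exact: val_cont_on|rewrite F0c].
Qed.

Lemma traces_post X Y (M : zpair R X) (N : zpair R Y) (f : appr M N) P P'
    (g : continuousType Y P) (h : continuousType X P)
    (a : continuousType P P') :
  traces f g h -> traces f (ctscomp a g) (ctscomp a h).
Proof.
(* An empty [P] with inhabited [P'] is possible, but then [X] and [Y] are empty. *)
move=> tr [p0']; have [[p0]|P0] := pselect (inhabited P); last first.
  have Y0 (y : Y) : False by apply: P0; exists; exact: g y.
  have X0 (x : X) : False by apply: P0; exists; exact: h x.
  exists set0, set0, (fun=> p0'), (fun=> p0'); split=> //.
  - split; split; [exact: open0|by move=> ? [x]; case: (X0 x)|exact: open0|].
    by move=> ? [y]; case: (Y0 y).
  - by split=> ? [].
  - by exists (fun=> p0'); split.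
have [W [V [F [G [[zW zV] [cF cG] [Fh Gg] WV FG]]]]] := tr (inhabits p0).
exists W, V, (a \o F), (a \o G); split=> //.
- by split=> u Wu; (apply: continuous_comp; last exact: cts_fun); [exact: cF|exact: cG].
- by split=> [x|y] /=; rewrite ?Fh ?Gg.
- by apply: (comp_hom_on (k := a) _ FG); exact: cts_fun.
Qed.

End Approaching.

(** * The calculus of approaching maps up to approaching homotopy *)

Section ApproachingHomotopies.
Variable R : realType.
Local Notation I := (set_type (@unit_interval R)).
Local Notation I0 := (@I0 R).
Local Notation I1 := (@I1 R).
Implicit Types X Y Z U V M N T L : topologicalType.

Lemma approaching_comp U M V N T L (a : U -> M) (A : set M) (b : V -> N)
    (B : set N) (c : T -> L) (C : set L) (f : U -> V) (g : V -> T) :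
  approaching a A b B f -> approaching b B c C g ->
  approaching a A c C (g \o f).
Proof. by move=> af ag u /af; exact: (ag (f \o u)). Qed.

Lemma approaching_ext U M V N (a : U -> M) (A : set M) (b : V -> N)
    (B : set N) (f : U -> V) (F : M -> N) :
  (forall x, A x -> {for x, continuous F}) -> (forall x, A x -> B (F x)) ->
  (forall u, F (a u) = b (f u)) -> approaching a A b B f.
Proof.
move=> cF FB Ff u [x Ax cl]; exists (F x); first exact: FB.
move=> S O nS nO.
have nS' : ((a \o u) @ \oo) (F @^-1` S).
  by have : \forall n \near \oo, S (b (f (u n))) by []; apply: filterS => n; rewrite /= Ff.
by have [m [Sm Om]] := cl _ _ nS' (cF x Ax _ nO); exists (F m).
Qed.

Lemma cluster_subseq N (v : nat -> N) (s : nat -> nat) (y : N) :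
  (forall n, (n <= s n)%N) -> cluster ((v \o s) @ \oo) y -> cluster (v @ \oo) y.
Proof.
move=> sn cl A B [n _ nA] nB; apply: cl => //.
by exists n => // m nm; apply: nA; exact: leq_trans nm (sn m).
Qed.

Lemma inv_succ_lt (e : R) : 0 < e -> exists k : nat, k.+1%:R^-1 < e.
Proof.
move=> e0; exists (Num.truncn e^-1); rewrite invf_plt ?posrE//.
exact: truncnS_gt.
Qed.

Lemma subseq_cluster M (d : M -> M -> R) (v : nat -> M) (Q : set nat) x :
  metrizes d ->
  (forall e n, 0 < e -> exists m, [/\ (n <= m)%N, d x (v m) < e & Q m]) ->
  exists s : nat -> nat, [/\ forall n, (n <= s n)%N,
    forall n, d x (v (s n)) < n.+1%:R^-1 & forall n, Q (s n)].
Proof.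
move=> dM H.
have /choice [s sP] : forall n, exists m,
    [/\ (n <= m)%N, d x (v m) < n.+1%:R^-1 & Q m].
  by move=> n; apply: H; rewrite invr_gt0.
by exists s; split=> n; have [] := sP n.
Qed.

Lemma subseq_cluster_cluster M (d : M -> M -> R) (w : nat -> M) x :
  metrizes d -> (forall n, d x (w n) < n.+1%:R^-1) -> cluster (w @ \oo) x.
Proof.
move=> dM H; apply/(cluster_seqP _ _ dM) => e n e0.
have [k ke] := inv_succ_lt e0; exists (maxn n k); first exact: leq_maxl.
apply: lt_trans (H _) _; apply: le_lt_trans ke.
by rewrite lef_pV2 ?posrE// ler_nat ltnS leq_maxr.
Qed.

(** A sequence clustering at [x] has a subsequence that converges to [x] within a single branch. *)
Lemma approaching_if U M V N (a : U -> M) (A : set M) (b : V -> N)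
    (B : set N) (c : U -> bool) (f g : U -> V) :
  metrizable R M ->
  approaching a A b B f -> approaching a A b B g ->
  approaching a A b B (fun u => if c u then f u else g u).
Proof.
move=> [d dM] af ag u [x Ax cl].
have step (Q : set nat) (k : U -> V) : approaching a A b B k ->
    (forall n, Q n -> k (u n) = if c (u n) then f (u n) else g (u n)) ->
    (forall e n, 0 < e -> exists m, [/\ (n <= m)%N, d x (a (u m)) < e & Q m]) ->
    exists2 y, B y & cluster ((b \o (fun u => if c u then f u else g u) \o u) @ \oo) y.
  move=> ak kQ /(subseq_cluster (v := a \o u) dM) [s [sn sx Qs]].
  have [|y By cy] := ak (u \o s).
    by exists x => //; exact: (subseq_cluster_cluster dM sx).
  exists y => //; apply: (@cluster_subseq _ _ s) => //.
  rewrite (_ : _ \o s = b \o k \o (u \o s))//.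
  by apply/funext => n /=; rewrite kQ.
have [H|H] := pselect (forall e n, 0 < e ->
    exists m, [/\ (n <= m)%N, d x (a (u m)) < e & c (u m)]).
  by apply: (step [set n | c (u n)] f) => // n /= ->.
have [e0 [n0 [e00 Hn]]] : exists e n, 0 < e /\
    forall m, (n <= m)%N -> d x (a (u m)) < e -> ~~ c (u m).
  apply: contrapT => Hn; apply: H => e n e0.
  apply: contrapT => Hm; apply: Hn; exists e, n; split=> // m nm xm.
  by apply/negP => cm; apply: Hm; exists m.
apply: (step [set n | ~~ c (u n)] g) => // [n /= /negbTE ->//|e n ep].
move/(cluster_seqP _ _ dM): cl => /(_ (Num.min e e0) (maxn n n0)) [|m nm].
  by rewrite lt_min ep.
rewrite lt_min => /andP[xe xe0]; exists m; split=> //.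
  exact: leq_trans (leq_maxl _ _) nm.
by apply: Hn xe0; exact: leq_trans (leq_maxr _ _) nm.
Qed.

(** First a subsequence whose images converge, then a cluster point of its times by compactness of
    the interval. *)
Lemma approaching_prodI U M V N (a : U -> M) (A : set M) (b : V -> N)
    (B : set N) (f : U -> V) : metrizable R N ->
  approaching a A b B f ->
  approaching (fun p : (U * I)%type => (a p.1, p.2)) (A `*` [set: I])
    (fun p : (V * I)%type => (b p.1, p.2)) (B `*` [set: I])
    (fun p : (U * I)%type => (f p.1, p.2)).
Proof.
move=> [d dN] af w [[x t] [/= Ax _] cl].
have [|y By cy] := af (fst \o w).
  exists x => // S O nS nO.
  have nO' : nbhs ((x, t) : (M * I)%type) (fst @^-1` O).
    exact: (@continuous_fst _ _ (x, t) _ nO).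
  have [[m s] [/= Sm Om]] := cl (fst @^-1` S) (fst @^-1` O) nS nO'.
  by exists m.
have [|s [sn sy _]] := @subseq_cluster _ _ (b \o f \o (fst \o w)) setT y dN.
  move/(cluster_seqP _ _ dN): cy => cy e n e0.
  by have [m nm ym] := cy e n e0; exists m.
have [t' [_ ct']] := @compact_I R ((snd \o w \o s) @ \oo) _ filterT.
exists (y, t') => //.
apply/(cluster_seqP _ _ (metrizes_prod dN (metrizes_I R))) => e n e0.
have e2 : 0 < e / 2 by lra.
have [k ke] := inv_succ_lt e2.
move/(cluster_seqP _ _ (metrizes_I R)): ct' => /(_ _ (maxn n k) e2) [m nm tm].
exists (s m).
  exact: leq_trans (leq_trans (leq_maxl _ _) nm) (sn m).
have : d y (b (f (w (s m)).1)) < e / 2.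
  apply: lt_trans (sy m) _; apply: le_lt_trans ke.
  rewrite lef_pV2 ?posrE// ler_nat ltnS.
  exact: leq_trans (leq_maxr _ _) nm.
by move: tm; rewrite /prod_dist /=; lra.
Qed.

Section Equivalence.
Variables (X Y : topologicalType) (M : zpair R X) (N : zpair R Y).
Implicit Types f g h : appr M N.

Lemma appr_homotopic_ext f f' g g' : (forall u, f u = f' u) ->
  (forall u, g u = g' u) -> appr_homotopic f g -> appr_homotopic f' g'.
Proof.
by move=> ff gg [H [aH H0 H1]]; exists H; split=> // u; rewrite ?H0 ?H1.
Qed.

Lemma appr_homotopic_refl f : appr_homotopic f f.
Proof.
have c : continuous (fun z : zcompl M * I => f z.1).
  move=> z; apply: (@continuous_comp _ _ _ fst f); first exact: continuous_fst.
  exact: cts_fun.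
exists [the continuousType (zcompl M * I)%type (zcompl N) of mkcts c]; split=> //.
apply: (@approaching_comp _ _ _ _ _ _ _ _ _ _ _ _ fst f); last exact: appr_approaching.
apply: (@approaching_ext _ _ _ _ _ _ _ _ _ fst) => // [x _|x []//].
exact: continuous_fst.
Qed.

Lemma appr_homotopic_sym f g : appr_homotopic f g -> appr_homotopic g f.
Proof.
move=> [H [aH H0 H1]].
have ci T : continuous (fun z : T * I => (z.1, irev z.2)).
  move=> z; apply: continuous_pair; first exact: continuous_fst.
  apply: (@continuous_comp _ _ _ snd (@irev R)); first exact: continuous_snd.
  exact: irev_continuous.
have c : continuous (fun z : zcompl M * I => H (z.1, irev z.2)).
  move=> z; apply: (@continuous_comp _ _ _ (fun z : zcompl M * I => (z.1, irev z.2)) H).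
    exact: ci.
  exact: cts_fun.
exists [the continuousType (zcompl M * I)%type (zcompl N) of mkcts c].
split=> [|u|u]; rewrite /= /mkcts /= ?irev0 ?irev1 ?H0 ?H1//.
apply: (@approaching_comp _ _ _ _ _ _ _ _ _ _ _ _
  (fun z => (z.1, irev z.2)) H); last exact: aH.
by apply: (@approaching_ext _ _ _ _ _ _ _ _ _ (fun z : M * I => (z.1, irev z.2)))
  => // x _; exact: ci.
Qed.

Lemma appr_homotopic_trans g f h :
  appr_homotopic f g -> appr_homotopic g h -> appr_homotopic f h.
Proof.
move=> [H [aH H0 H1]] [H' [aH' H'0 H'1]].
have c : continuous (concat H H').
  move=> [u t]; apply: concat_continuous => [s|s|]; rewrite ?H1 ?H'0//; exact: cts_fun.
exists [the continuousType (zcompl M * I)%type (zcompl N) of mkcts c].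
split=> [|u|u]; rewrite /= /mkcts /= ?concat0 ?concat1 ?H0 ?H'1//.
apply: (@approaching_if _ _ _ _ _ _ _ _ (fun z : zcompl M * I => val z.2 - 1 / 2 <= 0)).
- by apply: metrizable_prod; [exact: zspace_metrizable|exact: metrizable_I].
- apply: (@approaching_comp _ _ _ _ _ _ _ _ _ _ _ _ 
    (fun z : zcompl M * I => (z.1, clamp (2 * val z.2))) H); last exact: aH.
  apply: (@approaching_ext _ _ _ _ _ _ _ _ _
    (fun z : M * I => (z.1, clamp (2 * val z.2 - 0)))) => [x _|//|[u t]].
    exact: rescale_continuous.
  by rewrite /= subr0.
- apply: (@approaching_comp _ _ _ _ _ _ _ _ _ _ _ _ 
    (fun z : zcompl M * I => (z.1, clamp (2 * val z.2 - 1))) H'); last exact: aH'.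
  apply: (@approaching_ext _ _ _ _ _ _ _ _ _
    (fun z : M * I => (z.1, clamp (2 * val z.2 - 1)))) => [x _|//|//].
  exact: rescale_continuous.
Qed.

End Equivalence.

Lemma appr_homotopic_compl X Y Z (M : zpair R X) (N : zpair R Y) (L : zpair R Z)
    (g : appr N L) (f f' : appr M N) :
  appr_homotopic f f' -> appr_homotopic (appr_comp g f) (appr_comp g f').
Proof.
move=> [H [aH H0 H1]]; exists (ctscomp g H); split=> [|u|u]; rewrite /= ?H0 ?H1//.
exact: (approaching_comp aH (@appr_approaching _ _ _ _ _ g)).
Qed.

Lemma appr_homotopic_compr X Y Z (M : zpair R X) (N : zpair R Y) (L : zpair R Z)
    (g g' : appr N L) (f : appr M N) :
  appr_homotopic g g' -> appr_homotopic (appr_comp g f) (appr_comp g' f).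
Proof.
move=> [H [aH H0 H1]].
have c : continuous (fun z : zcompl M * I => H (f z.1, z.2)).
  move=> z; apply: (@continuous_comp _ _ _ (fun z : zcompl M * I => (f z.1, z.2)) H).
    apply: continuous_pair; last exact: continuous_snd.
    apply: (@continuous_comp _ _ _ fst f); first exact: continuous_fst.
    exact: cts_fun.
  exact: cts_fun.
exists [the continuousType (zcompl M * I)%type (zcompl L) of mkcts c].
split=> [|u|u]; rewrite /= /mkcts ?H0 ?H1//.
apply: (@approaching_comp _ _ _ _ _ _ _ _ _ _ _ _ (fun z => (f z.1, z.2)) H); last exact: aH.
exact: (approaching_prodI (zspace_metrizable N) (@appr_approaching _ _ _ _ _ f)).
Qed.

Lemma closed_gauge M (A : set M) : metrizable R M -> closed A ->
  exists del : M -> R, [/\ continuous del, forall m, 0 <= del m,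
    forall m, A m -> del m = 0 & forall m, ~ A m -> 0 < del m].
Proof.
move=> [d dM] cA.
have [A0|/set0P/negP/negPn/eqP A0] := pselect (A !=set0); last first.
  exists (fun=> 1); split=> [m|m|m|m]; rewrite ?A0//; exact: cvg_cst.
exists (dset d A); split=> [|m|m|m].
- exact: dset_continuous.
- exact: dset_ge0.
- exact: dset_eq0.
- exact: dset_gt0.
Qed.

(** The homotopy of the Z-set [Y] is run for a time that vanishes exactly on [A]. *)
Lemma push_off Y (N : zpair R Y) M (A : set M) (F : M -> N) :
  metrizable R M -> closed A -> continuous F ->
  exists G : M -> N, [/\ continuous G, forall m, A m -> G m = F m &
    forall m, ~ A m -> zcompl N (G m)].
Proof.
move=> mM cA cF; have [del [cdel del0 delA delN]] := closed_gauge mM cA.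
have [_ [h [h0 hY]]] := z_Zset N.
exists (fun m => h (F m, clamp (del m))); split=> [m|m /delA ->|m /delN dm].
- apply: (@continuous_comp _ _ _ (fun m => (F m, clamp (del m))) h); last exact: cts_fun.
  apply: continuous_pair; first exact: cF.
  apply: (@continuous_comp _ _ _ del (@clamp R)); first exact: cdel.
  exact: clamp_continuous.
- by rewrite clamp_le0.
- by apply: hY; rewrite /= lt_max lt_min ltr01 dm orbT.
Qed.

Lemma zcompl_fun Y (N : zpair R Y) (U : topologicalType) (F : U -> N) :
  continuous F -> (forall u, zcompl N (F u)) ->
  exists f : continuousType U (zcompl N), forall u, val (f u) = F u.
Proof.
move=> cF FN; pose f u : zcompl N := exist _ (F u) (mem_set (FN u)).
have cf : continuous f.
  by move=> u; apply: (@cvg_set_val _ (nbhs u) _ N (zcompl N)); exact: cF.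
by exists [the continuousType U (zcompl N) of mkcts cf].
Qed.

Lemma combines_exists X Y (M : zpair R X) (N : zpair R Y)
    (phi : continuousType X Y) : exists f : appr M N, combines phi f.
Proof.
have [F cF Fphi] : exists2 F : M -> N, continuous F &
    forall x, F (zincl M x) = zincl N (phi x).
  apply: (ext_AR (zspace_metrizable M) (z_emb M) (z_AR N)) => x.
  by apply: (@continuous_comp _ _ _ phi (zincl N)); [exact: cts_fun|exact: zincl_continuous].
have [clX _] := z_Zset M.
have [G [cG GX GN]] := push_off (zspace_metrizable M) clX cF.
have cGv : continuous (fun u : zcompl M => G (val u)).
  move=> u; apply: (@continuous_comp _ _ _ (fun u : zcompl M => val u : M) G).
    exact: val_continuous.
  exact: cG.
have [f fG] := zcompl_fun cGv (fun u => GN _ (@zcompl_not _ _ _ u)).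
have Gi x : G (zincl M x) = zincl N (phi x) by rewrite GX ?Fphi//; exists x.
have af : z_approaching f.
  apply: (@approaching_ext _ _ _ _ _ _ _ _ _ G) => [x _|_ [x _ <-]|u].
  - exact: cG.
  - by rewrite Gi; exists (phi x).
  - by rewrite fG.
exists (Appr af), [the continuousType M N of mkcts cG].
by split=> // u; rewrite /= fG.
Qed.

(** Stated for a general [A] because [A] may also be the image of a compact part of [Y] in [N],
    smaller than [Y]. *)
Lemma pushed_homotopic Y (N : zpair R Y) U M (a : U -> M) (A : set M)
    (F F' : M -> N) (f f' : U -> zcompl N) :
  metrizable R M -> closed A -> continuous a -> (forall u, ~ A (a u)) ->
  continuous F -> continuous F' ->
  (forall m, A m -> F m = F' m) -> (forall m, A m -> range (zincl N) (F m)) ->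
  (forall u, val (f u) = F (a u)) -> (forall u, val (f' u) = F' (a u)) ->
  exists H : continuousType (U * I)%type (zcompl N),
    [/\ approaching (fun p : (U * I)%type => (a p.1, p.2)) (A `*` [set: I])
          (fun v : zcompl N => val v : N) (range (zincl N)) H,
        forall u, H (u, I0) = f u & forall u, H (u, I1) = f' u].
Proof.
move=> mM cA ca aA cF cF' FF FA fF fF'.
have [mu [cmu mu0 mu1 muxx]] := AR_equiconnected (z_AR N).
have [del [cdel del0 delA delN]] := closed_gauge mM cA.
have [_ [h [h0 hY]]] := z_Zset N.
(* Zero at both ends and over [A], where the homotopy must not be altered, and positive elsewhere,
   where it must miss [Y]. *)
pose s (z : M * I) := val z.2 * (1 - val z.2) * del z.1.
pose G (z : M * I) := h (mu (F z.1, F' z.1, z.2), clamp (s z)).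
have cval : continuous (fun z : M * I => val z.2).
  move=> z; apply: (@continuous_comp _ _ _ snd (fun t : I => val t)).
    exact: continuous_snd.
  exact: val_continuous.
have cs : continuous s.
  move=> z; apply: cvgM; last first.
    by apply: (@continuous_comp _ _ _ fst del); [exact: continuous_fst|exact: cdel].
  apply: cvgM; first exact: cval.
  by apply: cvgB; [exact: cvg_cst|exact: cval].
have cG : continuous G.
  move=> z; apply: (@continuous_comp _ _ _
    (fun z => (mu (F z.1, F' z.1, z.2), clamp (s z))) h); last exact: cts_fun.
  apply: continuous_pair.
    apply: (@continuous_comp _ _ _ (fun z : M * I => (F z.1, F' z.1, z.2)) mu); last exact: cmu.
    apply: continuous_pair; last exact: continuous_snd.
    apply: continuous_pair.
      by apply: (@continuous_comp _ _ _ fst F); [exact: continuous_fst|exact: cF].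
    by apply: (@continuous_comp _ _ _ fst F'); [exact: continuous_fst|exact: cF'].
  by apply: (@continuous_comp _ _ _ s (@clamp R)); [exact: cs|exact: clamp_continuous].
have G0 m : G (m, I0) = F m.
  by rewrite /G /s /= mul0r mul0r clamp_le0// h0 mu0.
have G1 m : G (m, I1) = F' m.
  by rewrite /G /s /= subrr mulr0 mul0r clamp_le0// h0 mu1.
pose aI (p : (U * I)%type) := (a p.1, p.2).
have caI : continuous aI.
  move=> p; apply: continuous_pair; last exact: continuous_snd.
  by apply: (@continuous_comp _ _ _ fst a); [exact: continuous_fst|exact: ca].
have cGa : continuous (G \o aI).
  by move=> p; apply: continuous_comp; [exact: caI|exact: cG].
have GN p : zcompl N ((G \o aI) p).
  case: p => u t /=.
  have [t0|t0] := ltP 0 (val t); last first.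
    have tE : t = I0 by apply/val_inj/le_anti; rewrite t0 I_ge0.
    by rewrite /aI /= tE G0 -fF; exact: zcompl_not.
  have [t1|t1] := ltP (val t) 1; last first.
    have tE : t = I1 by apply/val_inj/le_anti; rewrite t1 I_le1.
    by rewrite /aI /= tE G1 -fF'; exact: zcompl_not.
  apply: hY; rewrite /= lt_max lt_min ltr01 /s /= mulr_gt0 ?orbT//.
    by rewrite mulr_gt0// subr_gt0.
  exact/delN/aA.
have [H HG] := zcompl_fun cGa GN.
exists H; split.
- apply: (@approaching_ext _ _ _ _ _ _ _ _ _ G) => [z _|[m t] [/= Am _]|p].
  + exact: cG.
  + by rewrite /G /s /= delA// mulr0 clamp_le0// h0 FF// muxx -FF//; exact: FA.
  + by rewrite HG.
- by move=> u; apply: val_inj; rewrite HG /= /aI /= G0 fF.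
- by move=> u; apply: val_inj; rewrite HG /= /aI /= G1 fF'.
Qed.

Lemma combines_unique X Y (M : zpair R X) (N : zpair R Y)
    (phi : continuousType X Y) (f f' : appr M N) :
  combines phi f -> combines phi f' -> appr_homotopic f f'.
Proof.
move=> [F [Fi Fv]] [F' [Fi' Fv']].
apply: (@pushed_homotopic Y N (zcompl M) M (fun u => val u) (range (zincl M)) F F').
- exact: zspace_metrizable.
- by have [] := z_Zset M.
- exact: val_continuous.
- exact: zcompl_not.
- exact: cts_fun.
- exact: cts_fun.
- by move=> _ [x _ <-]; rewrite Fi Fi'.
- by move=> _ [x _ <-]; rewrite Fi; exists (phi x).
- by move=> u; rewrite Fv.
- by move=> u; rewrite Fv'.
Qed.

Lemma combines_id X (M : zpair R X) : combines (ctsid X) (appr_id M).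
Proof. by exists (ctsid M). Qed.

Lemma combines_comp X Y Z (M : zpair R X) (N : zpair R Y) (L : zpair R Z)
    (phi : continuousType X Y) (psi : continuousType Y Z)
    (f : appr M N) (g : appr N L) :
  combines phi f -> combines psi g -> combines (ctscomp psi phi) (appr_comp g f).
Proof.
move=> [F [Fi Fv]] [G [Gi Gv]]; exists (ctscomp G F).
by split=> [x|u] /=; rewrite ?Fi ?Gi ?Fv ?Gv.
Qed.

(* the square with horizontal sides f, f' and vertical sides al, be commutes
   in the fine shape category *)
Definition fsquare X Y X' Y' (M : zpair R X) (N : zpair R Y) (M' : zpair R X')
    (N' : zpair R Y') (al : continuousType X X') (be : continuousType Y Y')
    (f : appr M N) (f' : appr M' N') : Prop :=
  exists (i : appr M M') (j : appr N N'),
    [/\ combines al i, combines be j &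
        appr_homotopic (appr_comp j f) (appr_comp f' i)].

Lemma fsquareP X Y X' Y' (M : zpair R X) (N : zpair R Y) (M' : zpair R X')
    (N' : zpair R Y') (al : continuousType X X') (be : continuousType Y Y')
    (f : appr M N) (f' : appr M' N') (i : appr M M') (j : appr N N') :
  combines al i -> combines be j ->
  fsquare al be f f' <-> appr_homotopic (appr_comp j f) (appr_comp f' i).
Proof.
move=> ci cj; split=> [[i' [j' [ci' cj' H]]]|H]; last by exists i, j.
apply: appr_homotopic_trans (appr_homotopic_compr f (combines_unique cj cj')) _.
exact: appr_homotopic_trans H (appr_homotopic_compl f' (combines_unique ci' ci)).
Qed.

Lemma fsquare_hcomp X Y Z X' Y' Z' (M : zpair R X) (N : zpair R Y)
    (L : zpair R Z) (M' : zpair R X') (N' : zpair R Y') (L' : zpair R Z')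
    (al : continuousType X X') (be : continuousType Y Y')
    (ga : continuousType Z Z') (f : appr M N) (g : appr N L)
    (f' : appr M' N') (g' : appr N' L') :
  fsquare al be f f' -> fsquare be ga g g' ->
  fsquare al ga (appr_comp g f) (appr_comp g' f').
Proof.
move=> [i [j [ci cj Hf]]] [j' [k [cj' ck Hg]]].
have {}Hg := (fsquareP g g' cj ck).1 (ex_intro _ j' (ex_intro _ k (And3 cj' ck Hg))).
exists i, k; split=> //.
have := appr_homotopic_trans (appr_homotopic_compr f Hg) (appr_homotopic_compl g' Hf).
by apply: appr_homotopic_ext.
Qed.

Lemma fsquare_vcomp X Y X' Y' X'' Y'' (M : zpair R X) (N : zpair R Y)
    (M' : zpair R X') (N' : zpair R Y') (M'' : zpair R X'') (N'' : zpair R Y'')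
    (al : continuousType X X') (be : continuousType Y Y')
    (al' : continuousType X' X'') (be' : continuousType Y' Y'')
    (f : appr M N) (f' : appr M' N') (f'' : appr M'' N'') :
  fsquare al be f f' -> fsquare al' be' f' f'' ->
  fsquare (ctscomp al' al) (ctscomp be' be) f f''.
Proof.
move=> [i [j [ci cj H]]] [i' [j' [ci' cj' H']]].
exists (appr_comp i' i), (appr_comp j' j).
split; [exact: combines_comp|exact: combines_comp|].
have := appr_homotopic_trans (appr_homotopic_compl j' H) (appr_homotopic_compr i H').
by apply: appr_homotopic_ext.
Qed.

Lemma fsquare_refl X Y (M : zpair R X) (N : zpair R Y) (f : appr M N) :
  fsquare (ctsid X) (ctsid Y) f f.
Proof.
exists (appr_id M), (appr_id N); split; try exact: combines_id.
by apply: (appr_homotopic_ext (f := f) (g := f)) => //; exact: appr_homotopic_refl.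
Qed.

(** Maps combining with the identity in opposite directions are mutually inverse up to approaching
    homotopy, as their composites again combine with the identity. *)
Lemma fsquare_sym X Y (M M' : zpair R X) (N N' : zpair R Y) (f : appr M N)
    (f' : appr M' N') :
  fsquare (ctsid X) (ctsid Y) f f' -> fsquare (ctsid X) (ctsid Y) f' f.
Proof.
move=> [i [j [ci cj H]]].
have [i' ci'] := combines_exists M' M (ctsid X).
have [j' cj'] := combines_exists N' N (ctsid Y).
have ii : appr_homotopic (appr_comp i i') (appr_id M').
  apply: (@combines_unique X X _ _ (ctsid X)) (combines_id M').
  by rewrite -[ctsid _]ctscomp_idl; exact: combines_comp.
have jj : appr_homotopic (appr_comp j' j) (appr_id N).
  apply: (@combines_unique Y Y _ _ (ctsid Y)) (combines_id N).
  by rewrite -[ctsid _]ctscomp_idl; exact: combines_comp.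
exists i', j'; split=> //.
have h1 := appr_homotopic_sym (appr_homotopic_compl (appr_comp j' f') ii).
have h2 := appr_homotopic_compl j' (appr_homotopic_compr i' (appr_homotopic_sym H)).
have h3 := appr_homotopic_compr (appr_comp f i') jj.
apply: appr_homotopic_trans; first exact: (appr_homotopic_ext _ _ h1).
apply: appr_homotopic_trans; first exact: (appr_homotopic_ext _ _ h2).
exact: (appr_homotopic_ext _ _ h3).
Qed.

(** Representatives can be moved to prescribed ARs; this is what makes composable any two classes
    with matching objects. *)
Lemma appr_at (X Y : topologicalType) (M M' : zpair R X) (N N' : zpair R Y)
    (f : appr M N) :
  exists f' : appr M' N', fsquare (ctsid X) (ctsid Y) f f'.
Proof.
have [i ci] := combines_exists M' M (ctsid X).
have [j cj] := combines_exists N N' (ctsid Y).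
have [i' ci'] := combines_exists M M' (ctsid X).
exists (appr_comp (appr_comp j f) i), i', j; split=> //=.
have ii : appr_homotopic (appr_comp i i') (appr_id M).
  apply: (@combines_unique X X _ _ (ctsid X)) (combines_id _).
  by rewrite -[ctsid _]ctscomp_idl; exact: combines_comp.
have := appr_homotopic_sym (appr_homotopic_compl (appr_comp j f) ii).
by apply: appr_homotopic_ext.
Qed.

Lemma fsquare_trans X Y (M M' M'' : zpair R X) (N N' N'' : zpair R Y)
    (f : appr M N) (f' : appr M' N') (f'' : appr M'' N'') :
  fsquare (ctsid X) (ctsid Y) f f' -> fsquare (ctsid X) (ctsid Y) f' f'' ->
  fsquare (ctsid X) (ctsid Y) f f''.
Proof.
by move=> H H'; have := fsquare_vcomp H H'; rewrite !ctscomp_idl.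
Qed.

Lemma fsquare_combines X Y X' Y' (M : zpair R X) (N : zpair R Y)
    (M' : zpair R X') (N' : zpair R Y') (al : continuousType X X')
    (be : continuousType Y Y') (phi : continuousType X Y)
    (phi' : continuousType X' Y') (f : appr M N) (f' : appr M' N') :
  combines phi f -> combines phi' f' -> (forall x, be (phi x) = phi' (al x)) ->
  fsquare al be f f'.
Proof.
move=> cf cf' E.
have [i ci] := combines_exists M M' al; have [j cj] := combines_exists N N' be.
exists i, j; split=> //; apply: combines_unique (combines_comp cf cj) _.
rewrite (_ : ctscomp be phi = ctscomp phi' al); first exact: combines_comp.
by apply/continuousEP => x; exact: E.
Qed.

End ApproachingHomotopies.
Arguments res_ANR {R X} a i.
Arguments cmp {O c x y z} _ _ : simpl never.

(** * From fine shape to shape *)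

Section FineShapeToShape.
Variable R : realType.
Local Notation I := (set_type (@unit_interval R)).
Local Notation I0 := (@I0 R).
Local Notation I1 := (@I1 R).

(** The homotopy is extended over [M] times the interval and pushed off [Y]; its ends combine with
    [phi] and [psi], and uniqueness compares them with [f] and [g]. *)
Lemma combines_homotopic (X Y : topologicalType) (M : zpair R X)
    (N : zpair R Y) (phi psi : continuousType X Y) (f g : appr M N) :
  homotopic R phi psi -> combines phi f -> combines psi g -> appr_homotopic f g.
Proof.
move=> [h [h0 h1]] cf cg.
have mMI := metrizable_prod (zspace_metrizable M) (metrizable_I R).
have emb := closed_embedding_prodI R (z_emb M).
have [|F cF Fh] := ext_AR mMI emb (z_AR N) (f := fun z => zincl N (h z)).
  move=> z; apply: (@continuous_comp _ _ _ h (zincl N)); first exact: cts_fun.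
  exact: zincl_continuous.
pose A : set (M * I)%type := fst @^-1` range (zincl M).
have cA : closed A.
  apply: preimage_closed => [z _|]; first exact: continuous_fst.
  by have [] := z_Zset M.
have [G [cG GA GN]] := push_off mMI cA cF.
have cGv : continuous (fun z : zcompl M * I => G (val z.1, z.2)).
  move=> z; apply: (@continuous_comp _ _ _
    (fun z : zcompl M * I => (val z.1 : M, z.2)) G); last exact: cG.
  apply: continuous_pair; last exact: continuous_snd.
  apply: (@continuous_comp _ _ _ fst (fun u : zcompl M => val u : M)).
    exact: continuous_fst.
  exact: val_continuous.
have [H HG] := zcompl_fun cGv (fun z => GN (val z.1, z.2) (@zcompl_not _ _ _ z.1)).
have aH : approaching (fun p : (zcompl M * I)%type => (val p.1 : M, p.2))
    (range (zincl M) `*` [set: I])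
    (fun v : zcompl N => val v : N) (range (zincl N)) H.
  apply: (@approaching_ext _ _ _ _ _ _ _ _ _ G) => [z _|[m t] [/= [x _ <-] _]|z].
  - exact: cG.
  - by rewrite GA; [rewrite (Fh (x, t)); exists (h (x, t))|exists x].
  - by rewrite HG.
have end_ t (phi' : continuousType X Y) : (forall x, h (x, t) = phi' x) -> exists2 f' : appr M N,
    combines phi' f' & forall u, f' u = H (u, t).
  move=> ht; have c : continuous (fun u => H (u, t)).
    move=> u; apply: (@continuous_comp _ _ _ (fun u => (u, t)) H); last exact: cts_fun.
    exact: continuous_pairl.
  have cGt : continuous (fun m => G (m, t)).
    move=> m; apply: (@continuous_comp _ _ _ (fun m => (m, t)) G); last exact: cG.
    exact: continuous_pairl.
  have Gt x : G (zincl M x, t) = zincl N (phi' x).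
    by rewrite GA; [rewrite (Fh (x, t)) ht|exists x].
  have af : z_approaching (fun u => H (u, t)).
    apply: (@approaching_ext _ _ _ _ _ _ _ _ _ (fun m => G (m, t))) => [m _|_ [x _ <-]|u].
    - exact: cGt.
    - by rewrite Gt; exists (phi' x).
    - by rewrite HG.
  exists (@Appr _ _ _ _ _ [the continuousType (zcompl M) (zcompl N) of mkcts c] af) => //.
  by exists [the continuousType M N of mkcts cGt]; split=> // u; rewrite /= /mkcts HG.
have [f' cf' f'H] := end_ I0 phi h0; have [g' cg' g'H] := end_ I1 psi h1.
apply: appr_homotopic_trans (combines_unique cf cf') _.
apply: appr_homotopic_trans (combines_unique cg' cg).
by exists H; split.
Qed.

Lemma hclass_eq (X Y : metrSpace R) (f g : continuousType X Y) :
  hclass f = hclass g <-> homotopic R f g.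
Proof.
split=> [E|fg].
  have : hclass g g by exact: homotopic_refl.
  by rewrite -E.
apply/funext => h; apply/propext; split=> [fh|gh].
  exact: homotopic_trans (homotopic_sym fg) fh.
exact: homotopic_trans fg gh.
Qed.

Lemma cmp_hclass (X Y Z : metrSpace R) (g : continuousType Y Z)
    (f : continuousType X Y) :
  cmp (hclass g) (hclass f) = hclass (ctscomp g f).
Proof.
apply/funext => s; apply/propext; split=> [[b [a [c [gb fa -> cs]]]]|gfs].
  exact: homotopic_trans (homotopic_comp fa gb) cs.
by exists g, f, (ctscomp g f); split=> //; exact: homotopic_refl.
Qed.

Lemma idm_hclass (X : metrSpace R) : @idm _ (Ho R) X = hclass (ctsid X).
Proof.
by apply/funext => s; apply/propext; split=> [[r [-> rs]]|] //; exists (ctsid X).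
Qed.

Lemma mor_hclass (X Y : metrSpace R) (f : continuousType X Y) : mor (hclass f).
Proof. by exists f. Qed.

Section ProClasses.
Variables (X : metrSpace R) (p : anr_res X).

(* the element of colim [p i, Y] corresponding to f under [X, Y] *)
Definition pro_of (Y : metrSpace R) (f : continuousType X Y) :
    pro_elt p Y -> Prop :=
  fun t => exists2 h, tagged t = hclass h &
    homotopic R (ctscomp h (proj p (tag t))) f.

(** This identifies classes in the colimit with homotopy classes of maps on [X]; injectivity is
    [res_homotopic_near]. *)
Lemma pro_class_pro_of (Y : metrSpace R) (f : continuousType X Y)
    (t : pro_elt p Y) : ANR R Y -> pro_of f t -> pro_class t = pro_of f.
Proof.
case: t => i c aY [h /= -> hf]; apply/funext => -[j c']; apply/propext; split.
  move=> [[h' /= ->] [k [hs [ht /= E]]]]; exists h' => //=; move: hs ht E => /= ik jk.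
  rewrite !cmp_hclass => /hclass_eq E.
  have := homotopic_comp (homotopic_refl R (proj p k)) E.
  rewrite !ctscompA !proj_bondM => E'.
  exact: homotopic_trans (homotopic_sym E') hf.
move=> [h' /= -> hf']; split; first exact: mor_hclass.
have [k [ik [jk E]]] := res_homotopic_near aY (homotopic_trans hf (homotopic_sym hf')).
by exists k, ik, jk; rewrite /= !cmp_hclass; exact/hclass_eq.
Qed.

Lemma pro_of_ex (Y : metrSpace R) (f : continuousType X Y) : ANR R Y ->
  exists i (h : continuousType (p i) Y),
    pro_of f (Tagged (fun i => arr (Ho R) (p i) Y) (hclass h)).
Proof.
by move=> /(res_approx p f) [i [h hf]]; exists i, h; exists h.
Qed.

Lemma pro_of_eq (Y : metrSpace R) (f g : continuousType X Y) : ANR R Y ->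
  pro_of f = pro_of g <-> homotopic R f g.
Proof.
move=> aY; split=> [E|fg].
  have [i [h ft]] := pro_of_ex f aY; have := ft; rewrite E => -[h' /= E' h'g].
  have [h'' /= /esym E'' h''f] := ft.
  move: E'' E' => <-; move/hclass_eq => hh.
  apply: homotopic_trans (homotopic_sym h''f) (homotopic_trans _ h'g).
  exact: homotopic_comp (homotopic_refl _ _) hh.
apply/funext => t; apply/propext; split=> -[h E hf]; exists h => //.
  exact: homotopic_trans hf fg.
exact: homotopic_trans hf (homotopic_sym fg).
Qed.

End ProClasses.

Arguments pro_of {X} p {Y} f _.

Lemma pro_mor_pro_of (X Y : metrSpace R) (p : anr_res X) (q : anr_res Y)
    (F : pro_arr p q) : pro_mor F ->
  exists f : forall m, continuousType X (q m), forall m, F m = pro_of p (f m).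
Proof.
move=> [FM _].
have H m : exists f : continuousType X (q m), F m = pro_of p f.
  have [[i c] [[h /= ->] ->]] := FM m.
  exists (ctscomp h (proj p i)); apply: pro_class_pro_of; first exact: res_ANR.
  by exists h => //; exact: homotopic_refl.
by exists (fun m => projT1 (cid (H m))) => m; exact: projT2 (cid (H m)).
Qed.

(** A composite is computed by factoring [g] through any term of [q]; the last hypothesis says that
    every such factorization gives [h]. *)
Lemma pro_cmp_pro_of (X Y Z : metrSpace R) (p : anr_res X) (q : anr_res Y)
    (r : anr_res Z) (G : pro_arr q r) (F : pro_arr p q) m
    (g : continuousType Y (r m)) (f : forall n, continuousType X (q n))
    (h : continuousType X (r m)) :
  G m = pro_of q g -> (forall n, F n = pro_of p (f n)) ->
  (forall n (k : continuousType (q n) (r m)),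
    homotopic R (ctscomp k (proj q n)) g -> homotopic R (ctscomp k (f n)) h) ->
  pro_cmp G F (m := m) = pro_of p h.
Proof.
move=> Gg Ff H; have ar := res_ANR r m.
have step n (k : continuousType (q n) (r m)) i (l : continuousType (p i) (q n)) :
    homotopic R (ctscomp k (proj q n)) g ->
    homotopic R (ctscomp l (proj p i)) (f n) ->
    pro_class (pro_post (hclass k) (Tagged (fun i => arr (Ho R) (p i) (q n)) (hclass l)))
      = pro_of p h.
  move=> kg lf; apply: pro_class_pro_of => //; exists (ctscomp k l) => /=.
    exact: cmp_hclass.
  apply: homotopic_trans (H _ _ kg); rewrite ctscompA.
  exact: homotopic_comp lf (homotopic_refl _ _).
apply/funext => t; apply/propext; split.
  move=> [[n c] [[i c'] [/=]]]; rewrite Gg Ff => -[k /= -> kg] [l /= -> lf].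
  by rewrite step.
move=> ht; have [n [k gk]] := pro_of_ex q g ar.
have [i [l fl]] := pro_of_ex p (f n) (res_ANR q n).
exists (Tagged (fun n => arr (Ho R) (q n) (r m)) (hclass k)).
exists (Tagged (fun i => arr (Ho R) (p i) (q n)) (hclass l)).
rewrite /= Gg Ff; split=> //.
have [k' /= /hclass_eq kk kg] := gk; have [l' /= /hclass_eq ll lf] := fl.
rewrite step//.
  exact: homotopic_trans (homotopic_comp (homotopic_refl _ _) kk) kg.
exact: homotopic_trans (homotopic_comp (homotopic_refl _ _) ll) lf.
Qed.

(** A pro-morphism amounts to a compatible family of classes in [X, q m]; here the family is the
    pull-back along [f] of the projections of [q]. *)
Definition induces (X Y : metrSpace R) (M : zpair R X) (N : zpair R Y)
    (f : appr M N) (p : anr_res X) (q : anr_res Y) (F : pro_arr p q) : Prop :=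
  exists2 h : forall m, continuousType X (q m),
    forall m, F m = pro_of p (h m) & forall m, traces f (proj q m) (h m).

Lemma induces_mor (X Y : metrSpace R) (M : zpair R X) (N : zpair R Y)
    (f : appr M N) (p : anr_res X) (q : anr_res Y) (F : pro_arr p q) :
  induces f F -> pro_mor F.
Proof.
move=> [h Fh tr]; split=> [m|m n mn [i c]].
  have [i [l hl]] := pro_of_ex p (h m) (res_ANR q m).
  exists (Tagged (fun i => arr (Ho R) (p i) (q m)) (hclass l)).
  by split; [exact: mor_hclass|rewrite Fh (pro_class_pro_of _ hl)//; exact: res_ANR].
rewrite !Fh => -[l /= -> lh]; apply/esym/pro_class_pro_of; first exact: res_ANR.
exists (ctscomp (bond mn) l) => /=; first exact: cmp_hclass.
have ft := homotopic_comp lh (homotopic_refl R (bond mn)).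
rewrite ctscompA; apply: homotopic_trans ft _.
apply: (traces_unique (res_ANR q m) (appr_homotopic_refl f) (homotopic_refl _ (proj q m))) (tr m).
by have := traces_post (bond mn) (tr n); rewrite proj_bondM.
Qed.

Lemma induces_ex (X Y : metrSpace R) (M : zpair R X) (N : zpair R Y)
    (f : appr M N) (p : anr_res X) (q : anr_res Y) :
  exists F : pro_arr p q, induces f F.
Proof.
have H m := traces_exists f (proj q m) (res_ANR q m).
exists (fun m => pro_of p (projT1 (cid (H m)))), (fun m => projT1 (cid (H m))) => // m.
exact: projT2 (cid (H m)).
Qed.

Lemma induces_unique (X Y : metrSpace R) (M : zpair R X) (N : zpair R Y)
    (f f' : appr M N) (p : anr_res X) (q : anr_res Y) (F F' : pro_arr p q) :
  appr_homotopic f f' -> induces f F -> induces f' F' -> F = F'.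
Proof.
move=> ff [h Fh tr] [h' Fh' tr']; apply: functional_extensionality_dep => m.
rewrite Fh Fh'; apply/pro_of_eq; first exact: res_ANR.
exact: (traces_unique (res_ANR q m) ff (homotopic_refl _ _) (tr m) (tr' m)).
Qed.

Lemma induces_comp (X Y Z : metrSpace R) (M : zpair R X) (N : zpair R Y)
    (L : zpair R Z) (f : appr M N) (g : appr N L) (p : anr_res X)
    (q : anr_res Y) (r : anr_res Z) (F : pro_arr p q) (G : pro_arr q r) :
  induces f F -> induces g G -> induces (appr_comp g f) (pro_cmp G F).
Proof.
move=> [h Fh tr] [k Gk tr'].
have H m : exists l : continuousType X (r m), traces f (k m) l.
  exact: traces_exists (res_ANR r m).
exists (fun m => projT1 (cid (H m))) => m; case: (cid (H m)) => l fl /=.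
  apply: (pro_cmp_pro_of (Gk m) Fh) => n j jk.
  apply: (traces_unique (res_ANR r m) (appr_homotopic_refl f) jk) fl.
  exact: traces_post.
exact: (traces_comp (res_ANR r m) fl (tr' m)).
Qed.

Lemma induces_id (X : metrSpace R) (M : zpair R X) (p : anr_res X) :
  induces (appr_id M) (@pro_id R p).
Proof.
exists (proj p) => m.
  apply: pro_class_pro_of; first exact: res_ANR.
  exists (ctsid (p m)); first exact: idm_hclass.
  by rewrite ctscomp_idl; exact: homotopic_refl.
by have := traces_combines (proj p m) (res_ANR p m) (combines_id M); rewrite ctscomp_idr.
Qed.

(** For identities this shows that the canonical isomorphisms between resolutions are exactly the
    pro-morphisms induced by maps combining with the identity. *)
Lemma induces_over (X Y : metrSpace R) (M : zpair R X) (N : zpair R Y)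
    (phi : continuousType X Y) (f : appr M N) (p : anr_res X) (q : anr_res Y)
    (F : pro_arr p q) :
  combines phi f -> induces f F <-> pro_over (hclass phi) F.
Proof.
move=> cf; split=> [iF|[mF oF]].
  split=> [|m t]; first exact: induces_mor iF.
  have [h -> tr] := iF => -[l -> lh]; rewrite !cmp_hclass; apply/hclass_eq.
  apply: homotopic_trans lh _.
  apply: (traces_unique (res_ANR q m) (appr_homotopic_refl f) (homotopic_refl _ (proj q m)) (tr m)).
  exact: traces_combines (res_ANR q m) cf.
have [h Fh] := pro_mor_pro_of mF; exists h => // m.
have tc := traces_combines (proj q m) (res_ANR q m) cf.
apply: (traces_homotopic (res_ANR q m) (homotopic_refl _ _) _ tc).
have [i [l hl]] := pro_of_ex p (h m) (res_ANR q m).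
have [l' /= /hclass_eq ll lh] := hl.
have := hl; rewrite -Fh => /oF /=; rewrite !cmp_hclass => /hclass_eq E.
apply: homotopic_trans (homotopic_sym E) (homotopic_trans _ lh).
exact: homotopic_comp (homotopic_refl _ _) ll.
Qed.

Lemma induces_eqv (X Y : metrSpace R) (M M' : zpair R X) (N N' : zpair R Y)
    (f : appr M N) (f' : appr M' N') (s s' : sh_rep X Y) :
  fsquare (ctsid X) (ctsid Y) f f' ->
  induces f (@sh_arr _ _ _ s) -> induces f' (@sh_arr _ _ _ s') -> sh_eqv s s'.
Proof.
move=> [i [j [ci cj H]]] fs fs'.
have [A iA] := induces_ex i (sh_dom s) (sh_dom s').
have [B jB] := induces_ex j (sh_cod s) (sh_cod s').
exists A, B; split; [exact/(induces_over _ ci)|exact/(induces_over _ cj)|].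
exact: induces_unique H (induces_comp fs jB) (induces_comp iA fs').
Qed.

(** Together with [induces_eqv] this shows that the induced representatives fill a whole class. Both
    [s'] and the pro-morphism induced by [f'] become equal after composition with the canonical [A],
    which can be cancelled. *)
Lemma induces_transfer (X Y : metrSpace R) (M M' : zpair R X) (N N' : zpair R Y)
    (f : appr M N) (f' : appr M' N') (s s' : sh_rep X Y) :
  fsquare (ctsid X) (ctsid Y) f f' ->
  induces f (@sh_arr _ _ _ s) -> sh_eqv s s' -> induces f' (@sh_arr _ _ _ s').
Proof.
move=> [i [j [ci cj H]]] fs [A [B [oA oB AB]]].
have iA := (induces_over A ci).2 oA; have jB := (induces_over B cj).2 oB.
have [F f'F] := induces_ex f' (sh_dom s') (sh_cod s').
have E := induces_unique H (induces_comp fs jB) (induces_comp iA f'F).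
suff -> : @sh_arr _ _ _ s' = F by [].
have [h Fh _] := f'F; have [h' Fh'] := pro_mor_pro_of (@sh_mor _ _ _ s').
have [a Aa tra] := iA.
have aproj n : homotopic R (a n) (proj (sh_dom s') n).
  have tc := traces_combines (proj (sh_dom s') n) (res_ANR _ n) ci.
  have := traces_unique (res_ANR _ n) (appr_homotopic_refl i) (homotopic_refl _ _) (tra n) tc.
  by rewrite ctscomp_idr.
(* Since [A] lies over the identity of [X], composing with it does not change the homotopy class on
   [X] that describes a component. *)
have cancelA (G : pro_arr (sh_dom s') (sh_cod s')) m (g : continuousType X (sh_cod s' m)) :
    G m = pro_of (sh_dom s') g -> pro_cmp G A (m := m) = pro_of (sh_dom s) g.
  move=> Gg; apply: (pro_cmp_pro_of Gg Aa) => n k kg.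
  exact: homotopic_trans (homotopic_comp (aproj n) (homotopic_refl _ _)) kg.
apply: functional_extensionality_dep => m; rewrite Fh Fh'.
apply/pro_of_eq; first exact: res_ANR.
apply/(pro_of_eq (sh_dom s)); first exact: res_ANR.
rewrite -(cancelA _ _ _ (Fh m)) -(cancelA _ _ _ (Fh' m)).
by rewrite -[RHS](congr1 (fun K => K m) E) AB.
Qed.

Definition Fish_to_Sh (X Y : metrSpace R) (A : arr (Fish R) X Y) :
    arr (Sh R) X Y :=
  fun s => exists2 r, A r & induces (fish_map r) (@sh_arr _ _ _ s).

Lemma Fish_to_ShE (X Y : metrSpace R) (r : fish_rep X Y) (s : sh_rep X Y) :
  Fish_to_Sh (fish_eqv r) s <-> induces (fish_map r) (@sh_arr _ _ _ s).
Proof.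
split=> [[r' rr' rs]|rs]; last by exists r => //; exact: fsquare_refl.
apply: (induces_transfer (fsquare_sym rr') rs).
exact: (induces_eqv (fsquare_refl _) rs rs).
Qed.

Lemma Fish_to_Sh_class (X Y : metrSpace R) (r : fish_rep X Y) (s : sh_rep X Y) :
  induces (fish_map r) (@sh_arr _ _ _ s) -> Fish_to_Sh (fish_eqv r) = sh_eqv s.
Proof.
move=> rs; apply/funext => s'; apply/propext; split=> [/Fish_to_ShE rs'|ss'].
  exact: induces_eqv (fsquare_refl _) rs rs'.
by apply/Fish_to_ShE; exact: induces_transfer (fsquare_refl _) rs ss'.
Qed.

Lemma fish_eqv_eq (X Y : metrSpace R) (r s : fish_rep X Y) :
  fish_eqv r s -> fish_eqv r = fish_eqv s.
Proof.
move=> rs; apply/funext => t; apply/propext; split=> [rt|st].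
  exact: fsquare_trans (fsquare_sym rs) rt.
exact: fsquare_trans rs st.
Qed.

Lemma fish_rep_at (X Y : metrSpace R) (M : zpair R X) (N : zpair R Y)
    (r : fish_rep X Y) : exists f : appr M N, fish_eqv r = fish_eqv (FishRep f).
Proof.
by have [f rf] := appr_at M N (fish_map r); exists f; exact: fish_eqv_eq.
Qed.

Lemma fish_cmp (X Y Z : metrSpace R) (M : zpair R X) (N : zpair R Y)
    (L : zpair R Z) (g : appr N L) (f : appr M N) :
  @cmp _ (Fish R) X Y Z (fish_eqv (FishRep g)) (fish_eqv (FishRep f)) =
  fish_eqv (FishRep (appr_comp g f)).
Proof.
apply/funext => s; apply/propext; split.
  move=> [b [a [c [gb fa bac cs]]]]; case: bac gb fa cs => M' N' L' g' f' gg ff cs.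
  exact: fsquare_trans (fsquare_hcomp ff gg) cs.
by exists (FishRep g), (FishRep f), (FishRep (appr_comp g f)); split=> //;
  exact: fsquare_refl.
Qed.

Lemma fish_idm (X : metrSpace R) (M : zpair R X) :
  @idm _ (Fish R) X = fish_eqv (FishRep (appr_id M)).
Proof.
apply/funext => s; apply/propext; split=> [[r [rid rs]]|rs].
  case: rid rs => M' rs; apply: fsquare_trans rs => /=.
  by apply: (fsquare_combines (combines_id M) (combines_id M')).
by exists (FishRep (appr_id M)).
Qed.

Lemma Ho_to_FishE (X Y : metrSpace R) (M : zpair R X) (N : zpair R Y)
    (phi : continuousType X Y) (f : appr M N) : combines phi f ->
  Ho_to_Fish (hclass phi) = fish_eqv (FishRep f).
Proof.
move=> cf; apply/funext => s; apply/propext; split=> [[psi [r [pp cr rs]]]|fs].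
  apply: fsquare_trans rs => /=.
  have [g cg] := combines_exists M N psi.
  apply: (@fsquare_trans _ _ _ _ M _ _ N _ _ g).
    exists (appr_id M), (appr_id N); split; try exact: combines_id.
    have := combines_homotopic pp cf cg.
    by apply: appr_homotopic_ext.
  exact: (fsquare_combines cg cr).
by exists phi, (FishRep f); split=> //; exact: homotopic_refl.
Qed.

Lemma Fish_to_Sh_functor : is_functor Fish_to_Sh.
Proof.
split.
- move=> X Y _ [r ->].
  have [p] := anr_res_exists X; have [q] := anr_res_exists Y.
  have [F rF] := induces_ex (fish_map r) p q.
  by exists (ShRep (induces_mor rF)); apply: Fish_to_Sh_class.
- move=> X; have [M] := zpair_exists (ms_metrizable X).
  have [p] := anr_res_exists X.
  rewrite (fish_idm M); apply/funext => s; apply/propext; split.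
    move=> /Fish_to_ShE ids; exists (ShRep (induces_mor (induces_id M p))).
    split; first by exists p, (induces_mor (induces_id M p)).
    apply: induces_eqv (fsquare_refl (appr_id M)) _ ids; exact: induces_id.
  move=> [_ [[p' [h ->]] hs]]; apply/Fish_to_ShE.
  apply: induces_transfer (fsquare_refl (appr_id M)) _ hs; exact: induces_id.
- move=> X Y Z _ _ [b ->] [a ->].
  have [M] := zpair_exists (ms_metrizable X).
  have [N] := zpair_exists (ms_metrizable Y).
  have [L] := zpair_exists (ms_metrizable Z).
  have [g ->] := fish_rep_at N L b; have [f ->] := fish_rep_at M N a.
  rewrite fish_cmp; apply/funext => s; apply/propext; split.
    move=> /Fish_to_ShE gfs.
    have [p] := anr_res_exists X; have [q] := anr_res_exists Y.
    have [r] := anr_res_exists Z.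
    have [F fF] := induces_ex f p q; have [G gG] := induces_ex g q r.
    have gf := induces_comp fF gG.
    exists (ShRep (induces_mor gG)), (ShRep (induces_mor fF)), (ShRep (induces_mor gf)).
    split; [exact/Fish_to_ShE|exact/Fish_to_ShE|exact: ShRcmp|].
    exact: (@induces_eqv X Z M M L L _ _ (ShRep (induces_mor gf)) s (fsquare_refl _) gf gfs).
  move=> [b' [a' [c [/Fish_to_ShE gb /Fish_to_ShE fa bac cs]]]].
  apply/Fish_to_ShE; apply: induces_transfer (fsquare_refl _) _ cs.
  by case: bac gb fa => p q r G hG F hF hGF /= gb fa; exact: induces_comp.
Qed.

Lemma Ho_to_ShE (X Y : metrSpace R) (c : arr (Ho R) X Y) :
  mor c -> Ho_to_Sh c = Fish_to_Sh (Ho_to_Fish c).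
Proof.
move=> [phi ->].
have [M] := zpair_exists (ms_metrizable X).
have [N] := zpair_exists (ms_metrizable Y).
have [f cf] := combines_exists M N phi.
rewrite (Ho_to_FishE cf); apply/funext => s; apply/propext; split.
  move=> [r' /(induces_over _ cf) fr rs]; apply/Fish_to_ShE.
  exact: induces_transfer (fsquare_refl f) fr rs.
move=> /Fish_to_ShE fs; exists s; first exact/(induces_over _ cf).
exact: (induces_eqv (fsquare_refl f) fs fs).
Qed.

End FineShapeToShape.

(** * Proper maps and approaching maps *)

Section Compactness.
Variable R : realType.
Local Notation I := (set_type (@unit_interval R)).
Implicit Types X Y U V M N : topologicalType.

(** An ultrafilter on [C] contains balls of every radius, and a cluster point of points chosen in
    finite intersections of such balls is its limit. *)
Lemma seq_compact M (C : set M) : metrizable R M ->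
  (forall v : nat -> M, (forall n, C (v n)) ->
    exists2 x, C x & cluster (v @ \oo) x) -> compact C.
Proof.
move=> [d dM] H; rewrite compact_ultra => F FU FC.
have ctr (e : R) : 0 < e -> exists c, F [set x | d c x < e].
  move=> e0; apply: contrapT => Hn.
  have far (c : M) : F [set x | ~ d c x < e].
    have [Fc|//] := in_ultra_setVsetC [set x | d c x < e] FU.
    by case: Hn; exists c.
  have FS (s : seq M) : F [set x | forall c, c \in s -> ~ d c x < e].
    elim: s => [|c s IH]; first by apply: filterS FC => x _ c.
    apply: filterS (filterI (far c) IH) => x [/= cx sx] c'.
    by rewrite inE => /orP[/eqP ->|/sx].
  have pick_ (s : seq M) : exists x, C x /\ forall c, c \in s -> ~ d c x < e.
    have FCs : F (C `&` [set x | forall c, c \in s -> ~ d c x < e]) by exact: filterI.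
    by have [x [Cx sx]] := filter_ex FCs; exists x.
  have [pk pkP] := choice pick_.
  (* Greedy choice: [l n] lists the terms before the n-th, and the next term has distance at least
     [e] from all of them, which excludes a cluster point. *)
  pose l := fix l n := if n is n'.+1 then pk (l n') :: l n' else [::].
  pose v n := pk (l n).
  have lv m n : (m < n)%N -> v m \in l n.
    elim: n => // n IH; rewrite ltnS leq_eqVlt inE => /orP[/eqP ->|/IH ->].
      by rewrite eqxx.
    by rewrite orbT.
  have vfar m n : (m < n)%N -> e <= d (v m) (v n).
    by move=> mn; rewrite leNgt; apply/negP/(pkP (l n)).2/lv.
  have [x Cx cl] := H v (fun n => (pkP (l n)).1).
  have e2 : 0 < e / 2 by lra.
  move/(cluster_seqP _ _ dM): cl => cl.
  have [m _ xm] := cl _ 0%N e2; have [n mn xn] := cl _ m.+1 e2.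
  have := vfar m n mn; have := metr_tri dM x (v m) (v n).
  by rewrite (metr_sym dM (v m) x); lra.
have /choice [c cP] : forall n, exists c, F [set x | d c x < n.+1%:R^-1].
  by move=> n; apply: ctr; rewrite invr_gt0.
have Fc n : F [set x | forall k, (k <= n)%N -> d (c k) x < k.+1%:R^-1].
  elim: n => [|n IH].
    by apply: filterS (cP 0%N) => x x0 k; rewrite leqn0 => /eqP ->.
  apply: filterS (filterI (cP n.+1) IH) => x [/= x0 xn] k.
  by rewrite leq_eqVlt => /orP[/eqP ->//|]; exact: xn.
have /choice [v vP] : forall n, exists v,
    C v /\ forall k, (k <= n)%N -> d (c k) v < k.+1%:R^-1.
  move=> n; have FCn : F (C `&` [set x | forall k, (k <= n)%N -> d (c k) x < k.+1%:R^-1]).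
    exact: filterI.
  by have [x [Cx xP]] := filter_ex FCn; exists x.
have [x Cx cl] := H v (fun n => (vP n).1).
exists x; split=> // B /(nbhs_metr dM) [e e0 eB].
(* Three steps: from [x] to [v n], from there to the centre [c k], and on to [y]. *)
have e3 : 0 < e / 3 by lra.
have [k ke] := inv_succ_lt e3.
move/(cluster_seqP _ _ dM): cl => /(_ _ k e3) [n kn xn].
suff : F [set y | d x y < e] by apply: filterS => y; exact: eB.
apply: filterS (cP k) => y /= ky.
have h1 := lt_trans ((vP n).2 k kn) ke; have h2 := lt_trans ky ke.
have := metr_tri dM (v n) x y.
have := metr_tri dM (c k) (v n) y; rewrite (metr_sym dM (v n) (c k)); lra.
Qed.

(** [U] is the complement of [A] in [M] with the subspace topology, kept abstract so that it also
    covers the product of a complement with the interval. *)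
Definition complement_of U M (a : U -> M) (A : set M) : Prop :=
  [/\ continuous a, forall u, ~ A (a u), forall x, ~ A x -> exists u, a u = x &
      forall u B, nbhs u B -> \forall m \near a u, forall v, a v = m -> B v].

Lemma complement_zcompl X (M : zpair R X) :
  complement_of (fun u : zcompl M => val u : M) (range (zincl M)).
Proof.
split.
- exact: val_continuous.
- exact: zcompl_not.
- by move=> x Xx; exists (exist _ x (mem_set (Xx : zcompl M x))).
- move=> u B [_ [[W oW <-] /= Wu] WB].
  apply: filterS (open_nbhs_nbhs (conj oW Wu)) => m Wm v vm.
  by apply: WB; rewrite /= -vm in Wm *.
Qed.

Lemma complement_ofI U M (a : U -> M) (A : set M) : complement_of a A ->
  complement_of (fun p : (U * I)%type => (a p.1, p.2)) (A `*` [set: I]).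
Proof.
move=> [ca aA Aa na]; split.
- move=> p; apply: continuous_pair; last exact: continuous_snd.
  by apply: (@continuous_comp _ _ _ fst a); [exact: continuous_fst|exact: ca].
- by move=> p [] /aA.
- move=> [x t] xA; have [u ux] : exists u, a u = x by apply: Aa => Ax; apply: xA.
  by exists (u, t); rewrite /= ux.
- move=> [u t] B [[B1 B2] /= [n1 n2] B12].
  exists ([set m | forall v, a v = m -> B1 v], B2); first by split=> //; exact: na.
  by move=> [m s] [/= h1 h2] [v s'] [/= vm ss]; apply: B12; split=> /=; [exact: h1|rewrite ss].
Qed.

Lemma complement_compact U M (a : U -> M) (A S : set M) : complement_of a A ->
  compact [set: M] -> closed S -> (forall x, S x -> ~ A x) -> compact (a @^-1` S).
Proof.
move=> [ca aA Aa na] cM cS SA F PF FS.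
have cS' : compact S by exact: (subclosed_compact cS cM).
have [x [Sx cl]] := cS' (a @ F) _ FS.
have [u ux] := Aa x (SA x Sx); exists u; split; first by rewrite /= ux.
move=> B O FB nO.
have FB' : F (a @^-1` (a @` B)) by apply: filterS FB => v Bv; exists v.
have := na u O nO; rewrite ux => nO'.
by have [_ [[v Bv <-] Ov]] := cl _ _ FB' nO'; exists v; split=> //; exact: Ov.
Qed.

Lemma compact_cluster_seq M (v : nat -> M) : compact [set: M] ->
  exists x, cluster (v @ \oo) x.
Proof. by move=> cM; have [x [_ cl]] := cM (v @ \oo) _ filterT; exists x. Qed.

(** The images cluster at some [y] as [N] is compact. If [y] were off [B], a closed ball about it
    missing [B] would have a compact preimage, closed in [M] and accumulating at the point [x] of
    [A]. *)
Lemma proper_approaching U M V N (a : U -> M) (A : set M) (b : V -> N)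
    (B : set N) (f : U -> V) :
  complement_of a A -> complement_of b B -> metrizable R M -> metrizable R N ->
  compact [set: N] -> closed B -> proper f -> approaching a A b B f.
Proof.
move=> [ca aA _ _] cb mM [dN dNm] cN cB pf u [x Ax cl].
have [d dM] := mM.
have [|s [sn sx _]] := @subseq_cluster _ _ _ (a \o u) setT x dM.
  move/(cluster_seqP _ _ dM): cl => cl e n e0.
  by have [m nm xm] := cl e n e0; exists m.
have [y cy] := compact_cluster_seq (b \o f \o u \o s) cN.
exists y; last exact: (@cluster_subseq _ _ s).
apply: contrapT => By.
have /(nbhs_metr dNm) [e e0 eB] : nbhs y (~` B).
  by apply: open_nbhs_nbhs; split=> //; exact: closed_openC.
pose S := [set n | dN y n <= e / 2].
have cS : closed S.
  move=> n cln; have e4 : 0 < e / 4 by lra.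
  rewrite /S /=; apply/ler_addgt0Pr => r r0.
  have [n' [Sn' nn']] := cln _ (near_metr dNm n r0).
  have := metr_tri dNm n' y n; rewrite (metr_sym dNm n' n) /=.
  by move: Sn' nn'; rewrite /S /=; lra.
have SB n : S n -> ~ B n by rewrite /S /= => Sn; apply: eB; lra.
have cC := pf _ (complement_compact cb cN cS SB).
have : compact (a @` (f @^-1` (b @^-1` S))).
  by apply: continuous_compact cC; exact: continuous_subspaceT.
move=> /(compact_closed (metrizable_hausdorff mM)) cl'.
suff : (a @` (f @^-1` (b @^-1` S))) x by move=> [v _ vx]; apply: (aA v); rewrite vx.
apply: cl' => O /(nbhs_metr dM) [r r0 rO].
have [k kr] := inv_succ_lt r0; have e2 : 0 < e / 2 by lra.
move/(cluster_seqP _ _ dNm): cy => /(_ _ k e2) [n kn yn].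
exists (a (u (s n))); split; first by exists (u (s n)) => //=; exact: ltW.
apply: rO; apply: lt_trans (sx n) _; apply: le_lt_trans kr.
by rewrite lef_pV2 ?posrE// ler_nat ltnS.
Qed.

(** The preimage of a compact [C] cannot accumulate at [A]: the images would cluster in [B] although
    they stay in the compact set [C]. *)
Lemma approaching_proper U M V N (a : U -> M) (A : set M) (b : V -> N)
    (B : set N) (f : U -> V) :
  complement_of a A -> complement_of b B -> metrizable R M -> metrizable R N ->
  compact [set: M] -> hausdorff_space V -> continuous f ->
  approaching a A b B f -> proper f.
Proof.
move=> ca [cb bB _ _] [d dM] mN cM hV cf af C cC.
pose S := closure (a @` (f @^-1` C)).
have SA x : S x -> ~ A x.
  move=> Sx Ax.
  have /choice [u uP] : forall n, exists u,
      C (f u) /\ d x (a u) < n.+1%:R^-1.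
    move=> n; have n0 : 0 < n.+1%:R^-1 :> R by rewrite invr_gt0.
    by have [_ [[v Cv <-] xv]] := Sx _ (near_metr dM x n0); exists v.
  have [|y By cy] := af u.
    by exists x => //; apply: (subseq_cluster_cluster dM) => n; have [] := uP n.
  have : compact (b @` C).
    by apply: continuous_compact cC; exact: continuous_subspaceT.
  move=> /(compact_closed (metrizable_hausdorff mN)) cbC.
  suff : (b @` C) y by move=> [v _ vy]; apply: (bB v); rewrite vy.
  apply: cbC => O nO.
  have : (b @` C) `&` O !=set0.
    apply: cy nO; exists 0%N => // n _ /=.
    by exists (f (u n)) => //; have [] := uP n.
  by [].
have cS := complement_compact ca cM (@closed_closure _ _) SA.
apply: (subclosed_compact _ cS).
  apply: preimage_closed => [v _|]; first exact: cf.
  exact: compact_closed.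
by move=> v Cv; apply: subset_closure; exists v.
Qed.

(** A sequence in the compact [M] clusters in [A], where the approaching property applies, or off
    [A], where continuity does; either way the images cluster. *)
Lemma approaching_image_compact U M Y (L : zpair R Y) (a : U -> M) (A : set M)
    (f : U -> zcompl L) :
  complement_of a A -> metrizable R M -> compact [set: M] -> continuous f ->
  approaching a A (fun v : zcompl L => val v : L) (range (zincl L)) f ->
  compact (closure (range (fun u => val (f u) : L))).
Proof.
move=> [ca aA Aa na] [d dM] cM cf af.
have mL := zspace_metrizable L; have [dL dLm] := mL.
apply: seq_compact => // v vC.
have /choice [u uP] : forall n, exists u, dL (v n) (val (f u)) < n.+1%:R^-1.
  move=> n; have n0 : 0 < n.+1%:R^-1 :> R by rewrite invr_gt0.
  by have [_ [[w _ <-] xw]] := vC n _ (near_metr dLm (v n) n0); exists w.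
have [y cy] : exists y, cluster ((fun n => val (f (u n)) : L) @ \oo) y.
  have [x cx] := compact_cluster_seq (a \o u) cM.
  have [Ax|nAx] := pselect (A x).
    by have [|y _ cy] := af u; [exists x|exists y].
  have [w wx] := Aa x nAx; exists (val (f w)) => S O nS nO.
  have nO' : nbhs w ((fun w => val (f w) : L) @^-1` O).
    have := @continuous_comp _ _ _ f (fun v : zcompl L => val v : L) w (cf w)
      (@val_continuous _ _ _).
    exact.
  have := na w _ nO'; rewrite wx => nO''.
  have nS' : ((a \o u) @ \oo) (a @` (fun w => S (val (f w)))).
    have : \forall n \near \oo, S (val (f (u n))) by [].
    by apply: filterS => n Sn; exists (u n).
  have [_ [[w' Sw' <-] Ow']] := cx _ _ nS' nO''.
  by exists (val (f w')); split=> //; exact: Ow'.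
exists y.
  move=> O nO; have : (range (fun u => val (f u) : L)) `&` O !=set0.
    by apply: cy => //; exists 0%N => // n _; exists (u n).
  by [].
apply/(cluster_seqP _ _ dLm) => e n e0; have e2 : 0 < e / 2 by lra.
have [k ke] := inv_succ_lt e2.
move/(cluster_seqP _ _ dLm): cy => /(_ _ (maxn n k) e2) [m nm ym].
exists m; first exact: leq_trans (leq_maxl _ _) nm.
have : dL (v m) (val (f (u m))) < e / 2.
  apply: lt_trans (uP m) _; apply: le_lt_trans ke.
  by rewrite lef_pV2 ?posrE// ler_nat ltnS (leq_trans (leq_maxr _ _) nm).
have := metr_tri dLm (val (f (u m))) y (v m).
by rewrite (metr_sym dLm (val (f (u m))) (v m)); lra.
Qed.

End Compactness.

(** * From fine shape to antishape *)

Section FineShapeToAntishape.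
Variable R : realType.
Local Notation I := (set_type (@unit_interval R)).
Local Notation I0 := (@I0 R).
Local Notation I1 := (@I1 R).

Section CompactPairs.
Variables (K L : compactum R) (P : czpair R K) (Q : czpair R L).

Lemma zrange_closed (X : topologicalType) (M : zpair R X) :
  closed (range (zincl M)).
Proof. by have [] := z_Zset M. Qed.

Lemma prop_map_approaching (f : prop_map (zcompl P) (zcompl Q)) :
  z_approaching f.
Proof.
apply: (proper_approaching (complement_zcompl P) (complement_zcompl Q)).
- exact: zspace_metrizable.
- exact: zspace_metrizable.
- exact: cz_compact.
- exact: zrange_closed.
- exact: prop_proper.
Qed.

Definition prop_appr (f : prop_map (zcompl P) (zcompl Q)) : appr P Q :=
  Appr (prop_map_approaching f).

Lemma zcompl_hausdorff (X : topologicalType) (M : zpair R X) :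
  hausdorff_space (zcompl M).
Proof.
by apply: (@metrizable_hausdorff R); apply: metrizable_sub; exact: zspace_metrizable.
Qed.

Lemma appr_proper (f : appr P Q) : proper f.
Proof.
apply: (approaching_proper (complement_zcompl P) (complement_zcompl Q)).
- exact: zspace_metrizable.
- exact: zspace_metrizable.
- exact: cz_compact.
- exact: zcompl_hausdorff.
- exact: cts_fun.
- exact: appr_approaching.
Qed.

Lemma prop_homotopicP (f g : prop_map (zcompl P) (zcompl Q)) :
  prop_homotopic R f g <-> appr_homotopic (prop_appr f) (prop_appr g).
Proof.
have cP := complement_ofI R (complement_zcompl P).
have cQ := complement_zcompl Q.
have mPI := metrizable_prod (zspace_metrizable P) (metrizable_I R).
have cPI : compact [set: (P * I)%type].
  by rewrite -setXTT; apply: compact_setX; [exact: cz_compact|exact: compact_I].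
split=> [[H [H0 H1]]|[H [aH H0 H1]]].
  exists H; split=> //; apply: (proper_approaching cP cQ mPI (zspace_metrizable Q)).
  - exact: cz_compact.
  - exact: zrange_closed.
  - exact: prop_proper.
have pH : proper H.
  apply: (approaching_proper cP cQ mPI (zspace_metrizable Q)) => //.
  - exact: zcompl_hausdorff.
  - exact: cts_fun.
by exists (PropMap pH).
Qed.

End CompactPairs.

Lemma ssh_eqvP (K L : compactum R) (r s : ssh_rep K L) :
  ssh_eqv r s <->
  fsquare (ctsid K) (ctsid L) (prop_appr (ssh_map r)) (prop_appr (ssh_map s)).
Proof.
split=> [[i [j [ci cj /prop_homotopicP H]]]|[i [j [ci cj H]]]].
  by exists (prop_appr i), (prop_appr j); split.
exists (PropMap (@appr_proper _ _ _ _ i)), (PropMap (@appr_proper _ _ _ _ j)); split=> //.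
apply: (@prop_homotopicP K L (ssh_dom r) (ssh_cod s)
  (prop_comp (PropMap (@appr_proper _ _ _ _ j)) (ssh_map r))
  (prop_comp (ssh_map s) (PropMap (@appr_proper _ _ _ _ i)))).2.
by move: H; apply: appr_homotopic_ext.
Qed.

(* [M] and [N] need not be compact, so [f] itself need not be proper *)
Definition ssh_class (K L : compactum R) (M : zpair R K) (N : zpair R L)
    (f : appr M N) : arr (Ssh R) K L :=
  fun s => fsquare (ctsid K) (ctsid L) f (prop_appr (ssh_map s)).

Section StrongShapeClasses.
Variables (K L : compactum R).

(** Moved to compact ARs, an approaching map becomes proper; so the class of any approaching map
    contains strong shape representatives. *)
Lemma ssh_class_at (M : zpair R K) (N : zpair R L) (f : appr M N)
    (P : czpair R K) (Q : czpair R L) :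
  exists g : prop_map (zcompl P) (zcompl Q), ssh_class f (SshRep g).
Proof.
have [g fg] := appr_at P Q f; exists (PropMap (@appr_proper _ _ _ _ g)).
by have [i [j [ci cj H]]] := fg; exists i, j.
Qed.

Lemma ssh_class_eq (M M' : zpair R K) (N N' : zpair R L) (f : appr M N)
    (f' : appr M' N') :
  ssh_class f = ssh_class f' <-> fsquare (ctsid K) (ctsid L) f f'.
Proof.
split=> [E|ff].
  have [P] := czpair_exists K; have [Q] := czpair_exists L.
  have [g fg] := ssh_class_at f P Q; have := fg; rewrite E => f'g.
  exact: fsquare_trans fg (fsquare_sym f'g).
apply/funext => s; apply/propext; split=> [fs|f's].
  exact: fsquare_trans (fsquare_sym ff) fs.
exact: fsquare_trans ff f's.
Qed.

Lemma ssh_eqv_class (r : ssh_rep K L) :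
  ssh_eqv r = ssh_class (prop_appr (ssh_map r)).
Proof. by apply/funext => s; apply/propext; exact: ssh_eqvP. Qed.

Lemma ssh_class_mor (M : zpair R K) (N : zpair R L) (f : appr M N) :
  mor (ssh_class f).
Proof.
have [P] := czpair_exists K; have [Q] := czpair_exists L.
have [g fg] := ssh_class_at f P Q; exists (SshRep g).
by rewrite (ssh_eqv_class (SshRep g)); apply/ssh_class_eq.
Qed.

Lemma mor_ssh_class (M : zpair R K) (N : zpair R L) (c : arr (Ssh R) K L) :
  mor c -> exists f : appr M N, c = ssh_class f.
Proof.
move=> [r ->]; have [f rf] := appr_at M N (prop_appr (ssh_map r)).
by exists f; rewrite ssh_eqv_class; apply/ssh_class_eq.
Qed.

Lemma ssh_class_change (M M' : zpair R K) (N N' : zpair R L) (f : appr M N) :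
  exists2 f' : appr M' N', ssh_class f = ssh_class f' &
    fsquare (ctsid K) (ctsid L) f f'.
Proof. by have [f' ff] := appr_at M' N' f; exists f' => //; exact/ssh_class_eq. Qed.

Lemma ssh_ofE (M : zpair R K) (N : zpair R L) (phi : continuousType K L)
    (f : appr M N) : combines phi f -> ssh_of phi = ssh_class f.
Proof.
move=> cf; apply/funext => s; apply/propext; split.
  move=> [r cr /ssh_eqvP rs]; apply: fsquare_trans rs.
  by apply: (fsquare_combines cf) => //.
move=> fs; have [P] := czpair_exists K; have [Q] := czpair_exists L.
have [g cg] := combines_exists P Q phi.
exists (SshRep (PropMap (@appr_proper _ _ _ _ g))) => //.
apply/ssh_eqvP; apply: fsquare_trans fs.
by apply: (@fsquare_combines R K L K L _ _ _ _ (ctsid K) (ctsid L) phi phi).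
Qed.

Lemma ssh_idmE (M : zpair R K) : @idm _ (Ssh R) K = ssh_class (appr_id M).
Proof.
apply/funext => s; apply/propext; split=> [[r [rid rs]]|ms].
  case: rid rs => P /ssh_eqvP rs; apply: fsquare_trans rs.
  by apply: (@fsquare_combines R K K K K _ _ _ _ (ctsid K) (ctsid K) (ctsid K) (ctsid K)) => //;
    exact: combines_id.
have [P] := czpair_exists K; exists (@SshRep _ K K P P (prop_id _)).
split; first exact: SshRid.
apply/ssh_eqvP; apply: fsquare_trans ms.
by apply: (@fsquare_combines R K K K K _ _ _ _ (ctsid K) (ctsid K) (ctsid K) (ctsid K)) => //;
  exact: combines_id.
Qed.

End StrongShapeClasses.

Lemma ssh_cmpE (K L J : compactum R) (M : zpair R K) (N : zpair R L)
    (O : zpair R J) (f : appr M N) (g : appr N O) :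
  cmp (ssh_class g) (ssh_class f) = ssh_class (appr_comp g f).
Proof.
have ext (P : czpair R K) (Q : czpair R L) (S : czpair R J)
    (f' : prop_map (zcompl P) (zcompl Q)) (g' : prop_map (zcompl Q) (zcompl S)) :
    ssh_class f (SshRep f') -> ssh_class g (SshRep g') ->
    ssh_class (appr_comp g f) (SshRep (prop_comp g' f')).
  move=> ff gg; have [i [k [ci ck H]]] := fsquare_hcomp ff gg.
  by exists i, k; split=> //; apply: appr_homotopic_ext H.
apply/funext => s; apply/propext; split.
  move=> [b [a [c [gb fa bac /ssh_eqvP cs]]]].
  case: bac gb fa cs => P Q S g' f' gb fa cs.
  exact: fsquare_trans (ext _ _ _ _ _ fa gb) cs.
move=> gfs; have [P] := czpair_exists K; have [Q] := czpair_exists L.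
have [S] := czpair_exists J.
have [f' ff] := ssh_class_at f P Q; have [g' gg] := ssh_class_at g Q S.
exists (SshRep g'), (SshRep f'), (SshRep (prop_comp g' f')); split=> //.
apply/ssh_eqvP; apply: fsquare_trans gfs; apply: fsquare_sym; exact: ext.
Qed.

Definition csub_val (X : metrSpace R) (K : csub X) :
    continuousType (cspace K) X :=
  [the continuousType (set_type K) X of mkcts (@val_continuous X K)].

Lemma inclE (X : metrSpace R) (K L : csub X) (KL : K `<=` L)
    (M : zpair R (cspace K)) (N : zpair R (cspace L))
    (phi : continuousType (cspace K) (cspace L)) (f : appr M N) :
  (forall x, val (phi x) = val x) -> combines phi f -> incl KL = ssh_class f.
Proof.
move=> pv cf; apply: ssh_ofE.
rewrite (_ : sub_map _ = phi)//; apply/continuousEP => x.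
by apply: val_inj; rewrite pv.
Qed.

Lemma csub_closed (X : metrSpace R) (K : csub X) : closed K.
Proof.
apply: compact_closed; last exact: cset_compact.
exact: metrizable_hausdorff (ms_metrizable X).
Qed.

Lemma closed_embedding_val (X : topologicalType) (A : set X) :
  closed A -> closed_embedding (fun x : A => val x).
Proof.
move=> cA; split; first exact: val_inj.
  exact: val_continuous.
move=> B cB; have [W oW WB] := closed_openC cB.
rewrite (_ : _ @` B = A `&` ~` W); first exact: closedI cA (open_closedC oW).
apply/seteqP; split=> [_ [x Bx <-]|x [Ax Wx]].
  split; first exact: (set_mem (valP x)).
  by move=> Wx; have : (~` B) x by rewrite -WB.
exists (exist _ x (mem_set Ax)) => //; apply: contrapT => Bx.
by have : (~` B) (exist _ x (mem_set Ax)) by []; rewrite -WB.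
Qed.

Lemma closed_embedding_comp (X Y Z : topologicalType) (f : X -> Y) (g : Y -> Z) :
  closed_embedding f -> closed_embedding g -> closed_embedding (g \o f).
Proof.
move=> [fi cf fcl] [gi cg gcl]; split.
- by move=> x y /gi/fi.
- by move=> x; apply: continuous_comp; [exact: cf|exact: cg].
- by move=> A /fcl/gcl; rewrite image_comp.
Qed.

Section Neighbourhoods.
Variables (Y : metrSpace R) (N : zpair R Y).

Lemma zpreimage_compact (C : set N) : compact C -> compact (zincl N @^-1` C).
Proof.
move=> cC; have [[y0]|Y0] := pselect (inhabited Y); last first.
  by rewrite (_ : _ @^-1` _ = set0); [exact: compact0|apply/seteqP; split=> // y; case: Y0].
have [s sK cs] := closed_embedding_inv y0 (z_emb N).
have cCr : compact (C `&` range (zincl N)).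
  by apply: compact_closedI => //; exact: zrange_closed.
have -> : zincl N @^-1` C = s @` (C `&` range (zincl N)).
  apply/seteqP; split=> [y Cy|_ [n [Cn [y _ yn]] <-]]; last by move: Cn; rewrite -yn /= sK.
  by exists (zincl N y); rewrite ?sK//; split=> //; exists y.
by apply: continuous_compact cCr; apply: continuous_subspaceW cs => ? [].
Qed.

Variables (L : csub Y) (Q : zpair R (cspace L)).

Local Notation zL := (zincl N @` L).

Lemma zimage_closed : closed zL.
Proof. by have [_ _ cl] := z_emb N; apply: cl; exact: csub_closed. Qed.

(** The tool for compressing maps towards [L]: it is the identity on [L], and it is approaching for
    sequences that cluster in [L], though not at other points of [Y]. *)
Lemma zimage_retraction : exists (e : N -> Q) (e' : continuousType (zcompl N) (zcompl Q)),
  [/\ continuous e, forall l : cspace L, e (zincl N (val l)) = zincl Q l &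
      forall v, val (e' v) = e (val v)].
Proof.
have emb := closed_embedding_comp (closed_embedding_val (csub_closed (K := L))) (z_emb N).
have [F cF FL] := ext_AR (zspace_metrizable N) emb (z_AR Q) (zincl_continuous (M := Q)).
have [e [ce eL eN]] := push_off (zspace_metrizable N) zimage_closed cF.
have cev : continuous (fun v : zcompl N => e (val v)).
  move=> v; apply: (@continuous_comp _ _ _ (fun v : zcompl N => val v : N) e).
    exact: val_continuous.
  exact: ce.
have [v|e' e'E] := zcompl_fun cev.
  by apply: eN => -[y _ yv]; apply: (@zcompl_not _ _ N v); exists y.
exists e, e'; split=> // l; rewrite eL; last by exists (val l) => //; exact: (set_mem (valP l)).
exact: FL.
Qed.

End Neighbourhoods.

(** Expresses, without a choice of compression, that the restriction of [f] to [K] factors through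
    the class [t] into [L]: the square over the two inclusions commutes in the fine shape
    category. *)
Definition ash_of (X Y : metrSpace R) (M : zpair R X) (N : zpair R Y)
    (f : appr M N) (K : csub X) : ind_elt (cspace K) Y -> Prop :=
  fun t => exists (P : zpair R (cspace K)) (Q : zpair R (cspace (tag t)))
    (g : appr P Q), tagged t = ssh_class g /\ fsquare (csub_val K) (csub_val (tag t)) g f.

Section AntishapeClasses.
Variables (X Y : metrSpace R) (M : zpair R X) (N : zpair R Y).

Lemma ash_of_ex (f : appr M N) (K : csub X) :
  exists t : ind_elt (cspace K) Y, mor (tagged t) /\ ash_of f t.
Proof.
have [P] := czpair_exists (cspace K).
have [i ci] := combines_exists P M (csub_val K).
pose h := appr_comp f i.
have cC : compact (closure (range (fun u => val (h u) : N))).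
  apply: (approaching_image_compact (complement_zcompl P)).
  - exact: zspace_metrizable.
  - exact: cz_compact.
  - exact: cts_fun.
  - exact: appr_approaching.
(* The part of [Y] in the closure of the image; all cluster points in [Y] of values of [h] lie
   here. *)
pose L : csub Y := CSub (zpreimage_compact cC).
have [Q] := zpair_exists (cpt_metrizable (cspace L)).
have [e [e' [ce eL e'E]]] := zimage_retraction N Q.
have ah : approaching (fun u : zcompl P => val u : P) (range (zincl P))
    (fun v : zcompl N => val v : N) (zincl N @` L) h.
  move=> u cu; have [_ [y _ <-] cy] := appr_approaching h cu.
  exists (zincl N y) => //; exists y => //= O nO; apply: cy nO.
  by exists 0%N => // n _; exists (u n).
have ae : approaching (fun v : zcompl N => val v : N) (zincl N @` L)
    (fun v : zcompl Q => val v : Q) (range (zincl Q)) e'.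
  apply: (@approaching_ext _ _ _ _ _ _ _ _ _ e) => [n _|_ [y Ly <-]|v].
  - exact: ce.
  - by rewrite -[y]/(val (exist _ y (mem_set Ly) : L)) eL; exists (exist _ y (mem_set Ly)).
  - by rewrite e'E.
pose g : appr P Q := @Appr _ _ _ _ _ (ctscomp e' h) (approaching_comp ah ae).
have [j cj] := combines_exists Q N (csub_val L).
have [J [JL Jv]] := cj.
exists (Tagged (fun L => arr (Ssh R) (cspace K) (cspace L)) (ssh_class g)).
split; first exact: ssh_class_mor.
exists P, Q, g; split=> //; exists i, j; split=> //.
have nL (v : zcompl N) : ~ (zincl N @` L) (val v).
  by move=> [y _ yv]; apply: (@zcompl_not _ _ N v); exists y.
have cJe : continuous (J \o e).
  by move=> n; apply: continuous_comp; [exact: ce|exact: cts_fun].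
have JeL (y : Y) : (L : set Y) y -> J (e (zincl N y)) = zincl N y.
  by move=> Ly; rewrite -[y]/(val (exist _ y (mem_set Ly) : L)) eL JL.
(* Going to [Q] and back agrees with the identity on [L], hence is homotopic to it with control at
   [L]. Such control suffices after [h], which approaches [L]. *)
have [|||||H [aH H0 H1]] := @pushed_homotopic R Y N (zcompl N) N
    (fun v => val v) (zincl N @` L) (J \o e) idfun (j \o e') idfun
    (zspace_metrizable N) (@zimage_closed _ N L) (@val_continuous _ _) nL cJe.
- by move=> n; exact: cvg_id.
- by move=> _ [y Ly <-]; exact: JeL.
- by move=> _ [y Ly <-]; rewrite /= (JeL _ Ly); exists y.
- by move=> v; rewrite /= -Jv e'E.
- by [].
have c : continuous (fun z : zcompl P * I => H (h z.1, z.2)).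
  move=> z; apply: (@continuous_comp _ _ _ (fun z : zcompl P * I => (h z.1, z.2)) H).
    apply: continuous_pair; last exact: continuous_snd.
    apply: (@continuous_comp _ _ _ fst h); first exact: continuous_fst.
    exact: cts_fun.
  exact: cts_fun.
exists [the continuousType (zcompl P * I)%type (zcompl N) of mkcts c].
split=> [|u|u]; rewrite /= /mkcts ?H0 ?H1//.
apply: (@approaching_comp _ _ _ _ _ _ _ _ _ _ _ _ (fun z => (h z.1, z.2)) H); last exact: aH.
exact: (approaching_prodI (zspace_metrizable N) ah).
Qed.

Lemma csub_union3 (A B C : set Y) : compact A -> compact B -> compact C ->
  compact (A `|` B `|` C).
Proof. by move=> cA cB cC; apply: compactU => //; exact: compactU. Qed.

Lemma csub_incl (L L' : csub Y) (h : L `<=` L') :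
  exists phi : continuousType (cspace L) (cspace L'), forall x, val (phi x) = val x.
Proof. by exists (@sub_map R Y Y L L' (ctsid Y) (incl_proof h)). Qed.

(** Two factorizations are approaching homotopic in [N]. The compactness argument, applied to that
    homotopy, gives a compact set in which they can be compared after adding [L] and [L']. *)
Lemma ash_of_eqv (f : appr M N) (K : csub X) (t t' : ind_elt (cspace K) Y) :
  ash_of f t -> ash_of f t' -> ind_eqv t t'.
Proof.
move: t t' => [L c] [L' c'] [P1 [Q [g1 [/= -> gf1]]]] [P1' [Q' [g1' [/= -> gf1']]]].
have [P] := czpair_exists (cspace K).
have [g -> gg1] := ssh_class_change P Q g1.
have [g' -> gg1'] := ssh_class_change P Q' g1'.
have {gg1}gf : fsquare (csub_val K) (csub_val L) g f.
  by have := fsquare_vcomp (fsquare_sym gg1) gf1; rewrite !ctscomp_idr.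
have {gg1'}gf' : fsquare (csub_val K) (csub_val L') g' f.
  by have := fsquare_vcomp (fsquare_sym gg1') gf1'; rewrite !ctscomp_idr.
have [i ci] := combines_exists P M (csub_val K).
have [j cj] := combines_exists Q N (csub_val L).
have [j' cj'] := combines_exists Q' N (csub_val L').
have H1 := (fsquareP g f ci cj).1 gf.
have H2 := (fsquareP g' f ci cj').1 gf'.
have [H [aH H0 H1']] := appr_homotopic_trans H1 (appr_homotopic_sym H2).
have cC : compact (closure (range (fun u => val (H u) : N))).
  apply: (approaching_image_compact (complement_ofI R (complement_zcompl P))) aH.
  - by apply: metrizable_prod; [exact: zspace_metrizable|exact: metrizable_I].
  - by rewrite -setXTT; apply: compact_setX; [exact: cz_compact|exact: compact_I].
  - exact: cts_fun.
pose L2 : csub Y := CSub (csub_union3 (zpreimage_compact cC)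
  (@cset_compact _ _ L) (@cset_compact _ _ L')).
have LL2 : L `<=` L2 by move=> y Ly; left; right.
have LL2' : L' `<=` L2 by move=> y Ly; right.
have [Q2] := zpair_exists (cpt_metrizable (cspace L2)).
have [e [e' [ce eL e'E]]] := zimage_retraction N Q2.
have aH' : approaching (fun p : (zcompl P * I)%type => (val p.1 : P, p.2))
    (range (zincl P) `*` [set: I])
    (fun v : zcompl N => val v : N) (zincl N @` L2) H.
  move=> u cu; have [_ [y _ <-] cy] := aH u cu.
  exists (zincl N y) => //; exists y => //=; left; left => O nO; apply: cy nO.
  by exists 0%N => // n _; exists (u n).
have ae : approaching (fun v : zcompl N => val v : N) (zincl N @` L2)
    (fun v : zcompl Q2 => val v : Q2) (range (zincl Q2)) e'.
  apply: (@approaching_ext _ _ _ _ _ _ _ _ _ e) => [n _|_ [y Ly <-]|v].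
  - exact: ce.
  - by rewrite -[y]/(val (exist _ y (mem_set Ly) : L2)) eL; exists (exist _ y (mem_set Ly)).
  - by rewrite e'E.
(* The inclusion of [L0] into [L2] is represented by going to [N] and compressing, so the compressed
   homotopy joins the two composites. *)
have along (L0 : csub Y) (Q0 : zpair R (cspace L0)) (j0 : appr Q0 N)
    (L02 : L0 `<=` L2) : combines (csub_val L0) j0 ->
    exists2 k : appr Q0 Q2, incl L02 = ssh_class k & forall u, k u = e' (j0 u).
  move=> [J [JL Jv]]; have [phi pv] := csub_incl L02.
  have eJ x : e (J (zincl Q0 x)) = zincl Q2 (phi x).
    by rewrite JL /= -eL pv.
  have ceJ : continuous (e \o J).
    by move=> x; apply: continuous_comp; [exact: cts_fun|exact: ce].
  have ak : z_approaching (ctscomp e' j0).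
    apply: (@approaching_ext _ _ _ _ _ _ _ _ _ (e \o J)) => [n _|_ [y _ <-]|v].
    - exact: ceJ.
    - by rewrite /= eJ; exists (phi y).
    - by rewrite /= Jv e'E.
  exists (Appr ak) => //; apply: (inclE _ pv).
  by exists [the continuousType Q0 Q2 of mkcts ceJ]; split=> [x|v];
    [exact: eJ|rewrite /= /mkcts /= Jv e'E].
have [k kE ke] := along L Q j LL2 cj.
have [k' kE' ke'] := along L' Q' j' LL2' cj'.
exists L2, LL2, LL2'; rewrite /= kE kE' !ssh_cmpE; apply/ssh_class_eq.
exists (appr_id P), (appr_id Q2); split; try exact: combines_id.
exists (ctscomp e' H); split.
- exact: (approaching_comp aH' ae).
- by move=> u; rewrite /= H0 /= ke.
- by move=> u; rewrite /= H1' /= ke'.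
Qed.

(** Both inclusions into [Y] factor through [L2], where the two classes agree. *)
Lemma ash_of_transfer (f : appr M N) (K : csub X) (t t' : ind_elt (cspace K) Y) :
  ash_of f t -> mor (tagged t') -> ind_eqv t t' -> ash_of f t'.
Proof.
move: t t' => [L c] [L' c'] [P [Q [g [/= -> gf]]]] mc' [L2 [/= LL2 [LL2' E]]].
have [Q'] := zpair_exists (cpt_metrizable (cspace L')).
have [Q2] := zpair_exists (cpt_metrizable (cspace L2)).
have [g' gE] := mor_ssh_class P Q' mc'; rewrite {}gE {mc'} in E *.
have [phi pv] := csub_incl LL2; have [phi' pv'] := csub_incl LL2'.
have [k ck] := combines_exists Q Q2 phi.
have [k' ck'] := combines_exists Q' Q2 phi'.
move: E; rewrite (inclE LL2 pv ck) (inclE LL2' pv' ck') !ssh_cmpE => /ssh_class_eq E.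
exists P, Q', g'; split=> //.
have s1 : fsquare (ctsid (cspace K)) phi' g' (appr_comp k' g').
  exists (appr_id P), k'; split=> //; first exact: combines_id.
  exact: (appr_homotopic_ext _ _ (appr_homotopic_refl (appr_comp k' g'))).
have [i ci] := combines_exists P M (csub_val K).
have [j cj] := combines_exists Q2 N (csub_val L2).
have valE (L0 : csub Y) (psi : continuousType (cspace L0) (cspace L2)) :
    (forall x, val (psi x) = val x) -> ctscomp (csub_val L2) psi = csub_val L0.
  by move=> pE; apply/continuousEP => x /=; exact: pE.
have s3 : fsquare (csub_val K) (csub_val L2) (appr_comp k g) f.
  exists i, j; split=> //.
  have cjk : combines (csub_val L) (appr_comp j k).
    by rewrite -(valE _ _ pv); exact: combines_comp.
  by have := (fsquareP g f ci cjk).1 gf; apply: appr_homotopic_ext.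
have := fsquare_vcomp (fsquare_vcomp s1 (fsquare_sym E)) s3.
by rewrite !ctscomp_idr ctscomp_idl (valE _ _ pv').
Qed.

Lemma ash_of_mor (f : appr M N) (K : csub X) (t : ind_elt (cspace K) Y) :
  ash_of f t -> mor (tagged t).
Proof. by move=> [P [Q [g [-> _]]]]; exact: ssh_class_mor. Qed.

Lemma ind_class_ash_of (f : appr M N) (K : csub X) (t : ind_elt (cspace K) Y) :
  ash_of f t -> ind_class t = ash_of f (K := K).
Proof.
move=> ft; apply/funext => t'; apply/propext; split=> [[mt tt']|ft'].
  exact: ash_of_transfer ft mt tt'.
by split; [exact: ash_of_mor ft'|exact: ash_of_eqv ft ft'].
Qed.

End AntishapeClasses.

Lemma ash_of_fsquare (X Y : metrSpace R) (M M' : zpair R X) (N N' : zpair R Y)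
    (f : appr M N) (f' : appr M' N') (K : csub X) (t : ind_elt (cspace K) Y) :
  fsquare (ctsid X) (ctsid Y) f f' -> ash_of f t -> ash_of f' t.
Proof.
move=> ff [P [Q [g [gt gf]]]]; exists P, Q, g; split=> //.
by have := fsquare_vcomp gf ff; rewrite !ctscomp_idl.
Qed.

Lemma ash_of_pre (X Y : metrSpace R) (M : zpair R X) (N : zpair R Y)
    (f : appr M N) (K K' : csub X) (KK : K `<=` K')
    (s : ind_elt (cspace K') Y) :
  ash_of f s -> ash_of f (ind_pre (incl KK) s).
Proof.
case: s => L c [P [Q [g [/= -> gf]]]].
have [P'] := zpair_exists (cpt_metrizable (cspace K)).
have [phi pv] := csub_incl KK; have [k ck] := combines_exists P' P phi.
exists P', Q, (appr_comp g k); split; first by rewrite /= (inclE KK pv ck) ssh_cmpE.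
have s1 : fsquare phi (ctsid (cspace L)) (appr_comp g k) g.
  exists k, (appr_id Q); split=> //; first exact: combines_id.
  exact: (appr_homotopic_ext _ _ (appr_homotopic_refl (appr_comp g k))).
have := fsquare_vcomp s1 gf.
rewrite (_ : ctscomp (csub_val K') _ = csub_val K); last first.
  by apply/continuousEP => x; exact: pv.
by rewrite ctscomp_idr.
Qed.

Lemma ash_of_comp (X Y Z : metrSpace R) (M : zpair R X) (N : zpair R Y)
    (L : zpair R Z) (f : appr M N) (g : appr N L) (K : csub X)
    (s : ind_elt (cspace K) Y) (t : ind_elt (cspace (tag s)) Z) :
  ash_of f s -> ash_of g t -> ash_of (appr_comp g f) (ind_pre (tagged s) t).
Proof.
move: s t => [L1 c] [L2 c'] /= [P [Q [h [/= -> hf]]]] [Q1 [S [k1 [/= -> kg1]]]].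
have [k -> kk1] := ssh_class_change Q S k1.
exists P, S, (appr_comp k h); split; first exact: ssh_cmpE.
apply: fsquare_hcomp hf _.
by have := fsquare_vcomp (fsquare_sym kk1) kg1; rewrite !ctscomp_idr.
Qed.

Definition Fish_to_Ash (X Y : metrSpace R) (A : arr (Fish R) X Y) :
    arr (Ash R) X Y :=
  fun K t => exists2 r, A r & ash_of (fish_map r) t.

Lemma Fish_to_AshE (X Y : metrSpace R) (r : fish_rep X Y) :
  Fish_to_Ash (fish_eqv r) = fun K => ash_of (fish_map r) (K := K).
Proof.
apply: functional_extensionality_dep => K; apply/funext => t; apply/propext.
split=> [[r' rr']|rt]; last by exists r => //; exact: fsquare_refl.
exact: ash_of_fsquare (fsquare_sym rr').
Qed.

Lemma Fish_to_Ash_functor : is_functor Fish_to_Ash.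
Proof.
split.
- move=> X Y _ [r ->]; rewrite Fish_to_AshE; split=> [K|K K' KK s sK].
    have [t [mt rt]] := ash_of_ex (fish_map r) K; exists t; split=> //.
    by rewrite (ind_class_ash_of rt).
  by rewrite (ind_class_ash_of (ash_of_pre KK sK)).
- move=> X; have [M] := zpair_exists (ms_metrizable X).
  rewrite (fish_idm M) Fish_to_AshE; apply: functional_extensionality_dep => K.
  apply/esym/ind_class_ash_of.
  have [P] := zpair_exists (cpt_metrizable (cspace K)).
  exists P, P, (appr_id P); split; first exact: ssh_idmE.
  by apply: (fsquare_combines (combines_id P) (combines_id M)).
- move=> X Y Z _ _ [b ->] [a ->].
  have [M] := zpair_exists (ms_metrizable X).
  have [N] := zpair_exists (ms_metrizable Y).
  have [L] := zpair_exists (ms_metrizable Z).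
  have [g ->] := fish_rep_at N L b; have [f ->] := fish_rep_at M N a.
  rewrite fish_cmp !Fish_to_AshE; apply: functional_extensionality_dep => K.
  apply/funext => t; apply/propext; split.
    move=> gft; have [s [_ fs]] := ash_of_ex f K.
    have [s' [_ gs]] := ash_of_ex g (tag s).
    by exists s, s'; split=> //; rewrite (ind_class_ash_of (ash_of_comp fs gs)).
  by move=> [s [s' [fs gs]]]; rewrite (ind_class_ash_of (ash_of_comp fs gs)).
Qed.

Lemma Ho_to_AshE (X Y : metrSpace R) (c : arr (Ho R) X Y) :
  mor c -> Ho_to_Ash c = Fish_to_Ash (Ho_to_Fish c).
Proof.
move=> [phi ->].
have [M] := zpair_exists (ms_metrizable X).
have [N] := zpair_exists (ms_metrizable Y).
have [f cf] := combines_exists M N phi.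
rewrite (Ho_to_FishE cf) Fish_to_AshE; apply: functional_extensionality_dep => K.
(* [Ho_to_Ash] uses every map in the class, each with its own image of [K]; all of them must give
   the same element of the colimit. *)
have key (psi : continuousType X Y) : homotopic R phi psi ->
    ash_of f (Tagged (fun L => arr (Ssh R) (cspace K) (cspace L))
      (ssh_of (@sub_map R X Y K (cimage psi K) psi (@subset_refl _ _)))).
  move=> pp; have [g cg] := combines_exists M N psi.
  have [P] := zpair_exists (cpt_metrizable (cspace K)).
  have [Q] := zpair_exists (cpt_metrizable (cspace (cimage psi K))).
  have [k ck] := combines_exists P Q (@sub_map R X Y K (cimage psi K) psi (@subset_refl _ _)).
  exists P, Q, k; split; first exact: ssh_ofE.
  have kg : fsquare (csub_val K) (csub_val (cimage psi K)) k g.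
    exact: (fsquare_combines ck cg).
  have gf : fsquare (ctsid X) (ctsid Y) g f.
    exists (appr_id M), (appr_id N); split; try exact: combines_id.
    have := appr_homotopic_sym (combines_homotopic pp cf cg).
    by apply: appr_homotopic_ext.
  by have := fsquare_vcomp kg gf; rewrite !ctscomp_idl.
apply/funext => t; apply/propext; split.
  by move=> [psi pp]; rewrite (ind_class_ash_of (key psi pp)).
move=> ft; exists phi; first exact: homotopic_refl.
by rewrite (ind_class_ash_of (key phi (homotopic_refl R phi))).
Qed.

End FineShapeToAntishape.

Theorem theorem6 (R : realType) :
  (exists F : forall X Y : metrSpace R, arr (Fish R) X Y -> arr (Sh R) X Y,
     is_functor F /\
     forall (X Y : metrSpace R) (c : arr (Ho R) X Y),
       mor c -> Ho_to_Sh c = F X Y (Ho_to_Fish c)) /\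
  (exists F : forall X Y : metrSpace R, arr (Fish R) X Y -> arr (Ash R) X Y,
     is_functor F /\
     forall (X Y : metrSpace R) (c : arr (Ho R) X Y),
       mor c -> Ho_to_Ash c = F X Y (Ho_to_Fish c)).
Proof.
split.
  by exists (@Fish_to_Sh R); split; [exact: Fish_to_Sh_functor|exact: Ho_to_ShE].
by exists (@Fish_to_Ash R); split; [exact: Fish_to_Ash_functor|exact: Ho_to_AshE].
Qed.
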